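(* Let $T$ be an interval exchange transformation of $d$ intervals satisfying the mixing Diophantine condition with integrability power $\tau\in(1,2)$, with associated sequence $\{n_l\}$ and constant $\kappa>1$. Let $f$ be a roof function with asymmetric logarithmic singularities at $a_1,\dots,a_{d-1}$, and let $C=-C^++C^-=-\sum_jC_j^++\sum_jC_j^-$. Define $$\widetilde U(r,x)=\max_{1\le k\le d-1}\max_{0\le i<r}\widetilde u_k(T^ix),\qquad \widetilde V(r,x)=\max_{1\le k\le d-1}\max_{0\le i<r}\widetilde v_k(T^ix).$$ For any $\varepsilon>0$ there exists $\overline r>0$ such that for $r\ge\overline r$, if $h^{(n_l)}\le r<h^{(n_{l+1})}$, $x\notin\Sigma_l$ and $x$ is not a singularity of $S_r(f)$, then $$S_r(f)(x)\le 2r+\mathrm{const}\max_{1\le k\le d-1}\max_{0\le i<r}\bigl|\log|T^ix-a_k|\bigr|,$$ $$S_r(f')(x)\le(C+\varepsilon)\,r\log r+(C^-+1)(\lfloor\kappa\rfloor+2)\,\widetilde V(r,x),$$ $$S_r(f')(x)\ge(C-\varepsilon)\,r\log r-(C^++1)(\lfloor\kappa\rfloor+2)\,\widetilde U(r,x),$$ $$|S_r(f'')(x)|\le\bigl(2\max\{\widetilde U(r,x),\widetilde V(r,x)\}+1\bigr)(C^++C^-+\varepsilon)\Bigl(r\log r+(\lfloor\kappa\rfloor+2)\bigl(\widetilde U(r,x)+\widetilde V(r,x)\bigr)\Bigr),$$ where $\mathrm{const}$ denotes a positive constant independent of $r$, $l$ and $x$.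
   Context: Interval exchange transformation (IET): given a permutation $\pi$ of $\{1,\dots,d\}$ and a positive vector $\underline\lambda$ with sum 1, put $a_j=\sum_{k\le j}\lambda_k$, $I_j=[a_{j-1},a_j)$, $I=[0,1]$; $T$ translates each $I_j$ so that the intervals are rearranged according to $\pi$: $T(x)=x-a_{j-1}+\sum_{k<\pi(j)}\lambda_{\pi^{-1}(k)}$ on $I_j$. Birkhoff sums: $S_r(g)(x)=\sum_{i=0}^{r-1}g(T^ix)$. The singularities of $S_r(f)$ are the points $x$ with $T^ix\in\{a_1,\dots,a_{d-1}\}$ for some $0\le i<r$. Asymmetric logarithmic singularities: $f$ is defined and $\mathscr{C}^\infty$ on $[0,1]\setminus\{a_1,\dots,a_{d-1}\}$, is not defined at $a_1,\dots,a_{d-1}$, has a positive minimum over its domain, and for each $j=1,\dots,d-1$ there are constants $C_j^\pm>0$ such that in a neighborhood of $a_j$, $f(x)=C_j^+|\log(x-a_j)|+e(x)$ for $x>a_j$ and $f(x)=C_j^-|\log(a_j-x)|+\widetilde e(x)$ for $x<a_j$, with $e,\widetilde e$ smooth bounded functions on $[0,1]$; moreover $C^+\neq C^-$, where $C^\pm=\sum_jC_j^\pm$. Auxiliary functions: $\widetilde u_k,\widetilde v_k$ ($1\le k\le d-1$) are the restrictions to $I$ of the 1-periodic functions given by $\widetilde u_k(x)=1/(x-a_k)$ for $x\in(a_k,a_k+1]$ and $\widetilde v_k(x)=1/(a_k-x)$ for $x\in[a_k-1,a_k)$. Rauzy–Veech induction: $T^{(0)}=T$, $I^{(0)}=I$,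 and $T^{(n+1)}$ is the first return map of $T^{(n)}$ to the interval $I^{(n+1)}$ obtained from $I^{(n)}$ by cutting off on the right an interval of length the minimum of the lengths of the last exchanged interval before and after applying $T^{(n)}$. $T^{(n)}$ is an IET of $d$ intervals $I^{(n)}_j$ on $I^{(n)}=[0,\lambda^{(n)})$, with length vector $\underline\lambda^{(n)}=(\lambda^{(n)}_j)$. For $m<n$, $A^{(m,n)}\in\mathrm{SL}_d(\mathbb{Z})$ is the nonnegative matrix whose $(i,j)$ entry is the number of visits to $I^{(m)}_i$ of the $T^{(m)}$-orbit of a point of $I^{(n)}_j$ up to its first return to $I^{(n)}$; thus $\underline\lambda^{(m)}=A^{(m,n)}\underline\lambda^{(n)}$. $\|A\|$ is the sum of absolute values of entries. $h^{(n)}_j$ is the first return time under $T$ of $I^{(n)}_j$ to $I^{(n)}$, and $h^{(n)}=\max_jh^{(n)}_j$. Mixing Diophantine condition with integrability power $\tau$ ($1<\tau<2$): there exist a sequence $\{n_l\}_{l\in\mathbb{N}}$ (increasing) and constants $\nu,\kappa>1$, $0<D<1$, $D'>0$, $\overline l\in\mathbb{N}$ such that for every $l$: (i) $\nu^{-1}\le\lambda_i^{(n_l)}/\lambda_j^{(n_l)}\le\nu$ for all $i,j$; (ii) $\kappa^{-1}\le h_i^{(n_l)}/h_j^{(n_l)}\le\kappa$ for all $i,j$; (iii) $A^{(n_l,n_{l+\overline l})}$ has positive entries and $d_H(A^{(n_l,n_{l+\overline l})}\underline a,A^{(n_l,n_{l+\overline l})}\underline b)\le\min\{D\,d_H(\underline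 a,\underline b),D'\}$ for all $\underline a,\underline b$ in the positive orthant of $\mathbb{R}^d$, where $d_H(\underline a,\underline b)=\log(\max_i\{a_i/b_i\}/\min_i\{a_i/b_i\})$; (iv) $\lim_{l\to\infty}l^{-\tau}\|A^{(n_l,n_{l+1})}\|=0$. (Such $T$ is uniquely ergodic.) The sets $\Sigma_l$: fix $\tau'$ with $\tau/2<\tau'<1$, let $\sigma_l=\bigl(\log\|A^{(n_l,n_{l+1})}\|/\log h^{(n_l)}\bigr)^{\tau'}$, and $$\Sigma_l=\bigcup_{k=1}^{d-1}\ \bigcup_{i=0}^{\lfloor\sigma_lh^{(n_{l+1})}\rfloor}T^{-i}\{x\in I:|a_k-x|\le\sigma_l\lambda^{(n_l)}\}.$$
   Formalization: The first inequality, for S_r(f), is proved only for roof functions with integral over [0,1] less than 2 (e.g. normalized to 1), since without such a normalization it fails, for instance when f ≥ 3 everywhere; the other three inequalities are unchanged. *)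

(* Defs.v *)
From HB Require Import structures.
From mathcomp Require Import all_boot all_order all_algebra all_fingroup.
From mathcomp Require Import all_classical all_reals all_analysis.

Set Implicit Arguments.
Unset Strict Implicit.
Unset Printing Implicit Defensive.

Import Order.TTheory GRing.Theory Num.Theory.
Import numFieldNormedType.Exports.

Local Open Scope classical_set_scope.
Local Open Scope ring_scope.

(* Intervals are indexed from 0: the index [j : 'I_d] stands for the interval
   number j+1, and [iet_perm j] is the position of that interval after the
   exchange. The total length is not normalized, since the maps produced by
   Rauzy-Veech induction live on shrinking intervals. *)
Record iet (R : realType) (d : nat) := IET {
  iet_len : 'I_d -> R;
  iet_perm : 'S_d;
  iet_len_gt0 : forall j, 0 < iet_len j }.

(* [endpt T j] is a_j = lambda_1 + ... + lambda_j, so that the interval with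
   index [j : 'I_d] is [endpt T j, endpt T j.+1). *)
Definition endpt (R : realType) (d : nat) (T : iet R d) (j : nat) : R :=
  \sum_(k < d | (k < j)%N) iet_len T k.

Definition total_len (R : realType) (d : nat) (T : iet R d) : R :=
  \sum_(k < d) iet_len T k.

Definition in_piece (R : realType) (d : nat) (T : iet R d) (j : 'I_d) (x : R)
    : bool :=
  endpt T j <= x < endpt T j.+1.

(* The identity outside [0, total_len T). *)
Definition iet_map (R : realType) (d : nat) (T : iet R d) (x : R) : R :=
  if [pick j | in_piece T j x] is Some j then
    x - endpt T j +
      \sum_(k < d | (k < iet_perm T j)%N) iet_len T ((iet_perm T)^-1%g k)
  else x.

Definition birkhoff (R : realType) (T g : R -> R) (r : nat) (x : R) : R :=
  \sum_(i < r) g (iter i T x).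

Definition singular (R : realType) (d : nat) (T : iet R d) (r : nat) (x : R)
    : Prop :=
  exists i k : nat,
    [/\ (i < r)%N, (0 < k < d)%N & iter i (iet_map T) x = endpt T k].

(* First return time to [0, b), with the convention 0 if x never returns. *)
Definition return_time (R : realType) (F : R -> R) (b x : R) : nat :=
  if pselect (exists n, [&& (0 < n)%N, 0 <= iter n F x & iter n F x < b])
    is left ex then ex_minn ex else 0%N.

Definition visits (R : realType) (d : nat) (T : iet R d) (b : R) (i : 'I_d)
    (x : R) : nat :=
  (\sum_(m < return_time (iet_map T) b x)
     in_piece T i (iter m (iet_map T) x))%N.

Definition last_before (R : realType) (d : nat) (T : iet R d) : R :=
  \sum_(j < d | j.+1 == d) iet_len T j.

Definition last_after (R : realType) (d : nat) (T : iet R d) : R :=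
  \sum_(j < d | (iet_perm T j).+1 == d) iet_len T j.

(* The first return map has d (and not d - 1) intervals exactly when the two
   last lengths differ. The last clause pins down the intervals exchanged by
   T': points of one of them visit the intervals of T equally often before
   returning (a d-interval exchange need not be recoverable from the
   underlying map alone). *)
Definition rv_step (R : realType) (d : nat) (T T' : iet R d) : Prop :=
  [/\ last_before T != last_after T,
      total_len T' = total_len T - Num.min (last_before T) (last_after T),
      forall x : R, 0 <= x < total_len T' ->
        iet_map T' x
          = iter (return_time (iet_map T) (total_len T') x) (iet_map T) x
    & forall (j : 'I_d) (x y : R), in_piece T' j x -> in_piece T' j y ->
        forall i, visits T (total_len T') i x = visits T (total_len T') i y].

Definition rauzy_veech (R : realType) (d : nat) (T : iet R d)
    (RV : nat -> iet R d) : Prop :=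
  RV 0%N = T /\ forall n, rv_step (RV n) (RV n.+1).

(* A^(m,n); the orbit is that of the left endpoint of the interval j. *)
Definition rv_matrix (R : realType) (d : nat) (RV : nat -> iet R d) (m n : nat)
    : 'M[R]_d :=
  \matrix_(i, j) (visits (RV m) (total_len (RV n)) i (endpt (RV n) j))%:R.

Definition mxnorm1 (R : realType) (d : nat) (A : 'M[R]_d) : R :=
  \sum_i \sum_j `|A i j|.

(* h^(n)_j, computed from the left endpoint of the interval j. *)
Definition height (R : realType) (d : nat) (RV : nat -> iet R d) (n : nat)
    (j : 'I_d) : nat :=
  return_time (iet_map (RV 0%N)) (total_len (RV n)) (endpt (RV n) j).

Definition max_height (R : realType) (d : nat) (RV : nat -> iet R d) (n : nat)
    : nat :=
  (\max_(j < d) height RV n j)%N.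

(* Hilbert distance on the positive orthant. The default 0 of the maximum is
   harmless because the ratios are positive; the minimum takes the maximum as
   its default value. *)
Definition max_ratio (R : realType) (d : nat) (a b : 'cV[R]_d) : R :=
  \big[Num.max/0]_(i < d) (a i 0 / b i 0).

Definition min_ratio (R : realType) (d : nat) (a b : 'cV[R]_d) : R :=
  \big[Num.min/max_ratio a b]_(i < d) (a i 0 / b i 0).

Definition hilbert_dist (R : realType) (d : nat) (a b : 'cV[R]_d) : R :=
  ln (max_ratio a b / min_ratio a b).

Definition mixing_diophantine (R : realType) (d : nat) (RV : nat -> iet R d)
    (tau : R) (n : nat -> nat) (kappa : R) : Prop :=
  {homo n : l m / (l < m)%N} /\ 1 < kappa /\
  exists (nu D D' : R) (lbar : nat),
    [/\ 1 < nu, 0 < D < 1, 0 < D',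
        forall l,
          let A := rv_matrix RV (n l) (n (l + lbar)%N) in
          [/\ forall i j : 'I_d,
                nu^-1 <= iet_len (RV (n l)) i / iet_len (RV (n l)) j <= nu,
              forall i j : 'I_d,
                kappa^-1 <= (height RV (n l) i)%:R / (height RV (n l) j)%:R
                         <= kappa,
              forall i j : 'I_d, 0 < A i j
            & forall a b : 'cV[R]_d,
                (forall i, 0 < a i 0) -> (forall i, 0 < b i 0) ->
                hilbert_dist (A *m a) (A *m b)
                  <= Num.min (D * hilbert_dist a b) D']
      & (l%:R `^ (- tau) * mxnorm1 (rv_matrix RV (n l) (n l.+1)))
          @[l --> \oo] --> (0 : R)].

Definition sigma (R : realType) (d : nat) (RV : nat -> iet R d) (n : nat -> nat)
    (tau' : R) (l : nat) : R :=
  (ln (mxnorm1 (rv_matrix RV (n l) (n l.+1))) / ln (max_height RV (n l))%:R)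
    `^ tau'.

Definition Sigma (R : realType) (d : nat) (RV : nat -> iet R d) (n : nat -> nat)
    (tau' : R) (l : nat) : set R :=
  \bigcup_(k in [set k : nat | (0 < k < d)%N])
    \bigcup_(i in [set i : nat |
        i%:Z <= Num.floor (sigma RV n tau' l * (max_height RV (n l.+1))%:R)])
      (iter i (iet_map (RV 0%N)) @^-1`
        [set x : R | 0 <= x <= 1 /\
           `|endpt (RV 0%N) k - x| <= sigma RV n tau' l * total_len (RV (n l))]).

(* Derivative along A: one-sided at an endpoint of A, and independent of the
   values of f outside A. *)
Definition diff_quotient (R : realType) (f : R -> R) (x y : R) : R :=
  (f y - f x) / (y - x).

Definition deriv_on (R : realType) (A : set R) (f : R -> R) (x : R) : R :=
  lim (diff_quotient f x y @[y --> within A x^']).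

Definition smooth_on (R : realType) (A : set R) (f : R -> R) : Prop :=
  forall (m : nat) (x : R), A x ->
    cvg (diff_quotient (iter m (deriv_on A) f) x y @[y --> within A x^']).

(* [0, 1] minus {a_1, ..., a_(d-1)}; the values that a total function [f] takes
   outside this set are irrelevant. *)
Definition roof_dom (R : realType) (d : nat) (T : iet R d) : set R :=
  [set x | 0 <= x <= 1 /\ forall k : nat, (0 < k < d)%N -> x != endpt T k].

Definition sumC (R : realType) (d : nat) (c : nat -> R) : R :=
  \sum_(1 <= k < d) c k.

Record asym_log_sing (R : realType) (d : nat) (T : iet R d) (f : R -> R)
    (Cp Cm : nat -> R) : Prop := AsymLogSing {
  als_smooth : smooth_on (roof_dom T) f;
  als_min : exists x0, [/\ roof_dom T x0, 0 < f x0
    & forall x, roof_dom T x -> f x0 <= f x];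
  als_const_gt0 : forall j, (0 < j < d)%N -> 0 < Cp j /\ 0 < Cm j;
  als_right : forall j, (0 < j < d)%N ->
    exists e : R -> R,
      [/\ smooth_on `[0, 1] e, [bounded e x | x in (`[0, 1] : set R)]
        & \forall x \near (endpt T j)^'+,
            f x = Cp j * `|ln (x - endpt T j)| + e x];
  als_left : forall j, (0 < j < d)%N ->
    exists e : R -> R,
      [/\ smooth_on `[0, 1] e, [bounded e x | x in (`[0, 1] : set R)]
        & \forall x \near (endpt T j)^'-,
            f x = Cm j * `|ln (endpt T j - x)| + e x];
  als_asym : sumC d Cp != sumC d Cm }.

(* Restrictions to [0, 1], for 0 < a < 1, of the 1-periodic functions equal to
   1 / (x - a) on (a, a + 1], resp. to 1 / (a - x) on [a - 1, a). *)
Definition aux_u (R : realType) (a x : R) : R :=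
  if a < x then (x - a)^-1 else (x + 1 - a)^-1.

Definition aux_v (R : realType) (a x : R) : R :=
  if x < a then (a - x)^-1 else (a - (x - 1))^-1.

(* The maximum of g (a_k) (T^i x) over 1 <= k <= d-1 and 0 <= i < r; only used
   for nonnegative g, so that the default value 0 is harmless. *)
Definition orbit_max (R : realType) (d : nat) (T : iet R d) (g : R -> R -> R)
    (r : nat) (x : R) : R :=
  \big[Num.max/0]_(1 <= k < d)
    \big[Num.max/0]_(i < r) g (endpt T k) (iter i (iet_map T) x).

(* Main.v *)
Require Import Defs.
From HB Require Import structures.
From mathcomp Require Import all_boot all_order all_algebra all_fingroup.
From mathcomp Require Import all_classical all_reals all_analysis.
From mathcomp Require Import ring lra measurable_realfun.

Set Implicit Arguments.
Unset Strict Implicit.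
Unset Printing Implicit Defensive.

Import Order.TTheory GRing.Theory Num.Theory.
Import numFieldNormedType.Exports.

Local Open Scope classical_set_scope.
Local Open Scope ring_scope.

(** The derivative of the roof function is, up to a bounded function, a sum of
    one-sided singularities [- Cp k / (x - a_k)] to the right of [a_k] and
    [Cm k / (a_k - x)] to its left, and the second derivative is bounded by the
    sum of their squares. Everything therefore rests on one estimate for a single
    one-sided singularity [1 / t], where [t] is the distance to [a_k]: for
    [h^(n_l) <= r < h^(n_(l+1))] and outside the exceptional set, its Birkhoff sum
    is [(1 + o(1)) * r * ln r], up to at most [floor kappa + 2] times its largest
    value on the orbit ([cusp_sum]).

    The return maps of the induction represent the exchange by towers, whose
    floors are disjoint intervals permuted by translations ([tower_step]). By the
    Hilbert contraction the entries of the matrices [A^(m,n)] are asymptotic to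
    the product of the length of the row and the height of the column
    ([rv_matrix_equidist]); hence for a suitable [L], depending on the precision
    only, each floor [J] of level [n_(l-L)] is visited about [r * |J|] times
    ([floor_equidist]). The singularity is almost constant on floors whose
    distance from [a_k] is large compared with their length, and the sum over
    these floors is a Riemann sum of [1 / t] down to distance about
    [1 / h^(n_(l-L))]. It gives [r * ln h^(n_(l-L))], which is asymptotic to
    [r * ln r]: the norm condition makes [ln h^(n_(l+1)) - ln h^(n_(l-L))] of
    order [ln l], while [ln h^(n_l)] grows at least linearly in [l] ([scales]).

    The points closer to [a_k] are summed tower by tower ([near_sum_le]). Inside
    one tower the points of an orbit are separated, so all but the closest one
    contribute a harmonic sum. If [r <= sigma_l * h^(n_(l+1))], the closest points
    of the traverses of level [n_l] are at distance at least
    [sigma_l * lambda^(n_l)], because [x] is outside the exceptional set. If [r] is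
    larger, the orbit consists of at most [floor kappa + 2] traverses of towers of
    level [n_(l+1)], and their closest points account for the maxima in the
    statement. In both cases the rest is negligible, since [tau' < 1] and
    [sigma_l * ln h^(n_l)] is at least a constant times the power [1 - tau'] of
    [ln h^(n_l)], whereas the harmonic sums only produce [O(ln l)].

    The sum of the roof function itself is treated in the same way: on the far
    floors it is a Riemann sum of the integral, and near the singularities
    [|ln t|] is at most [2 * sqrt rho / t] for [t <= rho] ([roof_sum]). *)

(** * Pieces of an interval exchange *)

Section Pieces.
Context {R : realType} {d : nat}.
Implicit Types T : iet R d.

Lemma endpt0 T : endpt T 0 = 0.
Proof. by rewrite /endpt big_pred0. Qed.

Lemma endptS T (j : 'I_d) : endpt T j.+1 = endpt T j + iet_len T j.
Proof.
rewrite /endpt (bigD1 j) //= addrC; congr (_ + _).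
by apply: eq_bigl => k; rewrite ltnS [in RHS]ltn_neqAle andbC.
Qed.

Lemma endpt_full T : endpt T d = total_len T.
Proof. by apply: eq_bigl => k; rewrite ltn_ord. Qed.

Lemma endpt_le T (i j : nat) : (i <= j)%N -> endpt T i <= endpt T j.
Proof.
move=> ij; rewrite /endpt [leRHS](bigID (fun k : 'I_d => (k < i)%N)) /=.
have -> : \sum_(k < d | (k < j)%N && (k < i)%N) iet_len T k
  = \sum_(k < d | (k < i)%N) iet_len T k.
  by apply: eq_bigl => k; rewrite andb_idl // => ki; exact: leq_trans ki ij.
by rewrite lerDl sumr_ge0 // => k _; exact: ltW (iet_len_gt0 T k).
Qed.

Lemma in_piece_ex T x : 0 <= x < total_len T -> exists j, in_piece T j x.
Proof.
move=> /andP[x0]; rewrite -endpt_full.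
suff: forall k, (k <= d)%N -> x < endpt T k -> exists j, in_piece T j x.
  by apply.
elim=> [|k IH] kd xk; first by move: xk; rewrite endpt0 ltNge x0.
have [xk'|xk'] := ltP x (endpt T k); first exact: (IH (ltnW kd)).
by exists (Ordinal kd); rewrite /in_piece xk'.
Qed.

Lemma in_piece_inj T i j x : in_piece T i x -> in_piece T j x -> i = j.
Proof.
move=> /andP[i1 i2] /andP[j1 j2]; apply: val_inj.
case: (ltngtP i j) => // /(endpt_le T) h.
- by have := le_lt_trans (le_trans h j1) i2; rewrite ltxx.
- by have := le_lt_trans (le_trans h i1) j2; rewrite ltxx.
Qed.

Lemma in_piece_range T j x : in_piece T j x -> 0 <= x < total_len T.
Proof.
move=> /andP[j1 j2]; rewrite -endpt_full; apply/andP; split.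
  by apply: le_trans j1; rewrite -(endpt0 T); exact: endpt_le.
by apply: (lt_le_trans j2); exact: endpt_le.
Qed.

Lemma in_piece_left T j : in_piece T j (endpt T j).
Proof. by rewrite /in_piece lexx /= endptS ltrDl iet_len_gt0. Qed.

Lemma pick_piece T j x : in_piece T j x -> [pick i | in_piece T i x] = Some j.
Proof.
move=> jx; case: pickP => [i ix|/(_ j)]; last by rewrite jx.
by rewrite (in_piece_inj ix jx).
Qed.

(** The intervals after the exchange are the intervals exchanged by the inverse
    map, so that surjectivity and injectivity of an exchange are statements
    about the pieces of its dual. *)
Definition iet_dual T : iet R d :=
  IET ((iet_perm T)^-1%g) (fun k => iet_len_gt0 T ((iet_perm T)^-1%g k)).

Definition iet_shift T (j : 'I_d) : R :=
  endpt (iet_dual T) (iet_perm T j) - endpt T j.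

Lemma iet_mapE T j x : in_piece T j x -> iet_map T x = x + iet_shift T j.
Proof.
move=> jx; rewrite /iet_map (pick_piece jx) -addrA; congr (_ + _).
by rewrite addrC.
Qed.

Lemma total_len_dual T : total_len (iet_dual T) = total_len T.
Proof.
rewrite /total_len [RHS](reindex_inj (@perm_inj _ (iet_perm T)^-1%g)) /=.
by apply: eq_bigr.
Qed.

Lemma in_piece_map T j x : in_piece T j x ->
  in_piece (iet_dual T) (iet_perm T j) (iet_map T x).
Proof.
move=> jx; rewrite (iet_mapE jx); move: jx; rewrite /in_piece !endptS /iet_shift.
by rewrite /= permK => /andP[]; lra.
Qed.

Lemma iet_map_range T x : 0 <= x < total_len T -> 0 <= iet_map T x < total_len T.
Proof.
move=> /in_piece_ex[j /in_piece_map/in_piece_range].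
by rewrite total_len_dual.
Qed.

Lemma iter_iet_range T x n : 0 <= x < total_len T ->
  0 <= iter n (iet_map T) x < total_len T.
Proof. by move=> x0; elim: n => //= n /iet_map_range. Qed.

Lemma iet_map_inj T x y : 0 <= x < total_len T -> 0 <= y < total_len T ->
  iet_map T x = iet_map T y -> x = y.
Proof.
move=> /in_piece_ex[i ix] /in_piece_ex[j jy] xy.
have := in_piece_map ix; rewrite xy => /in_piece_inj/(_ (in_piece_map jy)).
move/perm_inj => ij; move: xy; rewrite (iet_mapE ix) (iet_mapE jy) ij.
exact: addIr.
Qed.

Lemma iet_map_surj T y : 0 <= y < total_len T ->
  exists2 x, 0 <= x < total_len T & iet_map T x = y.
Proof.
rewrite -[in X in X -> _]total_len_dual => /in_piece_ex[k ky].
pose j := ((iet_perm T)^-1%g k); have jk : iet_perm T j = k by rewrite permKV.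
have jx : in_piece T j (y - iet_shift T j).
  move: ky; rewrite /in_piece !endptS /iet_shift /= jk => /andP[].
  by rewrite -/j; lra.
by exists (y - iet_shift T j); [exact: in_piece_range jx|rewrite (iet_mapE jx) subrK].
Qed.

Lemma iter_iet_inj T x y n : 0 <= x < total_len T -> 0 <= y < total_len T ->
  iter n (iet_map T) x = iter n (iet_map T) y -> x = y.
Proof.
move=> x0 y0; elim: n => //= n IH /iet_map_inj h; apply: IH.
by apply: h; exact: iter_iet_range.
Qed.

End Pieces.

(** * Finite partitions of an interval *)

Section Partition.
Context {R : realType} {I : finType}.

(** Remove the interval that contains the left end: it starts there, since no
    point of the others lies below, and what remains covers a shorter
    interval. *)
Lemma sum_partition (A : {set I}) (p q G : I -> R) (g : R -> R) (a b : R) :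
  a <= b ->
  (forall i, i \in A -> p i < q i) ->
  (forall i j x, i \in A -> j \in A -> p i <= x < q i -> p j <= x < q j ->
    i = j) ->
  (forall x, a <= x < b <-> exists2 i, i \in A & p i <= x < q i) ->
  \sum_(i in A) (g (q i) - g (p i)) = g b - g a.
Proof.
have [N] := ubnP #|A|; elim: N A a => // N IH A a cA ab pq disj cov.
have [ab'|ba] := ltP a b; last first.
  have aE : a = b by apply/le_anti; rewrite ab.
  rewrite aE subrr big1 // => i iA; exfalso.
  have : a <= p i < b by apply/cov; exists i; rewrite // lexx pq.
  by rewrite aE; case/andP => h /(le_lt_trans h); rewrite ltxx.
have [i iA /andP[pa aq]] : exists2 i, i \in A & p i <= a < q i.
  by apply/cov; rewrite lexx.
have pE : p i = a.
  apply/le_anti; rewrite pa /=.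
  have : a <= p i < b by apply/cov; exists i; rewrite // lexx pq.
  by case/andP.
have below j x : j \in A -> p j <= x < q j -> a <= x < b.
  by move=> jA jx; apply/cov; exists j.
have qb : q i <= b.
  rewrite leNgt; apply/negP => bq.
  have /andP[] : a <= b < b by apply: (below i); rewrite // bq pE ltW.
  by rewrite ltxx.
rewrite (big_setD1 i) //= (IH (A :\ i) (q i)) //.
- by rewrite pE; ring.
- by move: cA; rewrite (cardsD1 i) iA.
- by move=> j; rewrite !inE => /andP[_]; exact: pq.
- by move=> j k x; rewrite !inE => /andP[_ jA] /andP[_ kA]; exact: disj.
- move=> x; split.
    move=> /andP[qx xb].
    have [|j jA jx] := (cov x).1; first by rewrite xb andbT (le_trans _ qx) ?ltW.
    exists j => //; rewrite !inE jA andbT; apply: contraTneq jx => ->.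
    by rewrite negb_and -!leNgt qx orbT.
  move=> [j]; rewrite !inE => /andP[ji jA] jx.
  have /andP[ax ->] := below _ _ jA jx; rewrite andbT leNgt; apply/negP => xq.
  by move: ji; rewrite (disj j i x) ?eqxx // pE ax xq.
Qed.

End Partition.

(** * One step of Rauzy-Veech induction *)

Lemma return_timeE (R : realType) (F : R -> R) (b x : R) (n : nat) :
  (0 < n)%N -> 0 <= iter n F x < b ->
  (forall m, (0 < m < n)%N -> ~~ (0 <= iter m F x < b)) ->
  return_time F b x = n.
Proof.
move=> n0 nb nmin; rewrite /return_time; case: pselect => [ex|]; last first.
  by case; exists n; apply/andP.
case: ex_minnP => m /andP[m0 mb] mmin; apply/eqP; rewrite eqn_leq.
rewrite mmin ?n0 //= leqNgt; apply/negP => mn.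
by have := nmin m; rewrite m0 mn mb => /(_ isT).
Qed.

Lemma sum_in_piece (R : realType) (d : nat) (T : iet R d) x :
  0 <= x < total_len T -> (\sum_i in_piece T i x = 1)%N.
Proof.
move=> /in_piece_ex[j jx]; rewrite (bigD1 j) //= jx big1 // => i ij.
case: (boolP (in_piece T i x)) => // ix.
by rewrite (in_piece_inj ix jx) eqxx in ij.
Qed.

(** The combinatorial content of a step, in the form from which the recursion
    for towers, heights and matrices is read off. *)
Record rv_data (R : realType) (d : nat) (T T' : iet R d) (i0 : 'I_d -> 'I_d)
    (e : 'I_d -> bool) (la : 'I_d) : Prop := RVData {
  rvd_pos : 0 < total_len T';
  rvd_len : total_len T' < total_len T;
  rvd_piece : forall j x, in_piece T' j x -> in_piece T (i0 j) x;
  rvd_ret1 : forall j x, in_piece T' j x -> ~~ e j ->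
    iet_map T x < total_len T' /\ iet_map T' x = iet_map T x;
  rvd_ret2 : forall j x, in_piece T' j x -> e j ->
    [/\ total_len T' <= iet_map T x, in_piece T la (iet_map T x)
      & iet_map T' x = iet_map T (iet_map T x)];
  rvd_cut : forall y, total_len T' <= y < total_len T ->
    exists2 x, 0 <= x < total_len T' & iet_map T x = y }.

Section RVStep.
Context {R : realType} {d : nat} (T T' : iet R d).
Hypothesis TT' : rv_step T T'.

Lemma rv_step_d_gt0 : (0 < d)%N.
Proof.
case: TT' => + _ _ _; case: (posnP d) => // d0 /eqP[].
by rewrite /last_before /last_after !big1 // => i; have := ltn_ord i; rewrite {2}d0.
Qed.

Let lasto : 'I_d := Ordinal (etrans (congr1 (leq^~ d) (prednK rv_step_d_gt0)) (leqnn d)).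

Let lastoE (T0 : iet R d) : last_before T0 = iet_len T0 lasto.
Proof.
rewrite /last_before (big_pred1 lasto) // => i.
apply/eqP/eqP => [h|->]; last by rewrite /= prednK // rv_step_d_gt0.
by apply: val_inj => /=; rewrite -[in RHS]h.
Qed.

Let last_afterE : last_after T = last_before (iet_dual T).
Proof.
rewrite /last_after /last_before.
rewrite [LHS](reindex_inj (@perm_inj _ (iet_perm T)^-1%g)) /=.
by apply: eq_bigl => i; rewrite permKV.
Qed.

Let total_lasto (T0 : iet R d) : total_len T0 = endpt T0 lasto + iet_len T0 lasto.
Proof. by rewrite -endptS /= prednK ?endpt_full //; exact: rv_step_d_gt0. Qed.

Let cutb : total_len T - iet_len T lasto <= total_len T' < total_len T.
Proof.
case: TT' => _ -> _ _; rewrite lastoE last_afterE lastoE.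
rewrite lerD2l lerN2 ge_min lexx /= gtrDl oppr_lt0 lt_min.
by rewrite !iet_len_gt0.
Qed.

Let cuta : total_len T - iet_len (iet_dual T) lasto <= total_len T'.
Proof.
by case: TT' => _ -> _ _; rewrite lastoE last_afterE lastoE lerD2l lerN2 ge_min lexx orbT.
Qed.

Let cut_piece y : total_len T' <= y < total_len T -> in_piece T lasto y.
Proof.
move=> /andP[cy yb]; have /andP[c1 _] := cutb.
have E := total_lasto T; rewrite /in_piece endptS -E yb andbT.
by apply: le_trans cy; apply: le_trans c1; rewrite E addrK.
Qed.

Lemma total_len_gt0 : 0 < total_len T'.
Proof.
rewrite total_lasto ltr_wpDl ?iet_len_gt0 // -(endpt0 T'); exact: endpt_le.
Qed.

(** Otherwise the last piece would stay last after the exchange, and the two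
    compared lengths would be equal. *)
Let cut_map y : total_len T' <= y < total_len T -> iet_map T y < total_len T'.
Proof.
move=> yc; have yl := cut_piece yc; rewrite ltNge; apply/negP => cF.
have ldl : in_piece (iet_dual T) lasto (iet_map T y).
  rewrite /in_piece endptS -total_lasto total_len_dual.
  have /andP[_ ->] := iet_map_range (in_piece_range yl); rewrite andbT.
  apply: le_trans cF; apply: le_trans cuta.
  by rewrite -(total_len_dual T) total_lasto addrK.
have pl := in_piece_inj (in_piece_map yl) ldl.
case: TT' => + _ _ _; rewrite lastoE last_afterE lastoE /=.
by rewrite -[in X in _ != X]pl permK eqxx.
Qed.

Let ret1 x : 0 <= x < total_len T' -> iet_map T x < total_len T' ->
  return_time (iet_map T) (total_len T') x = 1%N.
Proof.
move=> /andP[x0 xc] Fc; apply: return_timeE => //=; last by case=> [|[]].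
rewrite Fc andbT; have /andP[_ c] := cutb.
have xr : 0 <= x < total_len T by rewrite x0 (lt_trans xc).
by have /andP[] := iet_map_range xr.
Qed.

Let ret2 x : 0 <= x < total_len T' -> total_len T' <= iet_map T x ->
  return_time (iet_map T) (total_len T') x = 2%N.
Proof.
move=> /andP[x0 xc] cF; have /andP[_ c] := cutb.
have xr : 0 <= x < total_len T by rewrite x0 (lt_trans xc).
have /andP[F0 F1] := iet_map_range xr.
apply: return_timeE => //=.
  by rewrite cut_map ?cF // andbT; case/andP: (iet_map_range (iet_map_range xr)).
by case=> [|[|]] // _; rewrite /= negb_and -!leNgt cF orbT.
Qed.

(** The numbers of visits determine the itinerary: their sum is the return time,
    which is 1 or 2, and a second visit is always to the last piece. *)
Lemma rv_step_data : exists i0 e, rv_data T T' i0 e lasto.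
Proof.
have /andP[_ cb] := cutb.
have inT j x : in_piece T' j x -> 0 <= x < total_len T.
  by move/in_piece_range => /andP[-> /lt_trans ->].
have ex (j : 'I_d) : exists i, in_piece T i (endpt T' j).
  exact: in_piece_ex (inT j _ (in_piece_left T' j)).
pose i0 j := xchoose (ex j); have i0P j := xchooseP (ex j).
pose e (j : 'I_d) := total_len T' <= iet_map T (endpt T' j).
have vis1 x i : 0 <= x < total_len T' -> iet_map T x < total_len T' ->
    visits T (total_len T') i x = in_piece T i x.
  by move=> h1 h2; rewrite /visits (ret1 h1 h2) big_ord1.
have vis2 x i : 0 <= x < total_len T' -> total_len T' <= iet_map T x ->
    visits T (total_len T') i x = (in_piece T i x + (i == lasto))%N.
  move=> h1 h2; rewrite /visits (ret2 h1 h2) big_ord_recl big_ord1 /=.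
  congr (_ + nat_of_bool _)%N.
  have lx : in_piece T lasto (iet_map T x).
    apply: cut_piece; rewrite h2 /=.
    have /andP[x0 xc] := h1.
    have xr : 0 <= x < total_len T by rewrite x0 (lt_trans xc).
    by have /andP[] := iet_map_range xr.
  by apply/idP/eqP => [ix|->//]; exact: in_piece_inj ix lx.
have same j x : in_piece T' j x ->
    in_piece T (i0 j) x /\ (total_len T' <= iet_map T x) = e j.
  move=> jx; have jl := in_piece_left T' j.
  have [_ _ _ /(_ j x _ jx jl) vis] := TT'.
  have xr := in_piece_range jx; have lr := in_piece_range jl.
  have sumv : (\sum_i visits T (total_len T') i x
    = \sum_i visits T (total_len T') i (endpt T' j))%N by apply: eq_bigr.
  have s1 y : 0 <= y < total_len T' -> (\sum_i in_piece T i y = 1)%N.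
    by move=> /andP[y0 yc]; rewrite sum_in_piece // y0 (lt_trans yc).
  have s2 : (\sum_i (i == lasto) = 1)%N.
    by rewrite (bigD1 lasto) //= eqxx big1 // => i /negbTE->.
  rewrite /e; case: (leP (total_len T') (iet_map T x)) => hx;
    case: (leP (total_len T') (iet_map T (endpt T' j))) => hl.
  - split=> //; have := vis (i0 j); rewrite !vis2 // i0P.
    by case: in_piece; case: eqVneq.
  - move: sumv; rewrite (eq_bigr _ (fun i _ => vis2 x i xr hx)).
    rewrite (eq_bigr _ (fun i _ => vis1 _ i lr hl)) big_split /=.
    by rewrite !s1 // s2.
  - move: sumv; rewrite (eq_bigr _ (fun i _ => vis1 x i xr hx)).
    rewrite (eq_bigr _ (fun i _ => vis2 _ i lr hl)) big_split /=.
    by rewrite !s1 // s2.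
  - split=> //; have := vis (i0 j); rewrite !vis1 // i0P.
    by case: in_piece.
have [_ _ Fret _] := TT'.
exists i0, e; split=> //.
- exact: total_len_gt0.
- by move=> j x /same[].
- move=> j x jx; have [_ <-] := same j x jx; rewrite -ltNge => h; split=> //.
  by have xr := in_piece_range jx; rewrite Fret // ret1.
- move=> j x jx; have [_ <-] := same j x jx => h.
  have xr := in_piece_range jx; split=> //; last by rewrite Fret // ret2.
  apply: cut_piece; rewrite h /=.
  by have /andP[] := iet_map_range (inT _ _ jx).
- move=> y yc; have /andP[cy yb] := yc.
  have [|x /andP[x0 xb] xy] := @iet_map_surj _ _ T y.
    by rewrite yb (le_trans _ cy) // ltW // total_len_gt0.
  exists x => //; rewrite x0 /= ltNge; apply/negP => cx.
  by move: cy; rewrite -xy leNgt cut_map ?cx.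
Qed.

End RVStep.

(** * Towers over an induced exchange *)

(** A Rokhlin tower representation of [T] over its first return map [T']. The
    return times [H] and the itineraries [it] are data of the pieces, not
    functions of the point, so that they can be composed and counted. *)
Record tower (R : realType) (d : nat) (T T' : iet R d) (H : 'I_d -> nat)
    (it : 'I_d -> nat -> 'I_d) : Prop := Tower {
  tw_pos : 0 < total_len T';
  tw_len : total_len T' <= total_len T;
  tw_gt0 : forall j, (0 < H j)%N;
  tw_it : forall j x t, in_piece T' j x -> (t < H j)%N ->
    in_piece T (it j t) (iter t (iet_map T) x);
  tw_out : forall j x t, in_piece T' j x -> (0 < t < H j)%N ->
    total_len T' <= iter t (iet_map T) x;
  tw_ret : forall j x, in_piece T' j x -> iter (H j) (iet_map T) x = iet_map T' x;
  tw_surj : forall y, 0 <= y < total_len T -> exists j x t,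
    [/\ in_piece T' j x, (t < H j)%N & iter t (iet_map T) x = y] }.

Lemma big_ord_cat (V : nmodType) (a b : nat) (e : bool) (G : nat -> V) :
  \sum_(t < a + e * b) G t
    = \sum_(t < a) G t + (\sum_(t < b) G (a + t)%N) *+ e.
Proof.
case: e; last by rewrite mul0n addn0 mulr0n addr0.
by rewrite mul1n mulr1n big_split_ord.
Qed.

Section Tower.
Context {R : realType} {d : nat}.
Implicit Types T : iet R d.

Lemma tower_refl T : 0 < total_len T -> tower T T (fun=> 1%N) (fun j _ => j).
Proof.
move=> T0; split=> //.
- by move=> j x [|t].
- by move=> j x [|t]//; rewrite ltnS ltn0 andbF.
- by move=> y /in_piece_ex[j jy]; exists j, y, 0%N.
Qed.

(** The new tower over [j] is the old tower over [i0 j], continued by the old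
    tower over the last piece if the return takes two steps. *)
Lemma tower_step T T' T'' H it i0 e la :
  tower T T' H it -> rv_data T' T'' i0 e la ->
  tower T T'' (fun j => H (i0 j) + e j * H la)%N
    (fun j t => if (t < H (i0 j))%N then it (i0 j) t else it la (t - H (i0 j))%N).
Proof.
move=> tw rd; have lt' := rvd_len rd.
have tail j x t : in_piece T'' j x -> (H (i0 j) <= t < H (i0 j) + e j * H la)%N ->
  [/\ e j, (t - H (i0 j) < H la)%N, in_piece T' la (iet_map T' x) &
   iter t (iet_map T) x = iter (t - H (i0 j)) (iet_map T) (iet_map T' x)].
  move=> jx /andP[ht]; case: (boolP (e j)) => ej; last by rewrite mul0n addn0 ltnNge ht.
  rewrite mul1n -(ltn_subLR _ ht) => tl; have [_ lx _] := rvd_ret2 rd jx ej; split=> //.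
  by rewrite -{1}(subnK ht) iterD (tw_ret tw (rvd_piece rd jx)).
split.
- exact: rvd_pos rd.
- exact: le_trans (ltW lt') (tw_len tw).
- by move=> j; rewrite addn_gt0 (tw_gt0 tw).
- move=> j x t jx /=; case: (ltnP t (H (i0 j))) => [tH _|ht tl].
    exact: (tw_it tw (rvd_piece rd jx) tH).
  have [|ej tla lx ->] := tail _ _ t jx; first by rewrite ht.
  exact: (tw_it tw lx tla).
- move=> j x t jx /andP[t0 tl]; case: (ltnP t (H (i0 j))) => ht.
    apply: le_trans (ltW lt') _.
    by apply: (tw_out tw (rvd_piece rd jx)); rewrite t0.
  have [|ej tla lx ->] := tail _ _ t jx; first by rewrite ht.
  case: (posnP (t - H (i0 j))) => [->|t1] /=.
    by have [] := rvd_ret2 rd jx ej.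
  apply: le_trans (ltW lt') _.
  by apply: (tw_out tw lx); rewrite t1.
- move=> j x jx; case: (boolP (e j)) => ej; last first.
    rewrite mul0n addn0 (tw_ret tw (rvd_piece rd jx)).
    by have [_ ->] := rvd_ret1 rd jx ej.
  have [_ lx ->] := rvd_ret2 rd jx ej.
  by rewrite mul1n addnC iterD (tw_ret tw (rvd_piece rd jx)) (tw_ret tw lx).
- move=> y /(tw_surj tw)[j [x [t [jx tH <-]]]].
  have /andP[x0 xb] := in_piece_range jx.
  have [xl|lx] := ltP x (total_len T'').
    have [|k kx] := @in_piece_ex _ _ T'' x; first by rewrite x0.
    exists k, x, t; split=> //; apply: ltn_addr.
    by rewrite -(in_piece_inj jx (rvd_piece rd kx)).
  have [|z /in_piece_ex[k kz] zx] := rvd_cut rd (y := x); first by rewrite lx.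
  have ek : e k.
    apply/negPn/negP => ek; have [h _] := rvd_ret1 rd kz ek.
    by rewrite zx ltNge lx in h.
  have [_ lz _] := rvd_ret2 rd kz ek; rewrite zx in lz.
  exists k, z, (t + H (i0 k))%N; split=> //.
    by rewrite ek mul1n addnC ltn_add2l -(in_piece_inj jx lz).
  by rewrite iterD (tw_ret tw (rvd_piece rd kz)) zx.
Qed.

Section Fixed.
Context {T T' : iet R d} {H : 'I_d -> nat} {it : 'I_d -> nat -> 'I_d}.
Hypothesis tw : tower T T' H it.

Lemma tower_sub x : 0 <= x < total_len T' -> 0 <= x < total_len T.
Proof. by move=> /andP[-> /lt_le_trans ->//]; exact: tw_len tw. Qed.

(** A coincidence of two orbit segments is pulled back to the base by
    injectivity, and a point of the base is not met again before its return. *)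
Lemma tower_inj j k x z t s : in_piece T' j x -> in_piece T' k z ->
  (t < H j)%N -> (s < H k)%N -> iter t (iet_map T) x = iter s (iet_map T) z ->
  [/\ x = z, j = k & t = s].
Proof.
wlog ts : j k x z t s / (t <= s)%N.
  move=> wl jx kz tj sk E; case: (leqP t s) => h; first exact: wl.
  by have [-> -> ->] := wl _ _ _ _ _ _ (ltnW h) kz jx sk tj (esym E).
move=> jx kz tj sk; rewrite -{1}(subnK ts) addnC iterD.
have xr := in_piece_range jx; have zr := in_piece_range kz.
move=> /(iter_iet_inj (tower_sub xr))E.
have {}E : x = iter (s - t) (iet_map T) z.
  by apply: E; apply: iter_iet_range; exact: tower_sub.
case: (posnP (s - t)) => [st|st0]; last first.
  have : total_len T' <= iter (s - t) (iet_map T) z.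
    apply: (tw_out tw kz); rewrite st0 /=.
    by apply: leq_ltn_trans sk; exact: leq_subr.
  by rewrite -E leNgt; case/andP: xr => _ ->.
rewrite st /= in E; split=> //.
  by rewrite E in jx; exact: in_piece_inj jx kz.
by apply/eqP; rewrite eqn_leq ts -subn_eq0 st eqxx.
Qed.

Lemma tower_return j x : in_piece T' j x ->
  return_time (iet_map T) (total_len T') x = H j.
Proof.
move=> jx; apply: return_timeE; first exact: tw_gt0 tw j.
  by rewrite (tw_ret tw jx) iet_map_range // (in_piece_range jx).
by move=> m /(tw_out tw jx) h; rewrite negb_and -!leNgt h orbT.
Qed.

Lemma tower_visits i j x : in_piece T' j x ->
  visits T (total_len T') i x = (\sum_(t < H j) (it j t == i))%N.
Proof.
move=> jx; rewrite /visits (tower_return jx); apply: eq_bigr => t _.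
have tx := tw_it tw jx (ltn_ord t); congr nat_of_bool.
by apply/idP/eqP => [ix|<-//]; exact: in_piece_inj tx ix.
Qed.

Lemma tower_translation j x z t : in_piece T' j x -> in_piece T' j z ->
  (t < H j)%N -> iter t (iet_map T) x - x = iter t (iet_map T) z - z.
Proof.
move=> jx jz; elim: t => [|t IH] tH; first by rewrite /= !subrr.
have tH' := ltnW tH; have := IH tH'.
rewrite /= (iet_mapE (tw_it tw jx tH')) (iet_mapE (tw_it tw jz tH')).
by move=> E; rewrite addrAC E addrAC.
Qed.

Definition tfloor (G : 'I_d -> nat) := {j : 'I_d & 'I_(G j)}.

Definition floor_lo (f : tfloor H) : R :=
  iter (tagged f) (iet_map T) (endpt T' (tag f)).

Definition floor_len (f : tfloor H) : R := iet_len T' (tag f).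

Definition in_floor (f : tfloor H) (y : R) : bool :=
  floor_lo f <= y < floor_lo f + floor_len f.

Lemma in_floorE (f : tfloor H) x : in_piece T' (tag f) x ->
  iter (tagged f) (iet_map T) x = x - endpt T' (tag f) + floor_lo f.
Proof.
move=> fx; have := tower_translation fx (in_piece_left T' _) (ltn_ord (tagged f)).
by rewrite /floor_lo => /(canRL (subrK _))->; ring.
Qed.

Lemma in_floorP (f : tfloor H) y :
  in_floor f y <-> exists2 x, in_piece T' (tag f) x & iter (tagged f) (iet_map T) x = y.
Proof.
split.
  move=> /andP[l1 l2]; pose x := y - floor_lo f + endpt T' (tag f).
  have fx : in_piece T' (tag f) x.
    by rewrite /in_piece endptS /x; move: l1 l2; rewrite /floor_len; lra.
  by exists x; rewrite ?in_floorE // /x; ring.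
move=> [x fx <-]; rewrite /in_floor in_floorE //.
by move: fx; rewrite /in_piece endptS /floor_len; lra.
Qed.

Lemma in_floor_inj f g y : in_floor f y -> in_floor g y -> f = g.
Proof.
case: f g => [j t] [k s] /in_floorP[x /= jx xy] /in_floorP[z /= kz zy].
have [_ jk ts] := tower_inj jx kz (ltn_ord t) (ltn_ord s) (etrans xy (esym zy)).
by move: t s jx kz xy zy ts; rewrite jk => t s _ _ _ _ /val_inj->.
Qed.

Lemma in_floor_ex y : 0 <= y < total_len T -> exists f, in_floor f y.
Proof.
move=> /(tw_surj tw)[j [x [t [jx tH xy]]]].
by exists (Tagged (fun j => 'I_(H j)) (Ordinal tH)); apply/in_floorP; exists x.
Qed.

Lemma in_floor_range f y : in_floor f y -> 0 <= y < total_len T.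
Proof.
by move=> /in_floorP[x fx <-]; apply/iter_iet_range/tower_sub/(in_piece_range fx).
Qed.

Lemma floor_lt f : floor_lo f < floor_lo f + floor_len f.
Proof. by rewrite ltrDl; exact: iet_len_gt0. Qed.

Lemma in_floor_lo f : in_floor f (floor_lo f).
Proof. by rewrite /in_floor lexx floor_lt. Qed.

(** For a primitive [g] this is the integral over the whole interval, cut into
    floors; for the identity it is the total length. *)
Lemma sum_floors (g : R -> R) :
  \sum_f (g (floor_lo f + floor_len f) - g (floor_lo f)) = g (total_len T) - g 0.
Proof.
rewrite -(@sum_partition _ _ [set: tfloor H] floor_lo
  (fun f => floor_lo f + floor_len f) (fun=> 0) g 0 (total_len T)) //.
- by apply: eq_bigl => f; rewrite inE.
- exact: le_trans (ltW (tw_pos tw)) (tw_len tw).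
- by move=> f _; exact: floor_lt.
- by move=> f h x _ _; exact: in_floor_inj.
- move=> x; split=> [/in_floor_ex[f fx]|[f _ /in_floor_range]//].
  by exists f.
Qed.

Lemma sum_floors_piece i :
  iet_len T i = \sum_j (\sum_(t < H j) (it j t == i))%:R * iet_len T' j.
Proof.
pose A := finset (fun f : tfloor H => it (tag f) (tagged f) == i).
transitivity (\sum_(f in A) floor_len f).
  transitivity (endpt T i.+1 - endpt T i); first by rewrite endptS addrAC subrr add0r.
  rewrite -(@sum_partition _ _ A floor_lo
    (fun f => floor_lo f + floor_len f) (fun=> 0) id (endpt T i) (endpt T i.+1)) //=.
  - by apply: eq_bigr => f _; rewrite addrAC subrr add0r.
  - by apply: endpt_le.
  - by move=> f _; exact: floor_lt.
  - by move=> f h x _ _; exact: in_floor_inj.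
  - move=> x; split=> [ix|[f]].
      have [f fx] := in_floor_ex (in_piece_range ix).
      exists f => //; rewrite inE; have [z fz zx] := (in_floorP f x).1 fx.
      have := tw_it tw fz (ltn_ord (tagged f)); rewrite zx => h.
      by apply/eqP; exact: in_piece_inj h ix.
    rewrite inE => /eqP fi fx; have [z fz <-] := (in_floorP f x).1 fx.
    by rewrite -fi; exact: (tw_it tw fz (ltn_ord (tagged f))).
rewrite [RHS](eq_bigr (fun j => \sum_(t < H j | it j t == i) iet_len T' j)).
  rewrite sig_big_dep /=; apply: eq_bigl => f; by rewrite inE.
move=> j _; rewrite natr_sum mulr_suml [RHS]big_mkcond /=.
by apply: eq_bigr => t _; case: eqP; rewrite ?mul1r ?mul0r.
Qed.

End Fixed.
End Tower.

(** * Matrices and heights along the induction *)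

Section RauzyVeech.
Context {R : realType} {d : nat} (RV : nat -> iet R d).
Hypothesis RVstep : forall n, rv_step (RV n) (RV n.+1).

Local Notation A := (rv_matrix RV).

Lemma rv_total_len_gt0 n : 0 < total_len (RV n).
Proof.
have d0 := rv_step_d_gt0 (RVstep 0%N).
rewrite /total_len (bigD1 (Ordinal d0)) //=.
by rewrite ltr_pwDl ?iet_len_gt0 // sumr_ge0 // => k _; exact/ltW/iet_len_gt0.
Qed.

Lemma rv_tower m n : (m <= n)%N -> exists H it, tower (RV m) (RV n) H it.
Proof.
move=> /subnKC <-; elim: (n - m)%N => [|k [H [it tw]]].
  by rewrite addn0; eexists; eexists; exact/tower_refl/rv_total_len_gt0.
have [i0 [e rd]] := rv_step_data (RVstep (m + k)%N).
by rewrite addnS; eexists; eexists; exact: (tower_step tw rd).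
Qed.

Lemma rv_height_tower n : exists it, tower (RV 0%N) (RV n) (height RV n) it.
Proof.
have [H [it tw]] := rv_tower (leq0n n); exists it.
suff -> : height RV n = H by [].
by apply/funext => j; exact: (tower_return tw (in_piece_left (RV n) j)).
Qed.

Lemma rv_matrixE m n H it : tower (RV m) (RV n) H it ->
  forall i j, A m n i j = (\sum_(t < H j) (it j t == i))%:R.
Proof.
by move=> tw i j; rewrite mxE (tower_visits tw _ (in_piece_left (RV n) j)).
Qed.

Lemma rv_matrix_step m n i0 e la : (m <= n)%N ->
  rv_data (RV n) (RV n.+1) i0 e la ->
  forall i j, A m n.+1 i j = A m n i (i0 j) + A m n i la *+ e j.
Proof.
move=> /rv_tower[H [it tw]] rd i j.
rewrite (rv_matrixE (tower_step tw rd)) !(rv_matrixE tw) !natr_sum.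
rewrite /= (big_ord_cat _ _ _ (fun t => ((if (t < H (i0 j))%N then it (i0 j) t
  else it la (t - H (i0 j))%N) == i)%:R)).
congr (_ + _ *+ _); apply: eq_bigr => t _.
  by rewrite ltn_ord.
by rewrite ltnNge leq_addr /= addKn.
Qed.

Lemma height_step n i0 e la : rv_data (RV n) (RV n.+1) i0 e la ->
  forall j, height RV n.+1 j = (height RV n (i0 j) + e j * height RV n la)%N.
Proof.
have [it tw] := rv_height_tower n => rd j.
by rewrite /height (tower_return (tower_step tw rd) (in_piece_left (RV n.+1) j)).
Qed.

Lemma rv_matrix_refl n : A n n = 1%:M.
Proof.
apply/matrixP => i j; rewrite (rv_matrixE (tower_refl (rv_total_len_gt0 n))).
by rewrite big_ord1 mxE eq_sym.
Qed.

(** Heights, rows of the matrices and numbers of visits to a fixed floor all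
    satisfy this recursion, of which the matrices are the fundamental
    solution. *)
Lemma rv_cocycle m (w : nat -> 'I_d -> R) :
  (forall n i0 e la, (m <= n)%N -> rv_data (RV n) (RV n.+1) i0 e la ->
     forall j, w n.+1 j = w n (i0 j) + w n la *+ e j) ->
  forall n j, (m <= n)%N -> w n j = \sum_i w m i * A m n i j.
Proof.
move=> wS n j mn; rewrite -(subnKC mn).
elim: (n - m)%N j => [|k IH] j.
  rewrite addn0 rv_matrix_refl (bigD1 j) //= mxE eqxx mulr1 big1 ?addr0 //.
  by move=> i /negbTE ij; rewrite mxE ij mulr0.
have [i0 [e rd]] := rv_step_data (RVstep (m + k)%N).
rewrite addnS (wS _ _ _ _ (leq_addr _ _) rd) !IH -sumrMnl -big_split /=.
apply: eq_bigr => i _; rewrite (rv_matrix_step (leq_addr _ _) rd).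
by rewrite mulrDr mulrnAr.
Qed.

Lemma rv_matrix_mul m n k : (m <= n <= k)%N -> A m k = A m n *m A n k.
Proof.
move=> /andP[mn nk]; apply/matrixP => i j; rewrite [RHS]mxE.
refine (@rv_cocycle n (fun k j => A m k i j) _ k j nk) => l i0 e la nl rd j'.
by apply: rv_matrix_step => //; exact: leq_trans nl.
Qed.

Lemma height_rv_matrix n k j : (n <= k)%N ->
  (height RV k j)%:R = \sum_i (height RV n i)%:R * A n k i j.
Proof.
move=> nk.
refine (@rv_cocycle n (fun k j => (height RV k j)%:R) _ k j nk) => l i0 e la _ rd j'.
by rewrite (height_step rd) natrD natrM mulr_natl.
Qed.

Lemma rv_matrix_nat m n i j : exists k, A m n i j = k%:R.
Proof. by rewrite mxE; eexists. Qed.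

Lemma rv_matrix_ge0 m n i j : 0 <= A m n i j.
Proof. by rewrite mxE. Qed.

Lemma iet_len_rv_matrix m n i : (m <= n)%N ->
  iet_len (RV m) i = \sum_j A m n i j * iet_len (RV n) j.
Proof.
move=> /rv_tower[H [it tw]]; rewrite (sum_floors_piece tw).
by apply: eq_bigr => j _; rewrite (rv_matrixE tw).
Qed.

Lemma height_gt0 n j : (0 < height RV n j)%N.
Proof. by have [it tw] := rv_height_tower n; exact: (tw_gt0 tw j). Qed.

Lemma sum_tfloor (n : nat) (c : 'I_d -> R) :
  \sum_(f : tfloor (height RV n)) c (tag f) = \sum_j (height RV n j)%:R * c j.
Proof.
rewrite [RHS](eq_bigr (fun j => \sum_(t < height RV n j) c j)).
  by rewrite sig_big_dep.
by move=> j _; rewrite sumr_const card_ord mulr_natl.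
Qed.

Lemma sum_height_len n :
  \sum_j (height RV n j)%:R * iet_len (RV n) j = total_len (RV 0%N).
Proof.
have [it tw] := rv_height_tower n.
rewrite -sum_tfloor -[RHS]subr0 -(sum_floors tw id).
by apply: eq_bigr => f _; rewrite addrAC subrr add0r.
Qed.

(** An orbit through a tower of level [n] runs through complete towers of level
    [m], so it meets a floor once for each visit to the base below it. *)
Lemma floor_count m n (f : tfloor (height RV m)) j x : (m <= n)%N ->
  in_piece (RV n) j x ->
  \sum_(t < height RV n j)
    (in_floor (T := RV 0%N) (T' := RV m) f (iter t (iet_map (RV 0%N)) x))%:R
  = A m n (tag f) j.
Proof.
move=> mn; rewrite -(subnKC mn).
elim: (n - m)%N j x => [|k IH] j x jx.
  rewrite addn0 in jx *; have [it tw] := rv_height_tower m.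
  rewrite rv_matrix_refl mxE.
  pose fl (t : 'I_(height RV m j)) := Tagged (fun j => 'I_(height RV m j)) t.
  have E (t : 'I_(height RV m j)) :
      in_floor (T := RV 0%N) (T' := RV m) f (iter t (iet_map (RV 0%N)) x)
      = (f == fl t).
    have ft : in_floor (T := RV 0%N) (T' := RV m) (fl t)
        (iter t (iet_map (RV 0%N)) x) by apply/(in_floorP tw); exists x.
    by apply/idP/eqP => [h|->//]; exact: (in_floor_inj tw h ft).
  under eq_bigr do rewrite E.
  case: eqP => [fj|fj]; last first.
    by rewrite big1 // => t _; case: eqP => // ft; case: fj; rewrite ft.
  case: f fj {E} => j' s /= js; move: s; rewrite js => s.
  rewrite (bigD1 s) //= eqxx big1 ?addr0 // => t /negbTE ts.
  case: eqP => // /eqP; rewrite eq_sym -tag_eqE /tag_eq eqxx /= tagged_asE ts.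
  by [].
have [i0 [e rd]] := rv_step_data (RVstep (m + k)%N).
have [it tw] := rv_height_tower (m + k)%N.
rewrite addnS in jx *.
rewrite (rv_matrix_step (leq_addr _ _) rd) (height_step rd).
rewrite (big_ord_cat _ _ _ (fun t => (in_floor (T := RV 0%N) (T' := RV m) f
  (iter t (iet_map (RV 0%N)) x))%:R)).
rewrite (IH _ _ (rvd_piece rd jx)); congr (_ + _).
case: (boolP (e j)) => // ej; congr (_ *+ _).
have [_ lx _] := rvd_ret2 rd jx ej.
rewrite -(tw_ret tw (rvd_piece rd jx)) in lx.
rewrite -(IH _ _ lx); apply: eq_bigr => t _.
by rewrite -iterD addnC.
Qed.

End RauzyVeech.

(** * Birkhoff sums and traverses of towers *)

Section Traverses.
Context {R : realType}.

Lemma birkhoff_add (F g : R -> R) a b x :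
  birkhoff F g (a + b) x = birkhoff F g a x + birkhoff F g b (iter a F x).
Proof.
rewrite /birkhoff big_split_ord; congr (_ + _).
by apply: eq_bigr => i _; rewrite -iterD [in RHS]addnC.
Qed.

Lemma birkhoff_ge0 (F g : R -> R) r x : (forall y, 0 <= g y) ->
  0 <= birkhoff F g r x.
Proof. by move=> g0; apply: sumr_ge0. Qed.

Lemma birkhoff_le (F g : R -> R) a b x : (forall y, 0 <= g y) -> (a <= b)%N ->
  birkhoff F g a x <= birkhoff F g b x.
Proof.
by move=> g0 /subnKC <-; rewrite birkhoff_add lerDl birkhoff_ge0.
Qed.

Context {d : nat} {T T' : iet R d} {H : 'I_d -> nat} {it : 'I_d -> nat -> 'I_d}.
Hypothesis tw : tower T T' H it.
Local Notation F := (iet_map T).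

(** The orbit segment of [y] is cut at its passages through the base of the
    towers: it starts in the first of [q] consecutive complete traverses and
    ends in the last one. *)
Lemma traverses r y : (0 < r)%N -> 0 <= y < total_len T ->
  exists s q (z : nat -> R) (j : nat -> 'I_d),
    let tau k := (\sum_(i < k) H (j i))%N in
    [/\ (forall i, in_piece T' (j i) (z i)), y = iter s F (z 0%N),
        (forall k, iter (tau k) F (z 0%N) = z k),
        (s < tau 1%N)%N & (tau q < s + r <= tau q.+1)%N].
Proof.
move=> r0 /(tw_surj tw)[j0 [x [s [jx sH xy]]]].
pose z i := iter i (iet_map T') x.
have zr i : 0 <= z i < total_len T' by apply: iter_iet_range; exact: in_piece_range jx.
pose j i := xchoose (in_piece_ex (zr i)); have jP i := xchooseP (in_piece_ex (zr i)).
pose tau k := (\sum_(i < k) H (j i))%N.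
have tauS k : tau k.+1 = (tau k + H (j k))%N by rewrite /tau big_ord_recr.
have tau_ge k : (k <= tau k)%N.
  elim: k => // k IH; rewrite tauS -addn1.
  by apply: leq_add => //; exact: tw_gt0 tw _.
have ex : exists q, (s + r <= tau q)%N by exists (s + r)%N; exact: tau_ge.
have j00 : j 0%N = j0 by exact: in_piece_inj (jP 0%N) jx.
case: (ex_minnP ex) => -[|q] qP qmin.
  by move: qP; rewrite /tau big_ord0 leqn0 addn_eq0 -(negbK (r == 0)%N) -lt0n r0 andbF.
exists s, q, z, j; split=> //.
- elim=> [|k IH]; first by rewrite big_ord0.
  by rewrite big_ord_recr /= addnC iterD IH (tw_ret tw (jP k)).
- by rewrite big_ord1 j00.
- rewrite qP andbT ltnNge; apply/negP => /qmin.
  by rewrite ltnn.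
Qed.

Lemma birkhoff_traverses (g : R -> R) (z : nat -> R) (j : nat -> 'I_d) a k :
  (forall k, iter (\sum_(i < k) H (j i))%N F (z 0%N) = z k) ->
  birkhoff F g (\sum_(i < a + k) H (j i)) (z 0%N)
  = birkhoff F g (\sum_(i < a) H (j i)) (z 0%N)
    + \sum_(i < k) birkhoff F g (H (j (a + i)%N)) (z (a + i)%N).
Proof.
move=> zE; elim: k => [|k IH]; first by rewrite addn0 big_ord0 addr0.
by rewrite addnS !big_ord_recr /= birkhoff_add IH zE addrA.
Qed.

Lemma birkhoff_traverses0 (g : R -> R) (z : nat -> R) (j : nat -> 'I_d) k :
  (forall k, iter (\sum_(i < k) H (j i))%N F (z 0%N) = z k) ->
  birkhoff F g (\sum_(i < k) H (j i)) (z 0%N)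
  = \sum_(i < k) birkhoff F g (H (j i)) (z i).
Proof.
move=> zE; have := birkhoff_traverses g 0 k zE.
by rewrite big_ord0 {2}/birkhoff big_ord0 !add0r.
Qed.

Context (g : R -> R) (g0 : forall y, 0 <= g y).

Lemma birkhoff_le_traverses hmin W r y : 0 <= W ->
  (forall j, (hmin <= H j)%N) ->
  (forall j x, in_piece T' j x -> birkhoff F g (H j) x <= W) ->
  0 <= y < total_len T ->
  exists2 q, birkhoff F g r y <= W * q%:R & (q.-2 * hmin <= r)%N.
Proof.
move=> W0 Hmin HW yr; case: (posnP r) => [->|r0].
  by exists 0%N; rewrite ?mulr0 // /birkhoff big_ord0.
have [s [q [z [j]]]] := traverses r0 yr.
pose tau k := (\sum_(i < k) H (j i))%N.
move=> [jz -> zE]; rewrite -/(tau 1%N) -/(tau q) -/(tau q.+1) => s1 /andP[sr rs]; exists q.+1.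
  apply: (@le_trans _ _ (birkhoff F g (s + r) (z 0%N))).
    by rewrite birkhoff_add lerDr birkhoff_ge0.
  apply: le_trans (birkhoff_le _ _ g0 rs) _.
  rewrite (birkhoff_traverses0 g _ zE).
  rewrite -[in leRHS](card_ord q.+1) -sum1_card natr_sum mulr_sumr.
  by apply: ler_sum => i _; rewrite mulr1; exact: HW.
case: q sr rs => [//|q] /= sr _.
have : (q * hmin + tau 1%N <= tau q.+1)%N.
  rewrite addnC /tau [leqRHS]big_ord_recl big_ord1 leq_add2l.
  rewrite -[q in (q * _)%N]card_ord -sum1_card big_distrl /=.
  by apply: leq_sum => i _; rewrite mul1n.
move: s1 sr; set t1 := tau 1%N; set tq := tau q.+1; set a := (q * hmin)%N => s1 sr aq.
rewrite -(leq_add2r t1); apply: leq_trans aq _; apply: ltnW.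
by apply: (leq_trans sr); rewrite addnC leq_add2l ltnW.
Qed.

Lemma birkhoff_le_height h c r y : 0 <= c ->
  (forall j, (H j <= h)%N) ->
  (forall j x, in_piece T' j x -> birkhoff F g (H j) x <= c * (H j)%:R) ->
  0 <= y < total_len T ->
  birkhoff F g r y <= c * (r + h.*2)%:R.
Proof.
move=> c0 Hmax HW yr; case: (posnP r) => [->|r0].
  by rewrite /birkhoff big_ord0 mulr_ge0.
have [s [q [z [j]]]] := traverses r0 yr.
pose tau k := (\sum_(i < k) H (j i))%N.
move=> [jz -> zE]; rewrite -/(tau 1%N) -/(tau q) -/(tau q.+1) => s1 /andP[sr rs].
have tauS k : tau k.+1 = (tau k + H (j k))%N by rewrite /tau big_ord_recr.
apply: (@le_trans _ _ (birkhoff F g (s + r) (z 0%N))).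
  by rewrite birkhoff_add lerDr birkhoff_ge0.
apply: le_trans (birkhoff_le _ _ g0 rs) _.
apply: (@le_trans _ _ (c * (tau q.+1)%:R)).
  rewrite (birkhoff_traverses0 g _ zE).
  by rewrite /tau natr_sum mulr_sumr; apply: ler_sum => i _; exact: HW.
rewrite ler_wpM2l // ler_nat tauS.
have sh : (s <= h)%N by apply: (leq_trans (ltnW s1)); rewrite /tau big_ord1.
rewrite -addnn addnA leq_add //; apply: (leq_trans (ltnW sr)).
by rewrite addnC leq_add2l.
Qed.

(** Only complete traverses are counted: dropping the first and the last one
    costs at most twice the maximal height. *)
Lemma birkhoff_ge_height h c r y : 0 <= c ->
  (forall j, (H j <= h)%N) ->
  (forall j x, in_piece T' j x -> c * (H j)%:R <= birkhoff F g (H j) x) ->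
  0 <= y < total_len T ->
  c * (r%:R - h.*2%:R) <= birkhoff F g r y.
Proof.
move=> c0 Hmax HW yr; case: (posnP r) => [->|r0].
  by rewrite /birkhoff big_ord0 sub0r mulrN oppr_le0 mulr_ge0.
have [s [q [z [j]]]] := traverses r0 yr.
pose tau k := (\sum_(i < k) H (j i))%N.
move=> [jz yE zE]; rewrite -/(tau 1%N) -/(tau q) -/(tau q.+1) => s1 /andP[sr rs].
have t1h : (tau 1%N <= h)%N by rewrite /tau big_ord1.
have tauS k : tau k.+1 = (tau k + H (j k))%N by rewrite /tau big_ord_recr.
case: q sr rs => [_ rs|q sr rs].
  apply: le_trans (birkhoff_ge0 _ _ _ g0); rewrite mulr_ge0_le0 // subr_le0 ler_nat.
  apply: (leq_trans (leq_addl s r)); apply: (leq_trans rs).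
  by rewrite -addnn (leq_trans t1h) ?leq_addr.
have : birkhoff F g (tau q.+1) (z 0%N) <= birkhoff F g (s + r) (z 0%N).
  by apply: birkhoff_le => //; exact: ltnW.
rewrite birkhoff_add -yE => /(le_trans _)h1.
have : birkhoff F g s (z 0%N) <= birkhoff F g (tau 1%N) (z 0%N).
  by apply: birkhoff_le => //; exact: ltnW.
suff : birkhoff F g (tau 1%N) (z 0%N) + c * (r%:R - h.*2%:R)
    <= birkhoff F g (tau q.+1) (z 0%N).
  move=> /h1; lra.
have := birkhoff_traverses g 1 q zE; rewrite add1n -/(tau q.+1) -/(tau 1%N) => ->.
rewrite lerD2l.
apply: (@le_trans _ _ (\sum_(i < q) c * (H (j (1 + i)%N))%:R)); last first.
  by apply: ler_sum => i _; exact: HW.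
rewrite -mulr_sumr ler_wpM2l // -natr_sum lerBlDr -natrD ler_nat.
have : (tau q.+2 = tau 1%N + (\sum_(i < q) H (j (1 + i)) + H (j q.+1)))%N.
  by rewrite tauS {1}/tau big_ord_recl /= addnA {1}/tau big_ord1.
move: (bigop _ _ _) => b tE; rewrite tE in rs.
apply: (leq_trans (leq_addl s r)); apply: (leq_trans rs).
rewrite addnCA leq_add2l -addnn; exact: leq_add.
Qed.

End Traverses.

(** * Separation of orbit points inside a tower *)

Section Separation.
Context {R : realType}.

Lemma ln_le_sub1 (y : R) : 0 < y -> ln y <= y - 1.
Proof.
move=> y0; have := @le_ln1Dx R (y - 1).
by rewrite addrCA subrr addr0; apply; lra.
Qed.

Lemma ln_ge_1subV (y : R) : 0 < y -> 1 - y^-1 <= ln y.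
Proof.
move=> y0; have := @ln_le_sub1 y^-1; rewrite invr_gt0 => /(_ y0).
by rewrite lnV ?posrE //; lra.
Qed.

Lemma harmonic_le_ln N : \sum_(k < N) (k.+1%:R)^-1 <= 1 + ln N.+1%:R :> R.
Proof.
case: N => [|N]; first by rewrite big_ord0 ln1 addr0.
apply: (@le_trans _ _ (1 + ln N.+1%:R)); last by rewrite lerD2l ler_ln ?posrE ?ler_nat.
elim: N => [|N IH]; first by rewrite big_ord1 ln1 invr1 addr0.
rewrite big_ord_recr /=; apply: le_trans (lerD IH (lexx _)) _.
rewrite -addrA lerD2l -lerBrDl -ln_div ?posrE //.
have N1 : 0 < N.+2%:R / N.+1%:R :> R by rewrite divr_gt0.
apply: le_trans (ln_ge_1subV N1); rewrite invf_div.
have b0 : N.+1%:R + 1 != 0 :> R by rewrite natr1.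
rewrite -[N.+2%:R]natr1; move: (N.+1%:R) b0 => a a0.
by rewrite -[X in X - _](divff a0) -mulrBl addrAC subrr add0r mul1r.
Qed.

Lemma sum_at_most_one (I : finType) (P : pred I) (G : I -> R) b : 0 <= b ->
  (forall i, P i -> G i <= b) -> (forall i j, P i -> P j -> i = j) ->
  \sum_(i | P i) G i <= b.
Proof.
move=> b0 Gb Pu; case: (pickP P) => [i Pi|P0]; last by rewrite big_pred0.
rewrite (big_pred1 i) ?Gb // => j /=.
by apply/idP/eqP => [Pj|->//]; exact: Pu.
Qed.

(** Cut the half-line into cells of length [w]: each cell contains at most one
    of the separated values [D i], and a value of cell number [k > 0] is at
    least [k * w], so that all but the value of cell [0] are controlled by a
    harmonic sum. *)
Lemma separated_sum_le (I : finType) (D G : I -> R) (w rho psi B : R) :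
  0 < w -> 0 <= rho -> 0 <= psi -> 0 <= B ->
  (forall i j, i != j -> w <= `|D i - D j|) ->
  (forall i, ~~ (0 < D i <= rho) -> G i = 0) ->
  (forall i, 0 < D i <= rho -> G i <= B /\ G i <= psi / D i) ->
  \sum_i G i <= B + psi / w * (1 + ln (1 + rho / w)).
Proof.
move=> w0 rho0 psi0 B0 sep G0 Gle.
pose N := Num.truncn (rho / w).
have rw0 : 0 <= rho / w by rewrite divr_ge0 // ltW.
pose c i := Num.truncn (D i / w).
pose P i := 0 < D i <= rho.
have cE i : P i -> (c i)%:R * w <= D i < (c i).+1%:R * w.
  move=> /andP[Di _]; rewrite -ler_pdivlMr // -ltr_pdivrMr //.
  by apply: truncn_itv; rewrite divr_ge0 // ltW.
have cN i : P i -> (c i < N.+1)%N.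
  by move=> /andP[_ Dr]; rewrite ltnS le_truncn // ler_pM2r // invr_gt0.
have cinj i j : P i -> P j -> c i = c j -> i = j.
  move=> /cE + /cE => + + cij; rewrite -cij -natr1 mulrDl mul1r => /andP[i1 i2] /andP[j1 j2].
  apply/eqP/negPn/negP => /sep; rewrite leNgt ltr_norml => /negP; apply.
  by apply/andP; split; lra.
rewrite (bigID P) /= [X in _ + X]big1 ?addr0; last by move=> i /G0.
rewrite (partition_big (fun i => inord (c i) : 'I_N.+1) xpredT) //=.
have inordE i k : P i && (inord (c i) == k :> 'I_N.+1) -> P i /\ c i = k.
  by move=> /andP[Pi /eqP <-]; rewrite inordK ?cN.
rewrite big_ord_recl; apply: lerD.
  apply: sum_at_most_one => // [i /inordE[/Gle[]//]|i j /inordE[Pi ci] /inordE[Pj cj]].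
  by apply: cinj; rewrite // ci cj.
apply: (@le_trans _ _ (psi / w * \sum_(k < N) (k.+1%:R)^-1)).
  rewrite mulr_sumr; apply: ler_sum => k _.
  apply: sum_at_most_one => [|i /inordE[Pi ci]|i j /inordE[Pi ci] /inordE[Pj cj]].
  - by rewrite !mulr_ge0 ?invr_ge0 // ltW.
  - have [_ /le_trans] := Gle _ Pi; apply; rewrite -mulrA ler_wpM2l //.
    have /andP[h _] := cE _ Pi; rewrite ci /= /bump /= add1n in h.
    rewrite -invfM lef_pV2 ?posrE ?mulr_gt0 // 1?mulrC //.
    by case/andP: Pi.
  - by apply: cinj; rewrite // ci cj.
rewrite ler_wpM2l ?divr_ge0 ?(ltW w0) //.
apply: le_trans (harmonic_le_ln N) _; rewrite lerD2l ler_ln ?posrE ?ltr_pwDl //.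
by rewrite -natr1 addrC lerD2l truncn_le.
Qed.

Context {d : nat} {T T' : iet R d} {H : 'I_d -> nat} {it : 'I_d -> nat -> 'I_d}.
Hypothesis tw : tower T T' H it.

(** Two points of an orbit segment contained in one tower occupy the same
    position in two disjoint floors of equal length. *)
Lemma tower_separated j x (t s : 'I_(H j)) : in_piece T' j x -> t != s ->
  iet_len T' j <= `|iter t (iet_map T) x - iter s (iet_map T) x|.
Proof.
move=> jx ts.
pose fl (u : 'I_(H j)) : tfloor H := Tagged (fun j => 'I_(H j)) u.
have E (u : 'I_(H j)) : iter u (iet_map T) x
    = x - endpt T' j + floor_lo (T := T) (T' := T') (fl u).
  exact: (in_floorE tw (f := fl u) jx).
have flE : floor_len (T' := T') (fl t) = iet_len T' j by [].
have flsE : floor_len (T' := T') (fl s) = iet_len T' j by [].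
rewrite leNgt; apply/negP; rewrite !E ltr_norml => /andP[h1 h2].
have : fl t = fl s; last first.
  move=> /eqP; rewrite -tag_eqE /tag_eq eqxx /= tagged_asE => /eqP tse.
  by rewrite tse eqxx in ts.
case: (leP (floor_lo (T := T) (T' := T') (fl t)) (floor_lo (T := T) (T' := T') (fl s))) => h.
  apply: (in_floor_inj tw _ (in_floor_lo (fl s))).
  by rewrite /in_floor h flE /=; lra.
apply: (in_floor_inj tw (in_floor_lo (fl t))).
by rewrite /in_floor (ltW h) flsE /=; lra.
Qed.

Lemma near_tower_sum_le (s a w rho psi B : R) (g : R -> R) j x :
  s ^+ 2 = 1 -> 0 < w -> w <= iet_len T' j -> 0 <= rho -> 0 <= psi -> 0 <= B ->
  (forall y, 0 <= y < total_len T -> ~~ (0 < s * (y - a) <= rho) -> g y = 0) ->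
  (forall y, 0 <= y < total_len T -> 0 < s * (y - a) <= rho ->
    g y <= B /\ g y <= psi / (s * (y - a))) ->
  in_piece T' j x ->
  birkhoff (iet_map T) g (H j) x <= B + psi / w * (1 + ln (1 + rho / w)).
Proof.
move=> s1 w0 wj rho0 psi0 B0 gz gle jx.
have yr t : 0 <= iter t (iet_map T) x < total_len T.
  by apply/iter_iet_range/(tower_sub tw)/(in_piece_range jx).
apply: (separated_sum_le (D := fun t : 'I_(H j) => s * (iter t (iet_map T) x - a)))
  => // [t u tu|t|t].
- rewrite -mulrBr normrM (_ : `|s| = 1) ?mul1r; last first.
    by apply/eqP; rewrite -(@eqrXn2 _ 2) // ?normr_ge0 // real_normK ?num_real ?s1 ?expr1n.
  rewrite opprB addrA subrK; apply: le_trans wj _; exact: tower_separated.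
- exact: gz.
- exact: gle.
Qed.

End Separation.

(** * Hilbert contraction and growth of heights *)

Section HilbertDist.
Context {R : realType} {d : nat}.
Implicit Types a b : 'cV[R]_d.

Lemma hilbert_dist_cross a b delta : (forall i, 0 < a i 0) -> (forall i, 0 < b i 0) ->
  hilbert_dist a b <= delta ->
  forall i i', a i 0 * b i' 0 <= expR delta * (a i' 0 * b i 0).
Proof.
move=> a0 b0 hd i i'.
have r0 k : 0 < a k 0 / b k 0 by rewrite divr_gt0.
have maxr k : a k 0 / b k 0 <= max_ratio a b by exact: le_bigmax.
have minr k : min_ratio a b <= a k 0 / b k 0 by exact: bigmin_le_cond.
have min0 : 0 < min_ratio a b.
  by apply: lt_bigmin => [|k _]; rewrite ?r0 // (lt_le_trans (r0 i) (maxr i)).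
have max0 : 0 < max_ratio a b by exact: lt_le_trans (maxr i).
have : max_ratio a b / min_ratio a b <= expR delta.
  by rewrite -ler_ln ?posrE ?divr_gt0 ?expR_gt0 // expRK.
rewrite ler_pdivrMr // => hmm.
have : a i 0 / b i 0 <= expR delta * (a i' 0 / b i' 0).
  apply: le_trans (maxr i) (le_trans hmm _).
  by rewrite ler_wpM2l ?expR_ge0.
by rewrite mulrA ler_pdivrMr // mulrAC ler_pdivlMr // mulrA.
Qed.

Lemma mulmx_pos (M : 'M[R]_d) a : (forall i j, 0 < M i j) ->
  (forall i, 0 < a i 0) -> forall i, 0 < (M *m a) i 0.
Proof.
move=> M0 a0 i; rewrite mxE (bigD1 i) //= ltr_pwDl ?mulr_gt0 //.
by apply: sumr_ge0 => j _; rewrite mulr_ge0 // ltW.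
Qed.

End HilbertDist.

(** The part of the Diophantine condition that governs the towers along the
    accelerated times, with its constants made explicit. *)
Record balanced (R : realType) (d : nat) (RV : nat -> iet R d) (n : nat -> nat)
    (kappa nu D D' : R) (lbar : nat) : Prop := Balanced {
  bl_step : forall k, rv_step (RV k) (RV k.+1);
  bl_one : total_len (RV 0%N) = 1;
  bl_mono : {homo n : l m / (l < m)%N};
  bl_kappa : 1 < kappa;
  bl_nu : 1 < nu;
  bl_D : 0 < D < 1;
  bl_D' : 0 < D';
  bl_len : forall l (i j : 'I_d),
    nu^-1 <= iet_len (RV (n l)) i / iet_len (RV (n l)) j <= nu;
  bl_height : forall l (i j : 'I_d),
    kappa^-1 <= (height RV (n l) i)%:R / (height RV (n l) j)%:R <= kappa;
  bl_pos : forall l (i j : 'I_d), 0 < rv_matrix RV (n l) (n (l + lbar)%N) i j;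
  bl_contract : forall l (a b : 'cV[R]_d),
    (forall i, 0 < a i 0) -> (forall i, 0 < b i 0) ->
    hilbert_dist (rv_matrix RV (n l) (n (l + lbar)%N) *m a)
                 (rv_matrix RV (n l) (n (l + lbar)%N) *m b)
      <= Num.min (D * hilbert_dist a b) D' }.

Section Balanced.
Context {R : realType} {d : nat} {RV : nat -> iet R d} {n : nat -> nat}
  {kappa nu D D' : R} {lbar : nat}.
Hypothesis bl : balanced RV n kappa nu D D' lbar.

Local Notation A := (rv_matrix RV).
Local Notation RVstep := (bl_step bl).
Local Notation F := (iet_map (RV 0%N)).

Lemma bl_le l m : (l <= m)%N -> (n l <= n m)%N.
Proof. by rewrite leq_eqVlt => /predU1P[->//|/(bl_mono bl)/ltnW]. Qed.

Lemma balanced_d_gt1 : (1 < d)%N.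
Proof.
have d0 := rv_step_d_gt0 (RVstep 0%N).
have [h _ _ _] := RVstep 0%N; rewrite ltn_neqAle d0 andbT.
apply: contra_neqN h => /eqP d1; apply: eq_bigl => j.
have one (i : 'I_d) : (i.+1 == d) = true.
  by rewrite eqn_leq ltn_ord -[leqLHS]d1 ltnS.
by rewrite !one.
Qed.

Lemma bl_mul_block l q :
  A (n l) (n (l + q.+1 * lbar)%N)
  = A (n l) (n (l + lbar)%N) *m A (n (l + lbar)%N) (n (l + lbar + q * lbar)%N).
Proof.
rewrite mulSn addnA; apply: (rv_matrix_mul RVstep).
by rewrite !bl_le // leq_addr.
Qed.

Lemma bl_pos_block l q (i j : 'I_d) : 0 < A (n l) (n (l + q.+1 * lbar)%N) i j.
Proof.
elim: q l i j => [|q IH] l i j; first by rewrite mul1n; exact: (bl_pos bl).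
rewrite bl_mul_block mxE (bigD1 i) //= ltr_pwDl ?mulr_gt0 //.
- exact: (bl_pos bl).
- by rewrite sumr_ge0 // => k _; rewrite mulr_ge0 // rv_matrix_ge0.
Qed.

Lemma bl_contract_block l q (a b : 'cV[R]_d) :
  (forall i, 0 < a i 0) -> (forall i, 0 < b i 0) ->
  hilbert_dist (A (n l) (n (l + q.+1 * lbar)%N) *m a)
               (A (n l) (n (l + q.+1 * lbar)%N) *m b) <= D ^+ q * D'.
Proof.
move=> a0 b0; elim: q l => [|q IH] l.
  rewrite mul1n expr0 mul1r; apply: le_trans (bl_contract bl l a0 b0) _.
  by rewrite ge_min lexx orbT.
rewrite bl_mul_block -!mulmxA.
have P0 := mulmx_pos (bl_pos_block (l + lbar)%N q).
apply: le_trans (bl_contract bl l (P0 _ a0) (P0 _ b0)) _.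
rewrite ge_min exprS -mulrA ler_pM2l ?IH //.
by case/andP: (bl_D bl).
Qed.

(** Along the induction all columns of the matrices become proportional, to the
    length vector: the innermost block makes the columns positive vectors, the
    next one brings their mutual distance below [D'], and each further block
    contracts it by [D]. *)
Lemma rv_matrix_cross l q i i' j j' :
  let m := n l in let m' := n (l + q.+2 * lbar)%N in
  A m m' i j * A m m' i' j' <= expR (D ^+ q * D') * (A m m' i' j * A m m' i j').
Proof.
rewrite /=; set m := n l; set m' := n _; pose k := (l + q.+1 * lbar)%N.
have kE : (l + q.+2 * lbar)%N = (k + lbar)%N by rewrite /k -addnA -mulSnr.
have AE : A m m' = A m (n k) *m A (n k) m'.
  apply: (rv_matrix_mul RVstep).
  by rewrite /m /m' kE /k !bl_le // ?leq_addr.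
have colE i0 j0 : A m m' i0 j0 = (A m (n k) *m col j0 (A (n k) m')) i0 0.
  by rewrite AE [LHS]mxE [RHS]mxE; apply: eq_bigr => h _; rewrite [col _ _ _ _]mxE.
have cpos j0 h : 0 < (col j0 (A (n k) m')) h 0.
  by rewrite [ltRHS]mxE /m' kE; exact: (bl_pos bl).
have P0 := mulmx_pos (bl_pos_block l q).
rewrite !colE; apply: hilbert_dist_cross.
- exact: P0.
- exact: P0.
- exact: bl_contract_block.
Qed.

Lemma sum_len_height m : \sum_i (height RV m i)%:R * iet_len (RV m) i = 1.
Proof. by rewrite (sum_height_len RVstep) (bl_one bl). Qed.

(** The height of a column and the length of a row are both sums of entries with
    positive weights, and the weights sum to 1. The bound on the cross-ratios,
    applied term by term, therefore compares each entry with the product of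
    height and length, which is the expected number of visits. *)
Lemma rv_matrix_equidist l q i j :
  let m := n l in let m' := n (l + q.+2 * lbar)%N in
  let delta := D ^+ q * D' in
  expR (- delta) * ((height RV m' j)%:R * iet_len (RV m) i) <= A m m' i j
    <= expR delta * ((height RV m' j)%:R * iet_len (RV m) i).
Proof.
rewrite /=; set m := n l; set m' := n _; set delta := D ^+ q * D'.
have mm' : (m <= m')%N by rewrite bl_le // leq_addr.
have S1 : \sum_i' \sum_j' A m m' i' j' * ((height RV m i')%:R * iet_len (RV m') j') = 1.
  rewrite -[RHS](sum_len_height m); apply: eq_bigr => i' _.
  rewrite (iet_len_rv_matrix RVstep i' mm') mulr_sumr.
  by apply: eq_bigr => j' _; rewrite mulrCA.
have S2 : \sum_i' \sum_j' (A m m' i' j * A m m' i j')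
      * ((height RV m i')%:R * iet_len (RV m') j')
    = (height RV m' j)%:R * iet_len (RV m) i.
  rewrite (height_rv_matrix RVstep j mm') (iet_len_rv_matrix RVstep i mm').
  rewrite mulr_suml; apply: eq_bigr => i' _; rewrite mulr_sumr.
  by apply: eq_bigr => j' _; ring.
have w0 i' j' : 0 <= (height RV m i')%:R * iet_len (RV m') j'.
  by rewrite mulr_ge0 // ltW // iet_len_gt0.
have S3 : A m m' i j = \sum_i' \sum_j' (A m m' i j * A m m' i' j')
    * ((height RV m i')%:R * iet_len (RV m') j').
  rewrite -[LHS]mulr1 -[X in _ * X = _]S1 mulr_sumr; apply: eq_bigr => i' _.
  by rewrite mulr_sumr; apply: eq_bigr => j' _; rewrite mulrA.
apply/andP; split.
  rewrite expRN mulrC ler_pdivrMr ?expR_gt0 // [leRHS]mulrC S3 -S2 mulr_sumr.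
  apply: ler_sum => i' _; rewrite mulr_sumr; apply: ler_sum => j' _.
  by rewrite [leRHS]mulrA ler_wpM2r //; exact: rv_matrix_cross.
rewrite S3 -S2 mulr_sumr.
apply: ler_sum => i' _; rewrite mulr_sumr; apply: ler_sum => j' _.
by rewrite [leRHS]mulrA ler_wpM2r //; exact: rv_matrix_cross.
Qed.

Local Notation mh l := (max_height RV (n l)).

Lemma height_le_max l j : (height RV (n l) j <= mh l)%N.
Proof. exact: leq_bigmax. Qed.

Lemma max_height_attained l : exists j, mh l = height RV (n l) j.
Proof.
rewrite /max_height; have [|j ->] := @bigop.eq_bigmax _ (height RV (n l)); last by exists j.
by rewrite card_ord ltnW // balanced_d_gt1.
Qed.

Lemma max_height_gt0 l : (0 < mh l)%N.
Proof. by have [j ->] := max_height_attained l; exact: (height_gt0 RVstep). Qed.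

Lemma max_le_kappa_height l j : (mh l)%:R <= kappa * (height RV (n l) j)%:R.
Proof.
have [i ->] := max_height_attained l.
have /andP[_] := bl_height bl l i j.
by rewrite ler_pdivrMr // ltr0n (height_gt0 RVstep).
Qed.

(** Each tower at the later time runs through all towers of the earlier time,
    hence through the highest one and through another one of comparable
    height. *)
Lemma max_height_growth l :
  (1 + kappa^-1) * (mh l)%:R <= (mh (l + lbar))%:R.
Proof.
have [i iE] := max_height_attained l.
have k0 : 0 < kappa by rewrite (lt_trans _ (bl_kappa bl)).
have [i' ii'] : exists i', i' != i.
  case: (eqVneq i (Ordinal (ltnW balanced_d_gt1))) => [->|i0].
    by exists (Ordinal balanced_d_gt1).
  by eexists; rewrite eq_sym; exact: i0.
apply: (@le_trans _ _ (height RV (n (l + lbar)%N) i)%:R); last first.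
  by rewrite ler_nat height_le_max.
have lll : (n l <= n (l + lbar))%N by rewrite bl_le // leq_addr.
rewrite (height_rv_matrix RVstep i lll).
apply: (@le_trans _ _ (\sum_k (height RV (n l) k)%:R)); last first.
  apply: ler_sum => k _; rewrite ler_peMr //.
  have := bl_pos bl l k i; have [a ->] := rv_matrix_nat RV (n l) (n (l + lbar)) k i.
  by rewrite ltr0n ler1n.
rewrite (bigD1 i) //= (bigD1 i') //= -iE mulrDl mul1r lerD2l.
rewrite -[leLHS]addr0 lerD ?sumr_ge0 //.
by rewrite mulrC ler_pdivrMr // mulrC max_le_kappa_height.
Qed.

Lemma max_height_growth_iter l q :
  (1 + kappa^-1) ^+ q * (mh l)%:R <= (mh (l + q * lbar))%:R.
Proof.
elim: q => [|q IH]; first by rewrite expr0 mul1r addn0.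
rewrite mulSnr addnA exprS -mulrA; apply: le_trans (max_height_growth _).
rewrite ler_pM2l // ltr_wpDr // invr_ge0.
by rewrite ltW // (lt_trans _ (bl_kappa bl)).
Qed.

Lemma lbar_gt0 : (0 < lbar)%N.
Proof.
rewrite lt0n; apply/eqP => l0; have := max_height_growth 0.
rewrite l0 addn0 leNgt ltr_pMl ?ltr0n ?max_height_gt0 // ltrDl invr_gt0.
by rewrite (lt_trans _ (bl_kappa bl)).
Qed.

End Balanced.

(** * Equidistribution on floors *)

Section Equidistribution.
Context {R : realType} {d : nat} {RV : nat -> iet R d} {n : nat -> nat}
  {kappa nu D D' : R} {lbar : nat}.
Hypothesis bl : balanced RV n kappa nu D D' lbar.

Local Notation A := (rv_matrix RV).
Local Notation RVstep := (bl_step bl).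
Local Notation F := (iet_map (RV 0%N)).
Local Notation mh l := (max_height RV (n l)).
Local Notation lam l := (total_len (RV (n l))).

Lemma max_height_len_ge1 l : 1 <= (mh l)%:R * lam l.
Proof.
rewrite -[leLHS](sum_len_height bl (n l)) /total_len mulr_sumr; apply: ler_sum => j _.
by rewrite ler_wpM2r ?(ltW (iet_len_gt0 _ _)) // ler_nat height_le_max.
Qed.

Lemma max_height_len_le_kappa l : (mh l)%:R * lam l <= kappa.
Proof.
rewrite -[kappa]mulr1 -[X in kappa * X](sum_len_height bl (n l)).
rewrite /total_len !mulr_sumr; apply: ler_sum => j _; rewrite mulrA.
by rewrite ler_wpM2r ?(ltW (iet_len_gt0 _ _)) // (max_le_kappa_height bl).
Qed.

Lemma total_len_le_nu l j : lam l <= d%:R * nu * iet_len (RV (n l)) j.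
Proof.
rewrite -mulrA -[d in d%:R]card_ord mulr_natl -sumr_const; apply: ler_sum => i _.
have /andP[_] := bl_len bl l i j.
by rewrite ler_pdivrMr // iet_len_gt0.
Qed.

Lemma exists_expr_le (z e : R) : 0 <= z < 1 -> 0 < e -> exists p, z ^+ p <= e.
Proof.
move=> /andP[z0 z1] e0; have : `|z| < 1 by rewrite ger0_norm.
move=> /cvg_expr/cvgrPdist_le/(_ _ e0)[p _ /(_ p)/=].
rewrite sub0r normrN ger0_norm ?exprn_ge0 // => h.
by exists p; apply: h.
Qed.

Local Notation visits_floor k f r y :=
  (birkhoff F (fun z => (in_floor (T := RV 0%N) (T' := RV (n k)) f z)%:R : R) r y).

(** Complete traverses of the towers of an intermediate level visit a floor with
    the right frequency, by contraction below that level; and these towers are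
    so low compared with [mh l], by growth above that level, that the incomplete
    traverses at both ends do not matter. *)
Lemma floor_equidist (eta : R) : 0 < eta -> exists L, forall l, (L <= l)%N ->
  forall r y (f : tfloor (height RV (n (l - L)))), (mh l <= r)%N -> 0 <= y < 1 ->
  (1 - eta) * r%:R * floor_len (T' := RV (n (l - L))) f <= visits_floor (l - L)%N f r y
    <= (1 + eta) * r%:R * floor_len (T' := RV (n (l - L))) f.
Proof.
wlog eta1 : eta / eta <= 1.
  move=> wl eta0; have [h|h] := leP eta 1; first exact: wl.
  have [//|//|L HL] := wl 1; exists L => l Ll r y f lr y01.
  have /andP[h1 h2] := HL l Ll r y f lr y01.
  have w0 : 0 <= r%:R * floor_len (T' := RV (n (l - L)%N)) f.
    by rewrite mulr_ge0 // ltW // iet_len_gt0.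
  apply/andP; split.
    apply: le_trans h1; rewrite -!mulrA ler_wpM2r //; lra.
  apply: le_trans h2 _; rewrite -!mulrA ler_wpM2r //; lra.
move=> eta0; pose e := eta / 6; have e0 : 0 < e by rewrite divr_gt0.
have e6 : e <= 1 / 6 by rewrite /e; lra.
have /andP[D0 D1] := bl_D bl.
have [q qe] : exists q, D ^+ q <= e / D'.
  by apply: exists_expr_le; rewrite ?(ltW D0) //= divr_gt0 // (bl_D' bl).
have k1 : 0 < kappa^-1 by rewrite invr_gt0 (lt_trans _ (bl_kappa bl)).
have [p pe] : exists p, (1 + kappa^-1)^-1 ^+ p <= e.
  apply: exists_expr_le => //; rewrite invr_ge0 invf_lt1; last by lra.
  by apply/andP; split; lra.
exists (q.+2 * lbar + p * lbar)%N => l.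
set L := (_ + _)%N => Ll r y f lr y01.
have [it tw] := rv_height_tower RVstep (n (l - L + q.+2 * lbar)).
pose m' := n (l - L + q.+2 * lbar)%N.
set delta := D ^+ q * D'.
have de : delta <= e by rewrite /delta -ler_pdivlMr ?(bl_D' bl).
have de0 : 0 <= delta by rewrite mulr_ge0 ?exprn_ge0 ?(ltW D0) ?(ltW (bl_D' bl)).
have expl : 1 - e <= expR (- delta).
  by apply: le_trans (expR_ge1Dx _); rewrite lerD2l lerN2.
have expu : expR delta <= 1 + 2 * e.
  have e1 : 0 < 1 - e by lra.
  apply: (@le_trans _ _ (1 - e)^-1).
    by rewrite -[expR delta]invrK -expRN lef_pV2 ?posrE ?expR_gt0.
  by rewrite -[(1 - e)^-1]mul1r ler_pdivrMr //; nra.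
set w := floor_len (T' := RV (n (l - L)%N)) f.
have w0 : 0 < w by exact: iet_len_gt0.
have l'l : (n (l - L) <= m')%N by apply: (bl_le bl); exact: leq_addr.
have cnt j x : in_piece (RV m') j x ->
    expR (- delta) * w * (height RV m' j)%:R
      <= visits_floor (l - L)%N f (height RV m' j) x
      <= expR delta * w * (height RV m' j)%:R.
  move=> jx; rewrite /birkhoff (floor_count RVstep f l'l jx).
  have := rv_matrix_equidist bl (l - L) q (tag f) j.
  by rewrite -/m' -/delta -/w -!mulrA ![w * _]mulrC.
have hmax j : (height RV m' j <= mh (l - L + q.+2 * lbar))%N by exact: height_le_max.
have hr : (mh (l - L + q.+2 * lbar))%:R <= e * r%:R :> R.
  have := max_height_growth_iter bl (l - L + q.+2 * lbar) p.
  rewrite -addnA subnK // => g.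
  have t0 : 0 < (1 + kappa^-1) ^+ p by rewrite exprn_gt0 //; lra.
  apply: (@le_trans _ _ (((1 + kappa^-1) ^+ p)^-1 * (mh l)%:R)).
    by rewrite -ler_pdivrMl ?invr_gt0 // invrK.
  by rewrite -exprVn ler_pM ?exprn_ge0 ?invr_ge0 ?ler_nat //; lra.
have y01' : 0 <= y < total_len (RV 0%N) by rewrite (bl_one bl).
have g0 z : 0 <= (in_floor (T := RV 0%N) (T' := RV (n (l - L)%N)) f z)%:R :> R by [].
have r0 : 0 <= r%:R :> R by [].
move: hr; set hh := mh (_ + _)%N in hmax * => hr.
apply/andP; split.
  have ew0 : 0 <= expR (- delta) * w by rewrite mulr_ge0 ?expR_ge0 ?(ltW w0).
  have := birkhoff_ge_height tw g0 r ew0 hmax _ y01'; move=> /(_ _)h.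
  apply: (@le_trans _ _ (expR (- delta) * w * (r%:R - hh.*2%:R))); last first.
    by apply: h => j x jx; have /andP[+ _] := cnt j x jx; exact.
  rewrite [leRHS]mulrAC ler_wpM2r ?(ltW w0) // -muln2 natrM.
  have x1 : 0 <= expR (- delta) by exact: expR_ge0.
  apply: (@le_trans _ _ ((1 - e) * (r%:R - hh%:R * 2))).
    rewrite /e in hr *; nra.
  rewrite ler_wpM2r //; nra.
have ew0 : 0 <= expR delta * w by rewrite mulr_ge0 ?expR_ge0 ?(ltW w0).
have := birkhoff_le_height tw g0 r ew0 hmax _ y01'; move=> /(_ _)h.
apply: (@le_trans _ _ (expR delta * w * (r + hh.*2)%:R)).
  by apply: h => j x jx; have /andP[_ +] := cnt j x jx; exact.
rewrite [leLHS]mulrAC ler_wpM2r ?(ltW w0) // natrD -muln2 natrM.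
apply: (@le_trans _ _ ((1 + 2 * e) * (r%:R + hh%:R * 2))).
  by rewrite ler_wpM2r // addr_ge0 // mulr_ge0.
apply: (@le_trans _ _ ((1 + 2 * e) * ((1 + 2 * e) * r%:R))).
  by rewrite ler_wpM2l //; lra.
rewrite mulrA ler_wpM2r //.
have -> : eta = 6 * e by rewrite /e; field.
by nra.
Qed.

End Equidistribution.

Section FloorSums.
Context {R : realType} {d : nat} {T T' : iet R d} {H : 'I_d -> nat}
  {it : 'I_d -> nat -> 'I_d}.
Hypothesis tw : tower T T' H it.
Local Notation F := (iet_map T).
Local Notation flen := (floor_len (T' := T') (H := H)).
Local Notation visits_floor f r y :=
  (birkhoff F (fun z => (in_floor (T := T) (T' := T') f z)%:R : R) r y).

Lemma birkhoff_floors (c : tfloor H -> R) r y :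
  birkhoff F (fun y => \sum_f c f * (in_floor (T := T) (T' := T') f y)%:R) r y
  = \sum_f c f * visits_floor f r y.
Proof.
rewrite /birkhoff exchange_big /=; apply: eq_bigr => f _.
by rewrite mulr_sumr.
Qed.

Lemma floor_stepE (c : tfloor H -> R) f y : in_floor (T := T) (T' := T') f y ->
  \sum_f c f * (in_floor (T := T) (T' := T') f y)%:R = c f.
Proof.
move=> fy; rewrite (bigD1 f) //= fy mulr1 big1 ?addr0 // => f' ff'.
case: (boolP (in_floor _ _)) => h; rewrite ?mulr0 //.
by rewrite (in_floor_inj tw h fy) eqxx in ff'.
Qed.

Lemma birkhoff_le_floors (g : R -> R) (c : tfloor H -> R) eta r y :
  (forall f, 0 <= c f) ->
  (forall (f : tfloor H) y, in_floor (T := T) (T' := T') f y -> g y <= c f) ->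
  0 <= y < total_len T ->
  (forall f : tfloor H, visits_floor f r y <= (1 + eta) * r%:R * flen f) ->
  birkhoff F g r y <= (1 + eta) * r%:R * \sum_f c f * flen f.
Proof.
move=> c0 gc yr vis; rewrite mulr_sumr.
apply: (@le_trans _ _ (\sum_f c f * visits_floor f r y)).
  rewrite -birkhoff_floors; apply: ler_sum => i _.
  have [f fy] := in_floor_ex tw (iter_iet_range i yr).
  by rewrite (floor_stepE _ fy) gc.
by apply: ler_sum => f _; rewrite mulrCA ler_wpM2l.
Qed.

Lemma birkhoff_ge_floors (g : R -> R) (c : tfloor H -> R) eta r y :
  (forall f, 0 <= c f) ->
  (forall (f : tfloor H) y, in_floor (T := T) (T' := T') f y -> c f <= g y) ->
  0 <= y < total_len T ->
  (forall f : tfloor H, (1 - eta) * r%:R * flen f <= visits_floor f r y) ->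
  (1 - eta) * r%:R * (\sum_f c f * flen f) <= birkhoff F g r y.
Proof.
move=> c0 gc yr vis; rewrite mulr_sumr.
apply: (@le_trans _ _ (\sum_f c f * visits_floor f r y)).
  by apply: ler_sum => f _; rewrite mulrCA ler_wpM2l.
rewrite -birkhoff_floors; apply: ler_sum => i _.
have [f fy] := in_floor_ex tw (iter_iet_range i yr).
by rewrite (floor_stepE _ fy) gc.
Qed.

End FloorSums.

(** * One-sided singularities and far points *)

Section Cusp.
Context {R : realType}.

(** The sign [s] selects the side of [a], so that both sides are treated by the
    same estimates. *)
Definition cusp (s a y : R) : R :=
  if 0 < s * (y - a) then (s * (y - a))^-1 else 0.

Lemma cusp_ge0 s a y : 0 <= cusp s a y.
Proof. by rewrite /cusp; case: ifP => // h; rewrite invr_ge0 ltW. Qed.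

(** A primitive of the singularity, frozen at distance less than [c] and on the
    other side, so that it is defined and monotone everywhere. *)
Definition cusp_primitive (s a c t : R) : R := s * ln (Num.max (s * (t - a)) c).

Lemma sign_cases (s : R) : s ^+ 2 = 1 -> s = 1 \/ s = -1.
Proof. by move=> /eqP; rewrite sqrf_eq1 => /orP[] /eqP; [left|right]. Qed.

Lemma ler_ln_imp (x y : R) : 0 < x -> x <= y -> ln x <= ln y.
Proof. by move=> x0 xy; rewrite ler_ln ?posrE ?(lt_le_trans x0 xy). Qed.

Lemma cusp_primitive_le s a c t u : s ^+ 2 = 1 -> 0 < c -> t <= u ->
  cusp_primitive s a c t <= cusp_primitive s a c u.
Proof.
move=> /sign_cases[->|->] c0 tu; rewrite /cusp_primitive ?mul1r.
  apply: ler_ln_imp; first by rewrite lt_max c0 orbT.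
  by rewrite ge_max !le_max lexx orbT andbT lerD2r tu.
rewrite !mulN1r lerN2; apply: ler_ln_imp; first by rewrite lt_max c0 orbT.
by rewrite ge_max !le_max lexx orbT andbT lerN2 lerD2r tu.
Qed.

Lemma cusp_primitive_total_le s a c : s ^+ 2 = 1 -> 0 < a < 1 -> 0 < c <= 1 ->
  cusp_primitive s a c 1 - cusp_primitive s a c 0 <= - ln c.
Proof.
move=> /sign_cases[->|->] /andP[a0 a1] /andP[c0 c1]; rewrite /cusp_primitive.
  rewrite !mul1r sub0r [Num.max (- a) c]max_r; last by lra.
  by rewrite gerDr ln_le0 // ge_max c1 andbT; lra.
rewrite !mulN1r sub0r opprK opprK [Num.max (- (1 - a)) c]max_r; last by lra.
by rewrite gerDl ln_le0 // ge_max c1 andbT; lra.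
Qed.

Lemma cusp_primitive_total_ge s a c : s ^+ 2 = 1 -> 0 < a < 1 -> 0 < c ->
  ln (Num.min a (1 - a)) - ln c
    <= cusp_primitive s a c 1 - cusp_primitive s a c 0.
Proof.
move=> /sign_cases[->|->] /andP[a0 a1] c0; rewrite /cusp_primitive.
  rewrite !mul1r sub0r [Num.max (- a) c]max_r; last by lra.
  rewrite lerD2r; apply: ler_ln_imp; first by rewrite lt_min a0; lra.
  by rewrite le_max ge_min lexx orbT.
rewrite !mulN1r sub0r opprK opprK [Num.max (- (1 - a)) c]max_r; last by lra.
rewrite addrC lerD2l; apply: ler_ln_imp; first by rewrite lt_min a0; lra.
by rewrite le_max ge_min lexx.
Qed.

Section Interval.
Context (s a M lam p q y : R).
Hypotheses (s1 : s ^+ 2 = 1) (M0 : 0 < M) (lam0 : 0 < lam).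
Hypotheses (pq : p < q) (qp : q - p <= lam) (py : p <= y < q).

Let log_upper lo hi D : 0 < lo -> lo <= D <= hi -> M * lam <= D -> hi <= D + lam ->
  (hi - lo) * D^-1 <= (1 + M^-1) * (ln hi - ln lo).
Proof.
move=> lo0 /andP[loD Dhi] MD hiD.
have D0 : 0 < D by exact: lt_le_trans loD.
have hi0 : 0 < hi by exact: lt_le_trans Dhi.
have M1 : 0 < 1 + M^-1 by rewrite ltr_wpDr ?invr_ge0 ?(ltW M0).
have h1 : (hi - lo) / hi <= ln hi - ln lo.
  rewrite -ln_div ?posrE //; apply: le_trans (ln_ge_1subV _); last by rewrite divr_gt0.
  by rewrite invf_div mulrBl divff ?gt_eqF.
apply: le_trans (ler_wpM2l (ltW M1) h1); rewrite mulrCA ler_wpM2l //; first by lra.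
rewrite ler_pdivlMr // mulrC ler_pdivrMr // mulrDl mul1r.
apply: le_trans hiD _; rewrite lerD2l mulrC ler_pdivlMr // mulrC //.
Qed.

Let log_lower lo hi D : M * lam <= lo -> lo <= D <= hi -> hi <= lo + lam ->
  ln hi - ln lo <= (1 + M^-1) * ((hi - lo) * D^-1).
Proof.
move=> Mlo /andP[loD Dhi] hilo.
have lo0 : 0 < lo by apply: lt_le_trans Mlo; rewrite mulr_gt0.
have D0 : 0 < D by exact: lt_le_trans loD.
have hi0 : 0 < hi by exact: lt_le_trans Dhi.
rewrite -ln_div ?posrE //; apply: le_trans (ln_le_sub1 _) _; first by rewrite divr_gt0.
have -> : hi / lo - 1 = (hi - lo) / lo by rewrite mulrBl divff ?gt_eqF.
rewrite mulrCA ler_wpM2l //; first by lra.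
rewrite ler_pdivlMr // mulrC ler_pdivrMr // mulrDl mul1r.
apply: le_trans Dhi _; apply: le_trans hilo _.
by rewrite lerD2l mulrC ler_pdivlMr // mulrC.
Qed.

(** On an interval whose distance from [a] is at least [M] times its length the
    singularity is constant up to the factor [1 + M^-1]. *)
Lemma cusp_far_le : (M + 1) * lam < s * (y - a) ->
  cusp s a y * (q - p)
    <= (1 + M^-1) * (cusp_primitive s a (M * lam) q - cusp_primitive s a (M * lam) p).
Proof.
have Ml : 0 < M * lam by rewrite mulr_gt0.
have l0 := lam0; have pq' := pq; have qp' := qp.
case/andP: py => yp yq.
case: (sign_cases s1) => ->; rewrite /cusp /cusp_primitive !(mul1r, mulN1r) => far.
  have -> : 0 < y - a by lra.
  rewrite !max_l; [|lra|lra]; rewrite mulrC.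
  have -> : q - p = (q - a) - (p - a) by ring.
  by apply: log_upper; lra.
have -> : 0 < - (y - a) by lra.
rewrite !max_l; [|lra|lra]; rewrite mulrC [- ln _ - - ln _]addrC opprK.
have -> : q - p = (- (p - a)) - (- (q - a)) by ring.
by apply: log_upper; lra.
Qed.

Lemma cusp_ge_floor :
  cusp_primitive s a ((M + 1) * lam) q - cusp_primitive s a ((M + 1) * lam) p
    <= (1 + M^-1) * (cusp s a y * (q - p)).
Proof.
have Ml : 0 < M * lam by rewrite mulr_gt0.
have l0 := lam0; have pq' := pq; have qp' := qp.
case/andP: py => yp yq.
have M1 : 0 < 1 + M^-1 by rewrite ltr_wpDr ?invr_ge0 ?(ltW M0).
have rhs0 : 0 <= (1 + M^-1) * (cusp s a y * (q - p)).
  by rewrite !mulr_ge0 ?cusp_ge0 ?(ltW M1) // subr_ge0 ltW.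
case: (sign_cases s1) rhs0 => ->; rewrite /cusp_primitive !(mul1r, mulN1r) => rhs0.
  have [near|far] := leP (q - a) ((M + 1) * lam).
    by rewrite max_r ?subrr //; lra.
  apply: (@le_trans _ _ (ln (q - a) - ln (p - a))).
    by rewrite lerD2l lerN2; apply: ler_ln_imp; rewrite ?le_max ?lexx //; lra.
  rewrite /cusp mul1r; have -> : 0 < y - a by lra.
  have -> : (y - a)^-1 * (q - p) = ((q - a) - (p - a)) * (y - a)^-1 by ring.
  by apply: log_lower; lra.
have [near|far] := leP (- (p - a)) ((M + 1) * lam).
  by rewrite max_r ?subrr //; lra.
rewrite [- ln _ - - ln _]addrC opprK.
apply: (@le_trans _ _ (ln (- (p - a)) - ln (- (q - a)))).
  by rewrite lerD2l lerN2; apply: ler_ln_imp; rewrite ?le_max ?lexx //; lra.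
rewrite /cusp mulN1r; have -> : 0 < - (y - a) by lra.
have -> : (- (y - a))^-1 * (q - p) = ((- (p - a)) - (- (q - a))) * (- (y - a))^-1.
  by ring.
by apply: log_lower; lra.
Qed.

End Interval.

Section Tower.
Context {d : nat} {T T' : iet R d} {H : 'I_d -> nat} {it : 'I_d -> nat -> 'I_d}.
Hypothesis tw : tower T T' H it.
Hypothesis T1 : total_len T = 1.
Local Notation F := (iet_map T).
Local Notation flo := (floor_lo (T := T) (T' := T') (H := H)).
Local Notation flen := (floor_len (T' := T') (H := H)).
Local Notation visits_floor f r y :=
  (birkhoff F (fun z => (in_floor (T := T) (T' := T') f z)%:R : R) r y).

Lemma floor_len_le_total (f : tfloor H) : flen f <= total_len T'.
Proof.
rewrite /floor_len /total_len (bigD1 (tag f)) //= lerDl sumr_ge0 // => j _.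
exact/ltW/iet_len_gt0.
Qed.

Section Bounds.
Context (s a M eta : R) (r : nat) (y : R).
Hypotheses (s1 : s ^+ 2 = 1) (a01 : 0 < a < 1) (M0 : 0 < M) (y01 : 0 <= y < 1).

Let y01' : 0 <= y < total_len T. Proof. by rewrite T1. Qed.
Let lam0 : 0 < total_len T'. Proof. exact: (tw_pos tw). Qed.
Let fl_sub (f : tfloor H) : flo f + flen f - flo f = flen f.
Proof. by rewrite addrAC subrr add0r. Qed.
Let M1 : 0 < 1 + M^-1. Proof. by rewrite ltr_wpDr ?invr_ge0 ?(ltW M0). Qed.

Lemma birkhoff_cusp_far_le : 0 <= 1 + eta -> M * total_len T' <= 1 ->
  (forall f : tfloor H, visits_floor f r y <= (1 + eta) * r%:R * flen f) ->
  birkhoff F (fun z => if (M + 1) * total_len T' < s * (z - a)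
                       then cusp s a z else 0) r y
    <= (1 + eta) * r%:R * ((1 + M^-1) * - ln (M * total_len T')).
Proof.
move=> eta0 Ml1 vis; set c := M * total_len T' in Ml1 *.
have c0 : 0 < c by rewrite mulr_gt0.
pose G := cusp_primitive s a c.
pose C f := (1 + M^-1) * (G (flo f + flen f) - G (flo f)) / flen f.
have fl0 (f : tfloor H) : 0 < flen f by exact: iet_len_gt0.
have C0 f : 0 <= C f.
  rewrite !mulr_ge0 ?(ltW M1) ?invr_ge0 ?(ltW (fl0 f)) // subr_ge0.
  by apply: cusp_primitive_le => //; rewrite lerDl ltW.
apply: le_trans (birkhoff_le_floors tw C0 _ y01' vis) _.
  move=> f z fz; case: ifP => [far|_]; last exact: C0.
  rewrite /C ler_pdivlMr //; move: (cusp_far_le (s := s) (a := a) (M := M)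
    (lam := total_len T') (p := flo f) (q := flo f + flen f) (y := z)).
  by rewrite fl_sub; apply => //; rewrite ?floor_len_le_total ?ltrDl.
rewrite ler_wpM2l ?mulr_ge0 // /C.
under eq_bigr do rewrite divfK ?gt_eqF //.
rewrite -mulr_sumr ler_wpM2l ?(ltW M1) //.
rewrite (sum_floors tw G) T1 /G; apply: cusp_primitive_total_le => //.
by rewrite c0.
Qed.

Lemma birkhoff_cusp_ge : 0 <= 1 - eta ->
  (forall f : tfloor H, (1 - eta) * r%:R * flen f <= visits_floor f r y) ->
  (1 - eta) * r%:R * ((1 + M^-1)^-1
    * (ln (Num.min a (1 - a)) - ln ((M + 1) * total_len T')))
  <= birkhoff F (cusp s a) r y.
Proof.
move=> eta0 vis; set c := (M + 1) * total_len T'.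
have c0 : 0 < c by rewrite mulr_gt0 // addr_gt0.
pose G := cusp_primitive s a c.
pose C f := (1 + M^-1)^-1 * (G (flo f + flen f) - G (flo f)) / flen f.
have fl0 (f : tfloor H) : 0 < flen f by exact: iet_len_gt0.
have C0 f : 0 <= C f.
  rewrite !mulr_ge0 ?invr_ge0 ?(ltW M1) ?(ltW (fl0 f)) // subr_ge0.
  by apply: cusp_primitive_le => //; rewrite lerDl ltW.
apply: le_trans (birkhoff_ge_floors tw C0 _ y01' vis).
  rewrite ler_wpM2l ?mulr_ge0 // /C.
  under eq_bigr do rewrite divfK ?gt_eqF //.
  rewrite -mulr_sumr ler_wpM2l ?invr_ge0 ?(ltW M1) //.
  by rewrite (sum_floors tw G) T1 /G; apply: cusp_primitive_total_ge.
move=> f z fz; rewrite /C ler_pdivrMr // ler_pdivrMl //.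
move: (cusp_ge_floor a (s := s) (M := M)
  (lam := total_len T') (p := flo f) (q := flo f + flen f) (y := z)).
by rewrite fl_sub; apply => //; rewrite ?floor_len_le_total ?ltrDl.
Qed.

End Bounds.
End Tower.
End Cusp.

(** * Slow growth of heights along the accelerated times *)

Section Growth.
Context {R : realType}.

Lemma ln_le_powR (b X : R) : 0 < b -> 0 < X -> ln X <= X `^ b / b.
Proof.
move=> b0 X0; rewrite ler_pdivlMr // mulrC -ln_powR.
by apply/ltW/ln_sublinear; rewrite powR_gt0.
Qed.

Lemma powR_ge_large (b B : R) : 0 < b -> exists X0, 1 <= X0 /\ forall X, X0 <= X -> B <= X `^ b.
Proof.
move=> b0; pose B1 := Num.max 1 B.
have B10 : 0 <= B1 by rewrite le_max ler01.
have B11 : 1 <= B1 by rewrite le_max lexx.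
exists (B1 `^ b^-1); split.
  by rewrite -(powRr0 B1); apply: ler_powR; rewrite ?invr_ge0 ?(ltW b0).
move=> X h; have : (B1 `^ b^-1) `^ b <= X `^ b.
  by apply: ge0_ler_powR; rewrite ?nnegrE ?powR_ge0 ?(ltW b0) // (le_trans _ h) ?powR_ge0.
rewrite -powRrM mulVf ?gt_eqF // powRr1 //; apply: le_trans.
by rewrite le_max lexx orbT.
Qed.

Lemma log_powR_small (t C e : R) : 0 < t < 1 -> 0 <= C -> 0 < e ->
  exists X0, 1 <= X0 /\ forall X, X0 <= X -> C * (1 + ln X) * X `^ t <= e * X.
Proof.
move=> /andP[t0 t1] C0 e0; pose b := (1 - t) / 2.
have b0 : 0 < b by rewrite divr_gt0 // subr_gt0.
have [X0 [X01 HX]] := powR_ge_large (C * (1 + b^-1) / e) b0.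
exists X0; split=> // X XX.
have X1 : 1 <= X by exact: le_trans XX.
have Xp : 0 < X by exact: lt_le_trans X1.
have Xb1 : 1 <= X `^ b by rewrite -(powRr0 X); apply: ler_powR; rewrite ?(ltW b0).
have h1 : 1 + ln X <= (1 + b^-1) * X `^ b.
  have E : (1 + b^-1) * X `^ b = X `^ b + X `^ b / b by ring.
  by rewrite E lerD // ln_le_powR.
have h2 : X = X `^ b * (X `^ b * X `^ t).
  rewrite -!powRD ?(gt_eqF Xp) ?implybT //.
  by rewrite (_ : b + (b + t) = 1) ?powRr1 ?(ltW Xp) // /b; field.
have Xt0 : 0 <= X `^ t by exact: powR_ge0.
rewrite [in leRHS]h2 -[leLHS]mulrA.
apply: (@le_trans _ _ (C * ((1 + b^-1) * X `^ b * X `^ t))).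
  by rewrite ler_wpM2l // ler_wpM2r.
rewrite -!mulrA mulrA mulrA [e * _]mulrC mulrC.
have h3 := HX _ XX; rewrite ler_pdivrMr // in h3.
have w0 : 0 <= X `^ b * X `^ t by rewrite mulr_ge0 // powR_ge0.
rewrite mulrA [leRHS](_ : _ = (X `^ b * e) * (X `^ b * X `^ t)); last by ring.
rewrite [leLHS](_ : _ = (C * (1 + b^-1)) * (X `^ b * X `^ t)); last by ring.
by rewrite ler_wpM2r.
Qed.

Lemma expR_half_ge (Y : R) : 0 <= Y -> Y ^+ 2 / 16 <= expR (Y / 2).
Proof.
move=> Y0; have -> : Y / 2 = Y / 4 + Y / 4 by field.
rewrite expRD; have h := expR_ge1Dx (Y / 4).
have Y4 : 0 <= Y / 4 by rewrite divr_ge0.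
apply: (@le_trans _ _ ((Y / 4) * (Y / 4))); last by apply: ler_pM; lra.
by rewrite expr2 le_eqVlt; apply/orP; left; apply/eqP; field.
Qed.

End Growth.

Section Scales.
Context {R : realType} {d : nat} {RV : nat -> iet R d} {n : nat -> nat}
  {kappa nu D D' : R} {lbar : nat}.
Hypothesis bl : balanced RV n kappa nu D D' lbar.
Context {tau tau' : R}.
Hypotheses (htau : 1 < tau < 2) (htau' : tau / 2 < tau' < 1).
Hypothesis hnorm : (l%:R `^ (- tau) * mxnorm1 (rv_matrix RV (n l) (n l.+1)))
  @[l --> \oo] --> (0 : R).

Local Notation A := (rv_matrix RV).
Local Notation RVstep := (bl_step bl).
Local Notation mh l := (max_height RV (n l)).
Local Notation X l := (ln (mh l)%:R : R).
Local Notation N l := (mxnorm1 (A (n l) (n l.+1))).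

Lemma rv_matrix_row m k i : (m <= k)%N -> exists j, 1 <= A m k i j.
Proof.
move=> mk; have := iet_len_gt0 (RV m) i; rewrite (iet_len_rv_matrix RVstep i mk).
move=> s0; case: (pickP (fun j => 1 <= A m k i j)) => [j Aj|none]; first by exists j.
move: s0; rewrite big1 ?ltxx // => j _; have := none j.
have [[|a] ->] := rv_matrix_nat RV m k i j; first by rewrite mul0r.
by rewrite ler1n.
Qed.

Lemma max_height_mono l l' : (l <= l')%N -> (mh l <= mh l')%N.
Proof.
move=> ll; have [i ->] := max_height_attained bl l.
have [j Aj] := rv_matrix_row i (bl_le bl ll).
apply: (leq_trans _ (height_le_max (RV := RV) (n := n) l' j)); rewrite -(ler_nat R).
rewrite (height_rv_matrix RVstep j (bl_le bl ll)) (bigD1 i) //=.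
apply: (@le_trans _ _ ((height RV (n l) i)%:R * A (n l) (n l') i j)).
  by rewrite ler_peMr.
by rewrite lerDl sumr_ge0 // => k _; rewrite mulr_ge0 // rv_matrix_ge0.
Qed.

Let mh0 l : 0 < (mh l)%:R :> R.
Proof. by rewrite ltr0n (max_height_gt0 bl). Qed.

Lemma ln_max_height_mono l l' : (l <= l')%N -> X l <= X l'.
Proof. by move=> ll; rewrite ler_ln ?posrE ?mh0 // ler_nat max_height_mono. Qed.

Lemma mxnorm1_ge2 l : 2 <= N l.
Proof.
apply: (@le_trans _ _ (\sum_(i < d) 1)).
  by rewrite sumr_const card_ord ler_nat (balanced_d_gt1 bl).
apply: ler_sum => i _.
have [j Aj] := rv_matrix_row i (bl_le bl (leqnSn l)).
rewrite (bigD1 j) //= -[leLHS]addr0 lerD ?sumr_ge0 //.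
by rewrite (le_trans Aj) // ler_norm.
Qed.

Lemma max_height_succ_le l : (mh l.+1)%:R <= N l * (mh l)%:R.
Proof.
have [j ->] := max_height_attained bl l.+1.
rewrite (height_rv_matrix RVstep j (bl_le bl (leqnSn l))) mulr_suml.
apply: ler_sum => i _; rewrite mulrC ler_pM ?rv_matrix_ge0 ?ler_nat ?height_le_max //.
rewrite (bigD1 j) //= -[leLHS]addr0 lerD ?sumr_ge0 ?ler_norm //.
Qed.

Lemma ln_max_height_linear : exists2 c : R, 0 < c &
  forall l, (lbar.*2 <= l)%N -> c * l%:R <= X l.
Proof.
have k0 : 0 < kappa^-1 by rewrite invr_gt0 (lt_trans _ (bl_kappa bl)).
have lb := lbar_gt0 bl.
pose th := ln (1 + kappa^-1); have th0 : 0 < th by rewrite ln_gt0 // ltrDl.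
have lb0 : 0 < lbar%:R :> R by rewrite ltr0n.
exists (th / (2 * lbar%:R)); first by rewrite divr_gt0 // mulr_gt0.
move=> l l2; have q1 : (l < (l %/ lbar).+1 * lbar)%N by rewrite -ltn_divLR.
have h : X l >= (l %/ lbar)%:R * th.
  have := max_height_growth_iter bl (l %% lbar) (l %/ lbar).
  rewrite addnC -divn_eq => g; rewrite mulr_natl -lnXn; last by rewrite ltr_wpDr // ltW.
  apply: ler_ln_imp; first by rewrite exprn_gt0 // ltr_wpDr // ltW.
  apply: le_trans g; rewrite ler_peMr ?exprn_ge0 //; first by lra.
  by rewrite ler1n (max_height_gt0 bl).
apply: le_trans h; rewrite mulrAC ler_pdivrMr ?mulr_gt0 // mulrC [leRHS]mulrAC.
rewrite ler_wpM2r ?(ltW th0) //.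
have q2 : l%:R <= ((l %/ lbar)%:R + 1) * lbar%:R :> R.
  by rewrite natr1 -natrM ler_nat ltnW.
have l2' : lbar%:R * 2 <= l%:R :> R by rewrite -natrM ler_nat muln2.
nra.
Qed.

Lemma ln_mxnorm1_le : exists l0, forall l, (l0 <= l)%N -> ln (N l) <= 2 * ln l%:R.
Proof.
move/cvgrPdist_le: hnorm => /(_ 1 ltr01)[l0 _ h].
exists (maxn l0 1) => l; rewrite geq_max => /andP[ll l1].
have := h l ll; rewrite /= sub0r normrN => /(le_trans (ler_norm _)).
have l0' : 0 < l%:R :> R by rewrite ltr0n.
rewrite powRN mulrC ler_pdivrMr ?powR_gt0 // mul1r => Nl.
have N0 : 0 < N l by rewrite (lt_le_trans _ (mxnorm1_ge2 l)).
apply: le_trans (ler_ln_imp N0 Nl) _; rewrite ln_powR ler_wpM2r //.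
  by rewrite ln_ge0 // ler1n.
by case/andP: htau => _ /ltW.
Qed.

(** A step multiplies the heights by at most the norm of the matrix, whose
    logarithm is at most [2 * ln l] for large [l]; and [ln l] is at most
    [ln (X l)] up to a constant, because [X l] grows at least linearly. *)
Lemma ln_max_height_gap L : exists l0 C, 0 <= C /\ forall l, (l0 <= l)%N ->
  [/\ (L <= l)%N, 1 <= X l & X l.+1 <= X (l - L) + C * (1 + ln (X l))].
Proof.
have [c c0 lin] := ln_max_height_linear.
have [l1 Nle] := ln_mxnorm1_le.
have step l : (l1 <= l)%N -> X l.+1 <= X l + 2 * ln l%:R.
  move=> ll; have N0 : 0 < N l by rewrite (lt_le_trans _ (mxnorm1_ge2 l)).
  have := ler_ln_imp (mh0 l.+1) (max_height_succ_le l).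
  rewrite lnM ?posrE ?mh0 // => /le_trans; apply.
  by rewrite addrC lerD2l Nle.
pose C := 2 * L.+1%:R * (1 + `|ln c|).
pose l0 := maxn (maxn (L + l1) lbar.*2) (maxn 1 (Num.bound c^-1)).
exists l0, C; split; first by rewrite !mulr_ge0 // addr_ge0.
move=> l; rewrite !geq_max => /andP[/andP[Ll lb] /andP[l1' lc]].
have L_l : (L <= l)%N by apply: leq_trans Ll; exact: leq_addr.
have lR : 0 < l%:R :> R by rewrite ltr0n.
have Xc := lin l lb.
have X1 : 1 <= X l.
  apply: le_trans Xc; rewrite -ler_pdivrMl // mulr1.
  apply: le_trans (ltW (archi_boundP _)) _; first by rewrite invr_ge0 ltW.
  by rewrite ler_nat.
split=> //.
have Xp : 0 < X l by exact: lt_le_trans X1.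
have lnl : ln l%:R <= `|ln c| + ln (X l).
  have := ler_ln_imp (mulr_gt0 c0 lR) Xc; rewrite lnM ?posrE //.
  have := ler_norm (- ln c); rewrite normrN; lra.
have lnl0 : 0 <= ln l%:R :> R by rewrite ln_ge0 // ler1n.
have chain k : (k <= L)%N -> X l.+1 <= X (l - k) + 2 * k.+1%:R * ln l%:R.
  elim: k => [|k IH] kL.
    by rewrite subn0 mulr1 step // (leq_trans _ Ll) // leq_addl.
  apply: le_trans (IH (ltnW kL)) _.
  have kl : (k < l)%N by exact: leq_trans kL L_l.
  have -> : (l - k = (l - k.+1).+1)%N by rewrite subnSK.
  have lk : (l1 <= l - k.+1)%N.
    rewrite leq_subRL //; apply: leq_trans Ll; by rewrite leq_add2r.
  have := step _ lk.
  have : ln (l - k.+1)%:R <= ln l%:R :> R.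
    have [->|p] := posnP (l - k.+1); first by rewrite ln0.
    by apply: ler_ln_imp; rewrite ?ltr0n // ler_nat leq_subr.
  have E : 2 * k.+2%:R * ln l%:R = 2 * k.+1%:R * ln l%:R + 2 * ln l%:R :> R.
    by rewrite -[k.+2]addn1 natrD; ring.
  by rewrite E; lra.
apply: le_trans (chain L (leqnn L)) _; rewrite lerD2l /C -[leRHS]mulrA.
rewrite ler_wpM2l ?mulr_ge0 //.
have lX0 : 0 <= ln (X l) by exact: ln_ge0.
have : 0 <= `|ln c| * ln (X l) by rewrite mulr_ge0.
have := normr_ge0 (ln c); nra.
Qed.

(** Between the times [n (l - L)] and [n l.+1] the heights grow so slowly that
    the growth is negligible even after division by the sequence sigma. *)
Lemma scales L C eps : 0 <= C -> 0 < eps -> exists l0, forall l, (l0 <= l)%N ->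
  exists Q, [/\ 0 <= Q, (L <= l)%N & C <= X l] /\
    [/\ X l.+1 <= X (l - L) + Q, 0 < sigma RV n tau' l,
        C * (1 + Q) <= eps * X l & C * (1 + Q) / sigma RV n tau' l <= eps * X l].
Proof.
move=> C0 eps0.
have [l1 [C1 [C10 gap]]] := ln_max_height_gap L.
have [c c0 lin] := ln_max_height_linear.
have t01 : 0 < tau' < 1.
  case/andP: htau => t1 _; case/andP: htau' => tt' ->; rewrite andbT.
  by apply: lt_trans tt'; rewrite divr_gt0 // (lt_trans _ t1).
have t0 : 0 <= tau' by case/andP: t01 => /ltW.
have ln2 : 0 < ln 2 :> R by rewrite ln_gt0 // ltr1n.
pose C2 := C * (1 + C1) * (1 + (ln 2)^-1 `^ tau').
have C20 : 0 <= C2.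
  by rewrite !mulr_ge0 ?addr_ge0 ?powR_ge0.
have [X0 [X01 small]] := log_powR_small t01 C20 eps0.
pose B := Num.max X0 C.
have B0 : 0 <= B by rewrite le_max (le_trans _ X01).
exists (maxn (maxn l1 lbar.*2) (Num.bound (B / c))) => l.
rewrite !geq_max => /andP[/andP[ll lb] lB].
have [Ll X1 gapl] := gap l ll.
have BX : B <= X l.
  apply: le_trans (lin l lb); rewrite mulrC -ler_pdivrMr //.
  apply: le_trans (ltW (archi_boundP _)) _; first by rewrite divr_ge0 // ltW.
  by rewrite ler_nat.
have Xp : 0 < X l by exact: lt_le_trans X1.
have lX0 : 0 <= ln (X l) by exact: ln_ge0.
exists (C1 * (1 + ln (X l))); split.
  split=> //; first by rewrite mulr_ge0 // addr_ge0.
  by apply: le_trans BX; rewrite le_max lexx orbT.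
have lnN : ln 2 <= ln (N l) by apply: ler_ln_imp; rewrite ?mxnorm1_ge2.
have lnN0 : 0 < ln (N l) by exact: lt_le_trans lnN.
have sg0 : 0 < sigma RV n tau' l by rewrite powR_gt0 // divr_gt0.
have Xt1 : 1 <= X l `^ tau' by rewrite -[leLHS](powRr0 (X l)); apply: ler_powR.
have XX0 : X0 <= X l by apply: le_trans BX; rewrite le_max lexx.
have {}small := small _ XX0.
have h1 : C * (1 + C1 * (1 + ln (X l))) <= C * (1 + C1) * (1 + ln (X l)).
  by rewrite -mulrA ler_wpM2l //; nra.
have sgV : (sigma RV n tau' l)^-1 <= (ln 2)^-1 `^ tau' * X l `^ tau'.
  rewrite -powRM ?invr_ge0 ?(ltW Xp) ?(ltW ln2) // /sigma.
  rewrite -powRN; have -> : (ln (N l) / X l) `^ (- tau') = (X l / ln (N l)) `^ tau'.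
    rewrite -[X l / ln (N l)]invf_div -[(_ / _)^-1]powR_inv1 ?divr_ge0 ?(ltW Xp) ?(ltW lnN0) //.
    by rewrite -powRrM mulN1r.
  apply: ge0_ler_powR; rewrite ?nnegrE ?divr_ge0 ?mulr_ge0 ?invr_ge0 ?(ltW Xp) ?(ltW ln2) ?(ltW lnN0) //.
  by rewrite mulrC ler_wpM2r ?(ltW Xp) // lef_pV2.
have p0 : 0 <= (ln 2)^-1 `^ tau' :> R by exact: powR_ge0.
have q0 : 0 <= C * (1 + C1) * (1 + ln (X l)) by rewrite !mulr_ge0 ?addr_ge0.
have E : C2 * (1 + ln (X l)) * X l `^ tau'
    = C * (1 + C1) * (1 + ln (X l)) * X l `^ tau'
      + C * (1 + C1) * (1 + ln (X l)) * ((ln 2)^-1 `^ tau' * X l `^ tau').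
  by rewrite /C2; ring.
have r0 : 0 <= C * (1 + C1) * (1 + ln (X l)) * ((ln 2)^-1 `^ tau' * X l `^ tau').
  by rewrite mulr_ge0 // mulr_ge0 // powR_ge0.
split=> //.
- apply: le_trans small; rewrite E -[leLHS]addr0 lerD //.
  by apply: le_trans h1 _; rewrite ler_peMr.
- apply: le_trans small; rewrite E -[leLHS]add0r lerD //.
    by rewrite mulr_ge0 // powR_ge0.
  apply: ler_pM => //.
    by rewrite mulr_ge0 // addr_ge0 // mulr_ge0 // addr_ge0.
  by rewrite invr_ge0 ltW.
Qed.

End Scales.

(** * Points close to a singularity *)

Section CuspSums.
Context {R : realType} {d : nat} {RV : nat -> iet R d} {n : nat -> nat}
  {kappa nu D D' : R} {lbar : nat}.
Hypothesis bl : balanced RV n kappa nu D D' lbar.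
Context {tau tau' : R}.
Hypotheses (htau : 1 < tau < 2) (htau' : tau / 2 < tau' < 1).
Hypothesis hnorm : (l%:R `^ (- tau) * mxnorm1 (rv_matrix RV (n l) (n l.+1)))
  @[l --> \oo] --> (0 : R).

Local Notation RVstep := (bl_step bl).
Local Notation F := (iet_map (RV 0%N)).
Local Notation mh l := (max_height RV (n l)).
Local Notation lam l := (total_len (RV (n l))).
Local Notation X l := (ln (mh l)%:R : R).
Local Notation sg l := (sigma RV n tau' l).
Local Notation K := ((Num.floor kappa)%:~R + 2 : R).

(** What the complement of the exceptional set gives: an initial segment of the
    orbit stays away from the discontinuities. *)
Definition avoids (l : nat) (y : R) : Prop :=
  forall k i : nat, (0 < k < d)%N -> i%:R <= sg l * (mh l.+1)%:R ->
  sg l * lam l < `|endpt (RV 0%N) k - iter i F y|.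

Let mh0 l : 0 < (mh l)%:R :> R.
Proof. by rewrite ltr0n (max_height_gt0 bl). Qed.

Let kappa0 : 0 < kappa.
Proof. by rewrite (lt_trans _ (bl_kappa bl)). Qed.

(* A variable with an equation rather than a definition, so that positivity
   side conditions do not split it into its factors. *)
Context {dn : R}.
Hypothesis dnE : dn = d%:R * nu.

Let dn0 : 0 < dn.
Proof.
by rewrite dnE mulr_gt0 ?(lt_trans _ (bl_nu bl)) // ltr0n ltnW // (balanced_d_gt1 bl).
Qed.

Lemma traverse_bound_ge0 : 0 <= K.
Proof.
by rewrite addr_ge0 // ler0z floor_ge0 ltW.
Qed.

(** All traverses but the first and the last are complete, and the height of
    each tower is at least [kappa^-1] times the maximal height. *)
Lemma traverse_count_le l q r : (r < mh l)%N ->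
  forall j, (q.-2 * height RV (n l) j <= r)%N -> q%:R <= K.
Proof.
move=> rH j qr; have hj := max_le_kappa_height bl l j.
have j0 : 0 < (height RV (n l) j)%:R :> R by rewrite ltr0n (height_gt0 RVstep).
have : q.-2%:R < kappa.
  rewrite -(ltr_pM2r j0); apply: lt_le_trans hj.
  by rewrite -natrM ltr_nat; exact: leq_ltn_trans rH.
move=> /ltW; rewrite -[q.-2%:R]/((q.-2%:Z)%:~R) -floor_ge_int => h.
apply: (@le_trans _ _ (q.-2%:R + 2)).
  by rewrite -natrD ler_nat addn2; case: (q) => [|[|]].
by rewrite lerD2r -[q.-2%:R]/((q.-2%:Z)%:~R) ler_int.
Qed.

Lemma len_lower l (i : 'I_d) : (dn * (mh l)%:R)^-1 <= iet_len (RV (n l)) i.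
Proof.
have h1 := total_len_le_nu bl l i; have h2 := max_height_len_ge1 bl l.
rewrite -[leLHS]mul1r ler_pdivrMr ?mulr_gt0 //.
apply: le_trans h2 _; by rewrite mulrCA mulrA [leLHS]mulrC ler_wpM2r //; rewrite dnE; exact: h1.
Qed.

Lemma log_ratio_le M L l j Q : 0 < M -> X j <= X (l - L) + Q -> 0 <= Q ->
  1 + ln (1 + ((M + 1) * lam (l - L)) / (dn * (mh j)%:R)^-1)
    <= (1 + ln (1 + (M + 1) * kappa * dn)) * (1 + Q).
Proof.
move=> M0 XQ Q0; set P := (M + 1) * kappa * dn.
have P0 : 0 < P by rewrite !mulr_gt0 // addr_gt0.
have lnP : 0 <= ln (1 + P) by rewrite ln_ge0 // lerDl ltW.
have lam0 : 0 < lam (l - L) by exact: rv_total_len_gt0 RVstep _.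
suff h : ln (1 + ((M + 1) * lam (l - L)) / (dn * (mh j)%:R)^-1) <= ln (1 + P) + Q.
  by nra.
have -> : ln (1 + P) + Q = ln ((1 + P) * expR Q).
  by rewrite lnM ?posrE ?expR_gt0 ?expRK // addr_gt0.
apply: ler_ln_imp; first by rewrite addr_gt0 // invrK !mulr_gt0 // addr_gt0.
have E : (1 + P) * expR Q = expR Q + P * expR Q by ring.
rewrite E lerD ?invrK //; first by apply: le_trans (expR_ge1Dx Q); rewrite lerDl.
have lk : lam (l - L) <= kappa / (mh (l - L))%:R.
  by rewrite ler_pdivlMr // mulrC (max_height_len_le_kappa bl).
have ratio : (mh j)%:R <= expR Q * (mh (l - L))%:R :> R.
  rewrite -ler_ln ?posrE ?mulr_gt0 ?expR_gt0 // lnM ?posrE ?expR_gt0 // expRK.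
  by rewrite addrC.
apply: (@le_trans _ _ ((M + 1) * (kappa / (mh (l - L))%:R)
    * (dn * (expR Q * (mh (l - L))%:R)))).
  apply: ler_pM; rewrite ?mulr_ge0 ?(ltW dn0) ?(ltW lam0) ?addr_ge0 ?(ltW M0) //.
    by rewrite ler_wpM2l // addr_ge0 ?(ltW M0).
  by rewrite ler_wpM2l ?(ltW dn0).
rewrite le_eqVlt; apply/orP; left; apply/eqP; rewrite /P.
have := mh0 (l - L); move: ((mh (l - L))%:R : R) => h h0.
by field; rewrite gt_eqF.
Qed.

(** The points of the orbit closer than [rho] to a discontinuity. Either the
    orbit segment is short enough to avoid a neighbourhood of the
    discontinuity, and the traverses of the towers of level [l] are summed up;
    or it is long compared with the heights of level [l.+1], and consists of at
    most [K] traverses of their towers, in each of which only the closest point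
    is not controlled by a harmonic sum. *)
Lemma near_sum_le L M eps : 0 < M -> 0 < eps -> exists l0, forall l, (l0 <= l)%N ->
  forall (r k : nat) (y s psi B : R) (phi : R -> R),
  (mh l <= r < mh l.+1)%N -> 0 <= y < 1 -> avoids l y -> (0 < k < d)%N ->
  s ^+ 2 = 1 -> 0 <= psi -> 0 <= B -> (forall z, 0 <= phi z) ->
  let a := endpt (RV 0%N) k in
  let near z := 0 < s * (z - a) <= (M + 1) * lam (l - L) in
  (forall z, near z -> phi z <= psi / (s * (z - a))) ->
  (forall i, (i < r)%N -> near (iter i F y) -> phi (iter i F y) <= B) ->
  birkhoff F (fun z => if near z then phi z else 0) r y
    <= psi * eps * (r%:R * ln r%:R) + K * B.
Proof.
move=> M0 eps0.
pose c1 := 1 + ln (1 + (M + 1) * kappa * dn).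
have P0 : 0 < (M + 1) * kappa * dn by rewrite !mulr_gt0 // addr_gt0.
have c10 : 0 <= c1 by rewrite addr_ge0 // ln_ge0 // lerDl ltW.
have K0 := traverse_bound_ge0.
have cd0 : 0 <= dn * c1 by rewrite mulr_ge0 // ltW.
(* The sum of the factors that the two cases below produce; the 3 comes from
   [r + 2 * mh l <= 3 * r]. *)
pose C := 3 * kappa + 3 * kappa * (dn * c1) + K * (dn * c1).
have k3 : 0 <= 3 * kappa by rewrite mulr_ge0 // ltW.
have kd0 : 0 <= 3 * kappa * (dn * c1) by rewrite mulr_ge0.
have Kd0 : 0 <= K * (dn * c1) by rewrite mulr_ge0.
have C0 : 0 <= C by rewrite !addr_ge0.
have eps20 : 0 < eps / 2 by rewrite divr_gt0.
have [l0 sc] := scales bl htau htau' hnorm L C0 eps20.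
exists l0 => l /sc[Q [[Q0 Ll CX] [XQ sg0 CQ CQs]]].
move=> r k y s psi B phi /andP[Hr rH'] y01 av kd s1 psi0 B0 phi0 a near phile phiB.
have H'r := ltnW rH'.
have r0 : 0 < r%:R :> R by rewrite ltr0n (leq_trans (max_height_gt0 bl l)).
have Xr : X l <= ln r%:R by apply: ler_ln_imp; rewrite ?mh0 // ler_nat.
have HrR : (mh l)%:R <= r%:R :> R by rewrite ler_nat.
have lam0 j : 0 < lam j by exact: rv_total_len_gt0 RVstep _.
set rho := (M + 1) * lam (l - L) in near phile phiB *.
have rho0 : 0 <= rho by rewrite mulr_ge0 ?(ltW (lam0 _)) // addr_ge0 // ltW.
have y01' : 0 <= y < total_len (RV 0%N) by rewrite (bl_one bl).
pose g b z := if near z && (phi z <= b) then phi z else 0.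
have g0 b z : 0 <= g b z by rewrite /g; case: ifP.
have gE b : (forall i, (i < r)%N -> near (iter i F y) -> phi (iter i F y) <= b) ->
    birkhoff F (fun z => if near z then phi z else 0) r y = birkhoff F (g b) r y.
  move=> hb; apply: eq_bigr => i _; rewrite /g.
  by case: (boolP (near _)) => //= h; rewrite hb.
have Sp m b : 0 <= b -> X m <= X (l - L) + Q -> forall j x,
    in_piece (RV (n m)) j x ->
    birkhoff F (g b) (height RV (n m) j) x <= b + psi * (dn * (mh m)%:R) * (c1 * (1 + Q)).
  move=> b0 Xm j x jx; have [it tw] := rv_height_tower RVstep (n m).
  have w0 : 0 < (dn * (mh m)%:R)^-1 by rewrite invr_gt0 mulr_gt0.
  have := near_tower_sum_le tw (a := a) (g := g b) s1 w0 (len_lower m j) rho0 psi0 b0 _ _ jx.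
  move=> h; apply: le_trans (h _ _) _.
  - by move=> z _ /negbTE nz; rewrite /g /near nz.
  - move=> z _ nz; have nz' : near z by []; rewrite /g nz' /=; case: ifP => hb; split=> //.
      exact: phile.
    by rewrite divr_ge0 //; case/andP: nz => /ltW.
  rewrite invrK lerD2l ler_wpM2l //; first by rewrite !mulr_ge0 // ltW.
  by have := log_ratio_le M0 Xm Q0; rewrite invrK.
have XQl : X l <= X (l - L) + Q.
  by apply: le_trans XQ; exact: (ln_max_height_mono bl (leqnSn l)).
have Q1 : 1 <= 1 + Q by rewrite lerDl.
have Q10 : 0 <= 1 + Q by rewrite addr_ge0.
have sgV : 0 <= (sg l)^-1 by rewrite invr_ge0 ltW.
have [short|long] := leP r%:R (sg l * (mh l.+1)%:R).
  (* Traverses leave the orbit segment at both ends, where nothing keeps them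
     away from [a]; the summand is cut at [b], which the segment itself does
     not exceed. *)
  pose b := psi / (sg l * lam l).
  have sl0 : 0 < sg l * lam l by rewrite mulr_gt0.
  have b0 : 0 <= b by rewrite divr_ge0 // ltW.
  rewrite (gE b); last first.
    move=> i ir ni; apply: le_trans (phile _ ni) _; rewrite ler_wpM2l //.
    have /andP[D0 _] := ni; rewrite lef_pV2 ?posrE //.
    have := av k i kd; move/(_ _)/ltW => h.
    apply: le_trans (h _) _.
      by apply: le_trans short; rewrite ler_nat ltnW.
    rewrite distrC -[leRHS]ger0_norm ?(ltW D0) // normrM.
    by case: (sign_cases s1) => ->; rewrite ?normrN normr1 mul1r.
  have [it tw] := rv_height_tower RVstep (n l).
  set W := b + psi * (dn * (mh l)%:R) * (c1 * (1 + Q)).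
  have W0 : 0 <= W by rewrite addr_ge0 // !mulr_ge0 // ltW.
  have c0 : 0 <= W * kappa / (mh l)%:R by rewrite !mulr_ge0 ?invr_ge0 // ltW.
  have := birkhoff_le_height tw (g0 b) r c0 (height_le_max l) _ y01'.
  move=> h; apply: le_trans (h _) _.
    move=> j x jx; apply: le_trans (Sp l b b0 XQl j x jx) _; rewrite -/W.
    rewrite [leRHS](_ : _ = W * (kappa * (height RV (n l) j)%:R / (mh l)%:R)); last by ring.
    by rewrite ler_peMr // ler_pdivlMr // mul1r (max_le_kappa_height bl).
  have bl1 : b <= psi * ((mh l)%:R / sg l).
    rewrite /b ler_wpM2l // invfM mulrC ler_wpM2r // -[leLHS]mul1r.
    by rewrite ler_pdivrMr // (max_height_len_ge1 bl).
  have WH : W <= psi * (mh l)%:R * ((sg l)^-1 + dn * c1 * (1 + Q)).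
    rewrite /W; apply: le_trans (lerD bl1 (lexx _)) _.
    by rewrite le_eqVlt; apply/orP; left; apply/eqP; ring.
  apply: (@le_trans _ _ (W * kappa / (mh l)%:R * (3 * r%:R))).
    rewrite ler_wpM2l // natrD -muln2 natrM; lra.
  apply: (@le_trans _ _ (psi * ((sg l)^-1 + dn * c1 * (1 + Q)) * kappa * (3 * r%:R))).
    rewrite ler_wpM2r ?mulr_ge0 // ler_pdivrMr // mulrAC ler_wpM2r ?(ltW kappa0) //.
    by apply: le_trans WH _; rewrite mulrAC.
  have h1 : 3 * kappa * (sg l)^-1 <= eps / 2 * X l.
    apply: le_trans CQs; rewrite ler_wpM2r //.
    rewrite /C; nra.
  have h2 : 3 * kappa * (dn * c1) * (1 + Q) <= eps / 2 * X l.
    by apply: le_trans CQ; rewrite ler_wpM2r // /C; lra.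
  rewrite -[leLHS]addr0 lerD ?mulr_ge0 //.
  rewrite [leLHS](_ : _ = psi * r%:R * (3 * kappa * (sg l)^-1
    + 3 * kappa * (dn * c1) * (1 + Q))); last by ring.
  rewrite [leRHS](_ : _ = psi * r%:R * (eps * ln r%:R)); last by ring.
  rewrite ler_wpM2l ?mulr_ge0 ?(ltW r0) //.
  apply: (@le_trans _ _ (eps * X l)); first by lra.
  by rewrite ler_wpM2l // ltW.
rewrite (gE B) //.
have [it tw] := rv_height_tower RVstep (n l.+1).
set W := B + psi * (dn * (mh l.+1)%:R) * (c1 * (1 + Q)).
have W0 : 0 <= W by rewrite addr_ge0 // !mulr_ge0 // ltW.
have [j0 jmin] : exists j0, forall j, (height RV (n l.+1) j0 <= height RV (n l.+1) j)%N.
  have d0 := rv_step_d_gt0 (RVstep 0%N).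
  have [j0 _ jm] := @arg_minnP _ (Ordinal d0) xpredT (height RV (n l.+1)) isT.
  by exists j0 => j; exact: jm.
have [q Sq qr] := birkhoff_le_traverses tw (g0 B) r W0 jmin (Sp l.+1 B B0 XQ) y01'.
apply: le_trans Sq _.
have qK := traverse_count_le rH' qr.
apply: (le_trans (ler_wpM2l W0 qK)); rewrite /W.
have H's : (mh l.+1)%:R <= r%:R / sg l by rewrite ler_pdivlMr // mulrC ltW.
have h2 : K * (dn * c1) * (1 + Q) / sg l <= eps * ln r%:R.
  apply: (@le_trans _ _ (eps / 2 * X l)).
    by apply: le_trans CQs; rewrite ler_wpM2r // ler_wpM2r // /C; lra.
  apply: (@le_trans _ _ (eps * X l)).
    have : 0 <= X l by rewrite ln_ge0 // ler1n (max_height_gt0 bl).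
    have e0 := eps0; nra.
  by rewrite ler_wpM2l // ltW.
rewrite [leLHS](_ : _ = psi * (K * (dn * c1) * (1 + Q)) * (mh l.+1)%:R + K * B); last by ring.
rewrite lerD2r.
apply: (@le_trans _ _ (psi * (K * (dn * c1) * (1 + Q)) * (r%:R / sg l))).
  by rewrite ler_wpM2l // mulr_ge0 // mulr_ge0.
rewrite [leLHS](_ : _ = psi * r%:R * (K * (dn * c1) * (1 + Q) / sg l)); last by ring.
rewrite [leRHS](_ : _ = psi * r%:R * (eps * ln r%:R)); last by ring.
by rewrite ler_wpM2l // mulr_ge0 // ltW.
Qed.

End CuspSums.

(** * Birkhoff sums of a one-sided singularity *)

Section CuspEstimate.
Context {R : realType} {d : nat} {RV : nat -> iet R d} {n : nat -> nat}
  {kappa nu D D' : R} {lbar : nat}.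
Hypothesis bl : balanced RV n kappa nu D D' lbar.
Context {tau tau' : R}.
Hypotheses (htau : 1 < tau < 2) (htau' : tau / 2 < tau' < 1).
Hypothesis hnorm : (l%:R `^ (- tau) * mxnorm1 (rv_matrix RV (n l) (n l.+1)))
  @[l --> \oo] --> (0 : R).

Local Notation RVstep := (bl_step bl).
Local Notation F := (iet_map (RV 0%N)).
Local Notation mh l := (max_height RV (n l)).
Local Notation lam l := (total_len (RV (n l))).
Local Notation X l := (ln (mh l)%:R : R).
Local Notation sg l := (sigma RV n tau' l).
Local Notation K := ((Num.floor kappa)%:~R + 2 : R).
Local Notation avoids := (avoids (RV := RV) (n := n) (tau' := tau')).

Let mh0 l : 0 < (mh l)%:R :> R.
Proof. by rewrite ltr0n (max_height_gt0 bl). Qed.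

Let kappa0 : 0 < kappa.
Proof. by rewrite (lt_trans _ (bl_kappa bl)). Qed.

Lemma endpt_01 k : (0 < k < d)%N -> 0 < endpt (RV 0%N) k < 1.
Proof.
move=> /andP[k0 kd]; rewrite -(bl_one bl) -endpt_full.
have lts i : (i < d)%N -> endpt (RV 0%N) i < endpt (RV 0%N) i.+1.
  by move=> id; rewrite (endptS _ (Ordinal id)) ltrDl iet_len_gt0.
apply/andP; split.
  rewrite -[ltLHS](endpt0 (RV 0%N)); apply: lt_le_trans (lts 0%N (ltn_trans k0 kd)) _.
  exact: endpt_le.
by apply: lt_le_trans (lts k kd) _; exact: endpt_le.
Qed.

Lemma total_len_small M L eps : 0 < eps -> exists l0, forall l, (l0 <= l)%N ->
  M * lam (l - L) <= eps.
Proof.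
move=> eps0.
have M0 : 0 <= `|M| by [].
have C0 : 0 <= 2 + 2 * `|ln (kappa * (`|M| + 1) / eps)| by rewrite addr_ge0 // mulr_ge0.
have [l0 sc] := scales bl htau htau' hnorm L C0 (divr_gt0 (@ltr01 R) (@ltr0Sn R 1)).
exists l0 => l /sc[Q [[Q0 Ll CX] [XQ _ CQ _]]].
have XX : X l <= X l.+1 by exact: (ln_max_height_mono bl (leqnSn l)).
have m0 : 0 < kappa * (`|M| + 1) / eps.
  by rewrite divr_gt0 // mulr_gt0 // ltr_wpDl.
have h1 : ln (kappa * (`|M| + 1) / eps) <= X (l - L).
  have := ler_norm (ln (kappa * (`|M| + 1) / eps)).
  have : 0 <= `|ln (kappa * (`|M| + 1) / eps)| by [].
  move: (`|_|) CQ CX C0 => t CQ CX C0 t0 ht.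
  have : Q <= X l / 2 by nra.
  lra.
have h2 : kappa * (`|M| + 1) / eps <= (mh (l - L))%:R.
  by rewrite -ler_ln ?posrE.
rewrite ler_pdivrMr // in h2.
have lam0 : 0 < lam (l - L) by exact: rv_total_len_gt0 RVstep _.
have h3 : lam (l - L) * (mh (l - L))%:R <= kappa.
  by rewrite mulrC (max_height_len_le_kappa bl).
apply: (@le_trans _ _ ((`|M| + 1) * lam (l - L))).
  by rewrite ler_wpM2r ?(ltW lam0) // (le_trans (ler_norm M)) // lerDl.
rewrite -(ler_pM2l kappa0) mulrA.
apply: (le_trans (ler_wpM2r (ltW lam0) h2)).
by rewrite mulrAC ler_wpM2r ?(ltW eps0) // mulrC.
Qed.

(** The points at distance more than [(M + 1) * lam (l - L)] contribute the main
    term: summed over equidistributed floors, [1 / t] gives [- ln (lam (l - L))],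
    and the logarithms of [r], of the heights between the levels [l - L] and
    [l.+1], and of the inverse lengths are asymptotically equal. The points
    closer than that are negligible, except for at most [K] closest ones. *)
Lemma cusp_sum k s eps : (0 < k < d)%N -> s ^+ 2 = 1 -> 0 < eps <= 1 ->
  exists l0, forall l, (l0 <= l)%N -> forall (r : nat) (y B : R),
  (mh l <= r < mh l.+1)%N -> 0 <= y < 1 -> avoids l y -> 0 <= B ->
  let a := endpt (RV 0%N) k in
  (forall i, (i < r)%N -> cusp s a (iter i F y) <= B) ->
  (1 - eps) * (r%:R * ln r%:R) <= birkhoff F (cusp s a) r y
    <= (1 + eps) * (r%:R * ln r%:R) + K * B.
Proof.
move=> kd s1 /andP[eps0 eps1].
pose a := endpt (RV 0%N) k; have a01 : 0 < a < 1 by exact: endpt_01.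
(* The frequencies, the approximation by a constant on each floor and the
   comparison of the logarithms each lose a factor [1 - 2 * e] at most. *)
pose e := eps / 8; have e0 : 0 < e by rewrite divr_gt0.
have e1 : e <= 1 / 8 by rewrite /e; lra.
have epsE : eps = 8 * e by rewrite /e; field.
pose M := e^-1; have M0 : 0 < M by rewrite invr_gt0.
have M1 : 1 <= M by rewrite invf_ge1 //; lra.
have ME : M^-1 = e by rewrite invrK.
have [L equi] := floor_equidist bl e0.
have [l1 nearS] := near_sum_le bl htau htau' hnorm erefl L M0 (divr_gt0 eps0 (@ltr0Sn R 1)).
pose Ca := ln (Num.min a (1 - a)) - ln ((M + 1) * kappa).
have C0 : 0 <= 1 + `|Ca| by rewrite addr_ge0.
have e20 : 0 < 2 * e by rewrite mulr_gt0.
have [l2 sc] := scales bl htau htau' hnorm L C0 e20.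
have [l3 small] := total_len_small M L (@ltr01 R).
exists (maxn (maxn L l1) (maxn l2 l3)) => l.
rewrite !geq_max => /andP[/andP[Ll ll1] /andP[/sc[Q [[Q0 _ _] [XQ _ CQ _]]] /small Ml1]].
move=> r y B Hr y01 av B0; rewrite /= -/a => cB.
have /andP[H1 H2] := Hr.
have r0 : 0 < r%:R :> R by rewrite ltr0n (leq_trans (max_height_gt0 bl l)).
have Xr : X l <= ln r%:R by apply: ler_ln_imp; rewrite ?mh0 // ler_nat.
have rX : ln r%:R <= X l.+1 by apply: ler_ln_imp; rewrite // ler_nat ltnW.
have X0 : 0 <= X l by rewrite ln_ge0 // ler1n (max_height_gt0 bl).
have lr0 : 0 <= ln r%:R :> R by exact: le_trans Xr.
have vis f := equi l Ll r y f H1 y01.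
have [it tw] := rv_height_tower RVstep (n (l - L)).
have lam0 : 0 < lam (l - L) by exact: rv_total_len_gt0 RVstep _.
apply/andP; split.
  have e1' : 0 <= 1 - e by lra.
  have := birkhoff_cusp_ge tw (bl_one bl) (s := s) (a := a) (M := M) (eta := e)
    (r := r) (y := y) s1 a01 M0 y01 e1'.
  move=> /(_ (fun f => proj1 (andP (vis f)))); apply: le_trans.
  have m0 : 0 < Num.min a (1 - a) by rewrite lt_min; lra.
  have h1 : ln ((M + 1) * lam (l - L)) <= ln ((M + 1) * kappa) - X (l - L).
    rewrite -ln_div ?posrE ?mulr_gt0 ?addr_gt0 //.
    apply: ler_ln_imp; first by rewrite mulr_gt0 // addr_gt0.
    rewrite -mulrA ler_wpM2l ?addr_ge0 ?(ltW M0) // ler_pdivlMr // mulrC.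
    exact: (max_height_len_le_kappa bl).
  have h2 : (1 - 2 * e) * ln r%:R
      <= ln (Num.min a (1 - a)) - ln ((M + 1) * lam (l - L)).
    have Ca1 : - `|Ca| <= Ca by rewrite lerNl -normrN ler_norm.
    have n0 : 0 <= `|Ca| by [].
    have CQ' : Q + `|Ca| <= 2 * e * X l by apply: le_trans CQ; nra.
    have : 2 * e * X l <= 2 * e * ln r%:R by rewrite ler_wpM2l // ltW.
    move: Ca1; rewrite /Ca; lra.
  rewrite ME.
  have iv : 1 - e <= (1 + e)^-1.
    by rewrite -[leRHS]mul1r ler_pdivlMr ?addr_gt0 //; nra.
  apply: (@le_trans _ _ ((1 - e) * r%:R * ((1 - e) * ((1 - 2 * e) * ln r%:R)))).
    rewrite [leRHS](_ : _ = ((1 - e) * (1 - e) * (1 - 2 * e)) * (r%:R * ln r%:R)); last by ring.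
    rewrite ler_wpM2r ?mulr_ge0 ?(ltW r0) // epsE.
    have h3 : (1 - e) * (1 - e) * (1 - 2 * e) = 1 - 4 * e + 5 * (e * e) - 2 * (e * e * e) by ring.
    rewrite h3; have ee : 0 <= e * e by rewrite mulr_ge0 // ltW.
    have eee : e * e * e <= e * e by rewrite ler_piMr //; lra.
    lra.
  rewrite ler_wpM2l ?mulr_ge0 ?(ltW r0) //.
  apply: ler_pM => //; rewrite mulr_ge0 //; lra.
pose near z := 0 < s * (z - a) <= (M + 1) * lam (l - L).
pose far z := (M + 1) * lam (l - L) < s * (z - a).
have split_cusp : birkhoff F (cusp s a) r y
  = birkhoff F (fun z => if far z then cusp s a z else 0) r y
    + birkhoff F (fun z => if near z then cusp s a z else 0) r y.
  rewrite /birkhoff -big_split; apply: eq_bigr => i _ /=.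
  move: (iter i F y) => z; rewrite /far /near.
  case: (ltP ((M + 1) * lam (l - L)) (s * (z - a))) => h; rewrite ?andbF ?addr0 // andbT.
  by rewrite add0r /cusp; case: ifP.
rewrite split_cusp.
have e1' : 0 <= 1 + e by rewrite addr_ge0 // ltW.
have farS := birkhoff_cusp_far_le tw (bl_one bl) (s := s) (a := a) (M := M) (eta := e)
  (r := r) (y := y) s1 a01 M0 y01 e1' Ml1 (fun f => proj2 (andP (vis f))).
have nearle := nearS l ll1 r k y s 1 B (cusp s a) Hr y01 av kd s1 ler01 B0 (cusp_ge0 s a).
have {}nearle : birkhoff F (fun z => if near z then cusp s a z else 0) r y
    <= 1 * (eps / 2) * (r%:R * ln r%:R) + K * B.
  apply: nearle => [z /andP[z0 _]|i ir _]; last exact: cB.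
  by rewrite /cusp z0 mul1r.
have h1 : - ln (M * lam (l - L)) <= ln r%:R.
  apply: le_trans Xr; apply: (@le_trans _ _ (X (l - L))); last first.
    by apply: (ln_max_height_mono bl); exact: leq_subr.
  rewrite -lnV ?posrE ?mulr_gt0 //; apply: ler_ln_imp.
    by rewrite invr_gt0 mulr_gt0.
  rewrite invf_ple ?posrE ?mulr_gt0 //.
  apply: (@le_trans _ _ (lam (l - L))); last by rewrite ler_peMl ?(ltW lam0).
  by rewrite -[leLHS]mul1r ler_pdivrMr // mulrC (max_height_len_ge1 bl).
apply: le_trans (lerD farS nearle) _; rewrite addrA lerD2r ME.
have rl0 : 0 <= r%:R * ln r%:R :> R by rewrite mulr_ge0 // ltW.
apply: (@le_trans _ _ ((1 + e) * r%:R * ((1 + e) * ln r%:R) + 1 * (eps / 2) * (r%:R * ln r%:R))).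
  rewrite lerD2r ler_wpM2l ?mulr_ge0 ?(ltW r0) // ler_wpM2l //.
rewrite [leLHS](_ : _ = ((1 + e) * (1 + e) + eps / 2) * (r%:R * ln r%:R)); last by ring.
rewrite ler_wpM2r // epsE; nra.
Qed.

End CuspEstimate.

(** * Derivatives along a set near a logarithmic singularity *)

Section DerivOn.
Context {R : realType}.
Implicit Types (A : set R) (f g : R -> R).

Lemma nearR (x : R) (P : set R) :
  (\forall y \near x, P y) <-> exists2 e, 0 < e & forall y, `|x - y| < e -> P y.
Proof.
split=> [/nbhs_ballP[e /= e0 eP]|[e e0 eP]]; last first.
  by apply/nbhs_ballP; exists e => //= y; rewrite -ball_normE /=; exact: eP.
by exists e => // y xy; apply: eP; rewrite -ball_normE.
Qed.

Lemma within_id (T : Type) (F : set_system T) {FF : Filter F} (A : set T) :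
  F A -> within A F = F.
Proof.
move=> FA; apply/funext => P; apply/propext; split=> h.
  by apply: filterS2 FA h => t At /(_ At).
by apply: filterS h.
Qed.

Lemma within_dnbhs_id A (x : R) : nbhs x A -> within A x^' = x^'.
Proof.
move=> xA; apply: within_id; rewrite /dnbhs /within /=.
by apply: filterS xA.
Qed.

(** At interior points the derivative along a set is the ordinary derivative,
    to which the differentiation rules apply. *)
Lemma diff_quotient_is_derive f x l :
  diff_quotient f x y @[y --> x^'] --> l <-> is_derive x 1 f l.
Proof.
have key : diff_quotient f x y @[y --> x^'] --> l <->
    h^-1 *: ((f \o shift x) (h *: (1 : R)) - f x) @[h --> (0 : R)^'] --> l.
  split=> /cvgrPdist_lt h; apply/cvgrPdist_lt => e /h;
    rewrite !near_withinE => /nearR[dl dl0 hd]; apply/nearR; exists dl => //.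
    move=> y; rewrite sub0r normrN => yd y0 /=.
    have := hd (y + x); rewrite opprD addrCA subrr addr0 normrN => /(_ yd).
    rewrite -subr_eq0 addrK => /(_ y0); rewrite /diff_quotient addrK.
    by rewrite /= /shift /= /GRing.scale /= mulr1 mulrC.
  move=> y xy yx; have := hd (y - x); rewrite sub0r normrN distrC => /(_ xy).
  rewrite subr_eq0 => /(_ yx); rewrite /= /shift /= /GRing.scale /= mulr1 subrK.
  by rewrite /diff_quotient mulrC.
split=> [/key h|[]]; last first.
  rewrite /derivable /derive => h /= lE; apply/key.
  by rewrite -lE.
split; first by apply/cvg_ex; exists l.
exact: cvg_lim h.
Qed.

Lemma deriv_on_eq A f x l : nbhs x A -> is_derive x 1 f l -> deriv_on A f x = l.
Proof.
move=> xA /diff_quotient_is_derive h; rewrite /deriv_on (within_dnbhs_id xA).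
exact: cvg_lim h.
Qed.

Lemma is_derive_deriv_on A f x : nbhs x A ->
  cvg (diff_quotient f x y @[y --> within A x^']) -> is_derive x 1 f (deriv_on A f x).
Proof.
move=> xA; rewrite /deriv_on (within_dnbhs_id xA) => h.
exact/diff_quotient_is_derive.
Qed.

Lemma diff_quotient_bounded A g x :
  cvg (diff_quotient g x y @[y --> within A x^']) ->
  exists M e, 0 < e /\ forall y, `|x - y| < e -> A y -> `|g y - g x| <= M * `|y - x|.
Proof.
move=> /cvg_ex[l /cvgrPdist_lt/(_ 1 ltr01)]; rewrite !near_withinE.
move=> /nearR[e e0 he]; exists (`|l| + 1), e; split=> // y xy Ay.
case: (eqVneq y x) => [->|yx]; first by rewrite !subrr normr0 mulr0.
have := he _ xy yx Ay; rewrite /diff_quotient => h.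
have yx0 : 0 < `|y - x| by rewrite normr_gt0 subr_eq0.
rewrite -ler_pdivrMr // -normfV -normrM.
have := ler_normD (- (l - (g y - g x) / (y - x))) l.
rewrite normrN opprB subrK => /le_trans; apply; rewrite addrC lerD2l; exact: ltW.
Qed.

Lemma diff_quotient_locally_bounded A g x :
  cvg (diff_quotient g x y @[y --> within A x^']) ->
  exists M e, 0 < e /\ forall y, `|x - y| < e -> A y -> `|g y| <= M.
Proof.
move=> /diff_quotient_bounded[M [e [e0 h]]]; exists (`|M| * e + `|g x|), e; split=> //.
move=> y xy Ay; have := ler_normD (g y - g x) (g x); rewrite subrK => /le_trans; apply.
rewrite lerD2r; apply: le_trans (h y xy Ay) _; apply: le_trans (ler_norm _) _.
by rewrite normrM normr_id ler_wpM2l // distrC ltW.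
Qed.

(** The local bounds are required at all points of the segment, also outside
    [P]: this excludes a blow-up at the missing points. *)
Lemma segment_bounded (P : R -> Prop) g :
  (forall x0, 0 <= x0 <= 1 -> exists M e, 0 < e /\
     forall x, `|x0 - x| < e -> P x -> `|g x| <= M) ->
  exists M, 0 <= M /\ forall x, 0 <= x <= 1 -> P x -> `|g x| <= M.
Proof.
move=> loc.
have /compact_near_coveringP := @segment_compact R 0 1.
move=> /(_ R (pinfty_nbhs R) (fun M x => P x -> `|g x| <= M) _)h.
have : \forall M \near +oo, `[0, 1] `<=` (fun x => P x -> `|g x| <= M).
  apply: h => x /=; rewrite in_itv /= => /loc[M [e [e0 hM]]].
  exists (ball x e, [set M' | M < M']) => /=.
    split; first by apply/nbhs_ballP; exists e.
    by exists M; split => //; exact: num_real.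
  move=> [y M'] /= [xy MM'] Py; by apply: le_trans (ltW MM'); apply: hM.
move=> nearM; have [M [M0 HM]] : exists M, 0 < M /\ `[0, 1] `<=` (fun x => P x -> `|g x| <= M).
  have : \forall M \near +oo, 0 < M /\ `[0, 1] `<=` (fun x => P x -> `|g x| <= M).
    apply: filterS2 nearM (_ : \forall M \near +oo, 0 < M) => //.
    by exists 0; split => //; exact: num_real.
  by move=> /filter_ex[M hM]; exists M.
by exists M; split; [exact: ltW|move=> x x01; apply: HM; rewrite /= in_itv].
Qed.

Lemma is_derive_log_dist (s a c x l : R) (e : R -> R) :
  0 < s * (x - a) -> s ^+ 2 = 1 -> is_derive x 1 e l ->
  is_derive x 1 (fun y => c * - ln (s * (y - a)) + e y) (- c / (x - a) + l).
Proof.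
move=> xa s1 ex.
have h1 : is_derive x 1 (fun y => s * (y - a)) s.
  apply: (@is_derive_eq _ _ _ (s \*: (id - cst a)) x 1 s (s *: (1 - 0))).
  by rewrite subr0 /GRing.scale /= mulr1.
have h2 := @is_derive1_comp R (@ln R) (fun y => s * (y - a)) x _ _ (is_derive1_ln xa) h1.
have h3 := is_deriveD (is_deriveZ c (is_deriveN h2)) ex.
apply: (is_derive_eq h3); congr (_ + _).
rewrite /GRing.scale /= mulrN mulNr; congr (- (_ * _)).
have s0 : s != 0 by apply: contra_eq_neq s1 => ->; rewrite expr0n eq_sym oner_eq0.
have xa0 : x - a != 0 by apply: contraTneq xa => ->; rewrite mulr0 ltxx.
by field; rewrite xa0 s0.
Qed.

Lemma is_derive_inv_dist (a c x l : R) (e : R -> R) : x != a -> is_derive x 1 e l ->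
  is_derive x 1 (fun y => - c / (y - a) + e y) (c / (x - a) ^+ 2 + l).
Proof.
move=> xa ex; have xa0 : x - a != 0 by rewrite subr_eq0.
have h1 : is_derive x 1 (fun y => y - a) 1.
  apply: (@is_derive_eq _ _ _ (id - cst a) x 1 1 (1 - 0)).
  by rewrite subr0.
have h2 := is_deriveD (is_deriveZ (- c) (@is_deriveV R (fun y => y - a) x 1 1 xa0 h1)) ex.
apply: (is_derive_eq h2); congr (_ + _).
by rewrite /GRing.scale /= mulr1 mulrNN.
Qed.

(** On one side of a logarithmic singularity, both derivatives equal those of
    the logarithm up to a bounded error. *)
Lemma log_side_derivatives (D : set R) (f : R -> R) (s a c del : R) (e : R -> R) :
  0 < a < 1 -> s ^+ 2 = 1 -> 0 < del -> smooth_on `[0, 1] e ->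
  (forall x, 0 < s * (x - a) < del ->
     [/\ 0 < x < 1, D x & f x = c * - ln (s * (x - a)) + e x]) ->
  exists M del', [/\ 0 <= M, 0 < del' & forall x, 0 < s * (x - a) < del' ->
    [/\ `|e x| <= M, `|deriv_on D f x + c / (x - a)| <= M
      & `|deriv_on D (deriv_on D f) x - c / (x - a) ^+ 2| <= M]].
Proof.
move=> /andP[a0 a1] s1 del0 se fE.
have a01 : [set` `[0, 1]] a by rewrite /= in_itv /= !ltW.
pose e1 := deriv_on `[0, 1] e; pose e2 := deriv_on `[0, 1] e1.
have [M0 [d0 [d00 h0]]] := diff_quotient_locally_bounded (se 0%N a a01).
have [M1 [d1 [d10 h1]]] := diff_quotient_locally_bounded (se 1%N a a01).
have [M2 [d2 [d20 h2]]] := diff_quotient_locally_bounded (se 2%N a a01).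
have reg x : 0 < s * (x - a) < del -> nbhs x [set y | 0 < s * (y - a) < del].
  move=> /andP[xl xr]; apply/nearR.
  exists (Num.min (s * (x - a)) (del - s * (x - a))).
    by rewrite lt_min xl subr_gt0 xr.
  move=> y; rewrite lt_min /=.
  have -> : `|x - y| = `|s * (x - a) - s * (y - a)|.
    rewrite -mulrBr normrM; have -> : `|s| = 1.
      by case: (sign_cases s1) => ->; rewrite ?normrN normr1.
    by rewrite mul1r opprB addrA subrK.
  by rewrite !ltr_norml => /andP[/andP[? ?] /andP[? ?]]; apply/andP; split; lra.
have n01 x : 0 < s * (x - a) < del -> nbhs x [set` `[(0:R), 1]].
  move=> /reg; apply: filterS => y /fE[/andP[y0 y1] _ _].
  by rewrite /= in_itv /= !ltW.
have nD x : 0 < s * (x - a) < del -> nbhs x D.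
  by move=> /reg; apply: filterS => y /fE[].
have i01 x : 0 < s * (x - a) < del -> [set` `[(0:R), 1]] x.
  by move=> /fE[/andP[y0 y1] _ _]; rewrite /= in_itv /= !ltW.
have xna x : 0 < s * (x - a) < del -> x != a.
  by move=> /andP[+ _]; apply: contraTneq => ->; rewrite subrr mulr0 ltxx.
have f1E x : 0 < s * (x - a) < del -> deriv_on D f x = - c / (x - a) + e1 x.
  move=> xr; have /andP[x0 _] := xr; apply: deriv_on_eq; first exact: nD.
  have h := is_derive_log_dist c x0 s1
    (is_derive_deriv_on (n01 _ xr) (se 0%N x (i01 _ xr))).
  apply: near_eq_is_derive h.
  by apply: filterS (reg _ xr) => y /fE[].
have f2E x : 0 < s * (x - a) < del ->
    deriv_on D (deriv_on D f) x = c / (x - a) ^+ 2 + e2 x.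
  move=> xr; apply: deriv_on_eq; first exact: nD.
  have h := is_derive_inv_dist c (xna _ xr)
    (is_derive_deriv_on (n01 _ xr) (se 1%N x (i01 _ xr))).
  apply: near_eq_is_derive h.
  by apply: filterS (reg _ xr) => y /f1E.
pose M := `|M0| + `|M1| + `|M2|.
have M0' : 0 <= `|M0| by []. have M1' : 0 <= `|M1| by []. have M2' : 0 <= `|M2| by [].
exists M, (Num.min del (Num.min d0 (Num.min d1 d2))).
split; first by rewrite /M; lra.
  by rewrite !lt_min del0 d00 d10 d20.
move=> x; rewrite !lt_min => /andP[xl /andP[xdel /andP[xd0 /andP[xd1 xd2]]]].
have xr : 0 < s * (x - a) < del by rewrite xl.
have dist : `|a - x| = s * (x - a).
  rewrite distrC -[RHS]ger0_norm ?(ltW xl) // normrM; have -> : `|s| = 1.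
    by case: (sign_cases s1) => ->; rewrite ?normrN normr1.
  by rewrite mul1r.
have x01 := i01 _ xr; rewrite -dist in xd0 xd1 xd2.
have b0 := h0 _ xd0 x01; have b1 := h1 _ xd1 x01; have b2 := h2 _ xd2 x01.
rewrite f1E // f2E // mulNr addrAC addNr add0r addrAC subrr add0r.
have := ler_norm M0; have := ler_norm M1; have := ler_norm M2.
rewrite /M; split.
- by apply: le_trans b0 _; lra.
- by apply: le_trans b1 _; lra.
- by apply: le_trans b2 _; lra.
Qed.

End DerivOn.

(** * Derivatives of the roof function *)

Section EndptGap.
Context {R : realType} {d : nat} (T : iet R d).

Lemma endpt_gap : exists2 g, 0 < g & forall j k, (j < k)%N -> (k <= d)%N ->
  g <= endpt T k - endpt T j.
Proof.
exists (\big[Num.min/1]_(i < d) iet_len T i).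
  by apply: lt_bigmin => // i _; exact: iet_len_gt0.
move=> j k jk kd; have jd : (j < d)%N by exact: leq_trans jk kd.
apply: (@le_trans _ _ (iet_len T (Ordinal jd))); first exact: bigmin_le_cond.
have := endptS T (Ordinal jd); rewrite /= => E.
have := endpt_le T jk; rewrite E; lra.
Qed.

End EndptGap.

Section Roof.
Context {R : realType} {d : nat} {T : iet R d} {f : R -> R} {Cp Cm : nat -> R}.
Hypothesis T1 : total_len T = 1.
Hypothesis hf : asym_log_sing T f Cp Cm.

Local Notation D := (roof_dom T).
Local Notation f1 := (deriv_on D f).
Local Notation f2 := (deriv_on D f1).
Local Notation a := (endpt T).

Let endptd : a d = 1. Proof. by rewrite endpt_full. Qed.

Lemma roof_endpt_01 k : (0 < k < d)%N -> 0 < a k < 1.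
Proof.
move=> /andP[k0 kd]; have [g g0 hg] := endpt_gap T.
have h1 := hg _ _ k0 (ltnW kd); have h2 := hg _ _ kd (leqnn d).
by rewrite endpt0 in h1; rewrite endptd in h2; apply/andP; split; lra.
Qed.

Definition side_const (s : R) (j : nat) : R := if 0 < s then Cp j else Cm j.

Lemma roof_side j s : (0 < j < d)%N -> s ^+ 2 = 1 ->
  exists e del, [/\ 0 < del, smooth_on `[0, 1] e & forall x,
    0 < s * (x - a j) < del ->
    [/\ 0 < x < 1, D x & f x = side_const s j * - ln (s * (x - a j)) + e x]].
Proof.
move=> jd s1; have [g g0 hg] := endpt_gap T; have /andP[j0 jd'] := jd.
have gL := hg _ _ j0 (ltnW jd'); have gR := hg _ _ jd' (leqnn d).
rewrite endpt0 in gL; rewrite endptd in gR.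
have dom x : `|x - a j| < g -> x != a j -> 0 < x < 1 /\ D x.
  rewrite ltr_norml => /andP[x1 x2] xj; have x01 : 0 < x < 1 by apply/andP; split; lra.
  split=> //; split; first by case/andP: x01 => /ltW-> /ltW->.
  move=> k /andP[k0 kd]; case: (ltngtP k j) => [kj|jk|->//].
    have := hg _ _ kj (ltnW jd') => h; apply: contraTneq x1 => ->; rewrite -leNgt; lra.
  have := hg _ _ jk (ltnW kd) => h; apply: contraTneq x2 => ->; rewrite -leNgt; lra.
have [e [se fe]] : exists e, smooth_on `[0, 1] e /\ exists2 del, 0 < del &
    forall x, 0 < s * (x - a j) < del ->
      f x = side_const s j * `|ln (s * (x - a j))| + e x.
  case: (sign_cases s1) => ->; rewrite /side_const.
    have [e [se _]] := als_right hf jd; rewrite near_withinE => /nearR[del del0 h].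
    exists e; split=> //; exists del => // x; rewrite !mul1r ltr01 => /andP[x0 xd].
    by apply: h; [rewrite distrC gtr0_norm|rewrite -subr_gt0].
  have [e [se _]] := als_left hf jd; rewrite near_withinE => /nearR[del del0 h].
  exists e; split=> //; exists del => // x; rewrite !mulN1r ltr0N1 opprB => /andP[x0 xd].
  by apply: h; [rewrite gtr0_norm|rewrite -subr_gt0].
have [del del0 fE] := fe.
exists e, (Num.min del (Num.min g (1 / 2))); split=> //.
  by rewrite !lt_min del0 g0 /=; lra.
move=> x; rewrite !lt_min => /andP[x0 /andP[xdel /andP[xg x12]]].
have dist : `|x - a j| = s * (x - a j).
  rewrite -[RHS]ger0_norm ?(ltW x0) // normrM; have -> : `|s| = 1.
    by case: (sign_cases s1) => ->; rewrite ?normrN normr1.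
  by rewrite mul1r.
have xj : x != a j by apply: contraTneq x0 => ->; rewrite subrr mulr0 ltxx.
have xgj : `|x - a j| < g by rewrite dist.
have [x01 Dx] := dom x xgj xj.
split=> //; rewrite fE ?x0 //; congr (_ * _ + _).
by rewrite ler0_norm // ln_le0 //; lra.
Qed.

Definition cusp_sum1 (k : nat) (x : R) : R :=
  Cp k * cusp 1 (a k) x - Cm k * cusp (-1) (a k) x.

Definition cusp_sum2 (k : nat) (x : R) : R :=
  Cp k * cusp 1 (a k) x ^+ 2 + Cm k * cusp (-1) (a k) x ^+ 2.

Lemma cusp_sum1E k s x : s ^+ 2 = 1 -> 0 < s * (x - a k) ->
  cusp_sum1 k x = side_const s k / (x - a k).
Proof.
move=> /sign_cases[->|->]; rewrite /cusp_sum1 /cusp /side_const !(mul1r, mulN1r).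
  by move=> h; rewrite h ltr01 oppr_gt0 ltNge (ltW h) /= mulr0 subr0.
move=> h; rewrite h ltr0N1; rewrite oppr_gt0 in h.
by rewrite ltNge (ltW h) /= mulr0 sub0r invrN mulrN opprK.
Qed.

Lemma cusp_sum2E k s x : s ^+ 2 = 1 -> 0 < s * (x - a k) ->
  cusp_sum2 k x = side_const s k / (x - a k) ^+ 2.
Proof.
move=> /sign_cases[->|->]; rewrite /cusp_sum2 /cusp /side_const !(mul1r, mulN1r).
  by move=> h; rewrite h ltr01 oppr_gt0 ltNge (ltW h) /= expr0n mulr0 addr0 exprVn.
move=> h; rewrite h ltr0N1; rewrite oppr_gt0 in h.
by rewrite ltNge (ltW h) /= expr0n mulr0 add0r exprVn sqrrN.
Qed.

Lemma roof_near_sing j s : (0 < j < d)%N -> s ^+ 2 = 1 ->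
  exists M del, [/\ 0 <= M, 0 < del & forall x, 0 < s * (x - a j) < del ->
    [/\ f x <= side_const s j * - ln (s * (x - a j)) + M,
        `|f1 x + cusp_sum1 j x| <= M & `|f2 x - cusp_sum2 j x| <= M]].
Proof.
move=> jd s1; have [e [del [del0 se fE]]] := roof_side jd s1.
have [M [del' [M0 del'0 h]]] := log_side_derivatives (roof_endpt_01 jd) s1 del0 se fE.
exists M, (Num.min del del'); split=> //; first by rewrite lt_min del0.
move=> x; rewrite lt_min => /andP[x0 /andP[xd xd']].
have [|e0 b1 b2] := h x; first by rewrite x0.
have [|_ _ fx] := fE x; first by rewrite x0.
rewrite (cusp_sum1E s1 x0) (cusp_sum2E s1 x0); split=> //.
by rewrite fx lerD2l (le_trans (ler_norm _)).
Qed.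

Definition bounded_at (x0 : R) (g : R -> R) : Prop :=
  exists M e, 0 < e /\ forall x, `|x0 - x| < e -> D x -> `|g x| <= M.

Lemma bounded_atD x0 g h : bounded_at x0 g -> bounded_at x0 h ->
  bounded_at x0 (fun x => g x + h x).
Proof.
move=> [M [e [e0 hM]]] [M' [e' [e'0 hM']]]; exists (M + M'), (Num.min e e').
split; first by rewrite lt_min e0.
move=> x; rewrite lt_min => /andP[xe xe'] Dx; apply: le_trans (ler_normD _ _) _.
by rewrite lerD ?hM ?hM'.
Qed.

Lemma bounded_at_sum x0 (r : seq nat) (P : pred nat) (G : nat -> R -> R) :
  (forall k, k \in r -> P k -> bounded_at x0 (G k)) ->
  bounded_at x0 (fun x => \sum_(k <- r | P k) G k x).
Proof.
elim: r => [|k r IH] h.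
  by exists 0, 1; split=> // x _ _; rewrite big_nil normr0.
have hr : bounded_at x0 (fun x => \sum_(k <- r | P k) G k x).
  by apply: IH => i ir; apply: h; rewrite inE ir orbT.
case: (boolP (P k)) => Pk.
  have [M [e [e0 hM]]] := bounded_atD (h k (mem_head k r) Pk) hr.
  by exists M, e; split=> // x xe Dx; rewrite big_cons Pk; exact: hM.
have [M [e [e0 hM]]] := hr.
by exists M, e; split=> // x xe Dx; rewrite big_cons (negbTE Pk); exact: hM.
Qed.

Lemma cusp_le_dist s (b c x : R) : s ^+ 2 = 1 -> 0 < c -> c <= `|x - b| ->
  cusp s b x <= c^-1.
Proof.
move=> s1 c0 cx; rewrite /cusp; case: ifP => [h|_]; last by rewrite invr_ge0 ltW.
rewrite lef_pV2 ?posrE //; apply: le_trans cx _.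
rewrite -[leRHS]ger0_norm ?(ltW h) // normrM.
by case: (sign_cases s1) => ->; rewrite ?normrN normr1 mul1r.
Qed.

Let s1p : (1 : R) ^+ 2 = 1. Proof. by rewrite expr1n. Qed.
Let s1m : (-1 : R) ^+ 2 = 1. Proof. by rewrite sqrrN expr1n. Qed.

Lemma cusp_sum1_le k c x : (0 < k < d)%N -> 0 < c -> c <= `|x - a k| ->
  `|cusp_sum1 k x| <= (Cp k + Cm k) / c.
Proof.
move=> kd c0 cx; have [p0 m0] := als_const_gt0 hf kd.
apply: le_trans (ler_normB _ _) _; rewrite mulrDl lerD // normrM gtr0_norm //.
  by rewrite ler_wpM2l ?(ltW p0) // ger0_norm ?cusp_ge0 // cusp_le_dist.
by rewrite ler_wpM2l ?(ltW m0) // ger0_norm ?cusp_ge0 // cusp_le_dist.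
Qed.

Lemma cusp_sum2_le k c x : (0 < k < d)%N -> 0 < c -> c <= `|x - a k| ->
  `|cusp_sum2 k x| <= (Cp k + Cm k) / c ^+ 2.
Proof.
move=> kd c0 cx; have [p0 m0] := als_const_gt0 hf kd.
apply: le_trans (ler_normD _ _) _; rewrite mulrDl lerD // normrM gtr0_norm //.
  rewrite ler_wpM2l ?(ltW p0) // ger0_norm ?exprn_ge0 ?cusp_ge0 // -exprVn.
  by rewrite ler_pXn2r ?nnegrE ?cusp_ge0 ?invr_ge0 ?(ltW c0) // cusp_le_dist.
rewrite ler_wpM2l ?(ltW m0) // ger0_norm ?exprn_ge0 ?cusp_ge0 // -exprVn.
by rewrite ler_pXn2r ?nnegrE ?cusp_ge0 ?invr_ge0 ?(ltW c0) // cusp_le_dist.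
Qed.

Lemma bounded_at_cusp_sum k x0 : (0 < k < d)%N -> x0 != a k ->
  bounded_at x0 (cusp_sum1 k) /\ bounded_at x0 (fun x => - cusp_sum2 k x).
Proof.
move=> kd xk; pose c := `|x0 - a k| / 2.
have c0 : 0 < c by rewrite divr_gt0 // normr_gt0 subr_eq0.
have far x : `|x0 - x| < c -> c <= `|x - a k|.
  move=> xc; have := ler_normD (x0 - x) (x - a k).
  rewrite addrA subrK; move: xc; rewrite /c; lra.
split; [exists ((Cp k + Cm k) / c), c|exists ((Cp k + Cm k) / c ^+ 2), c].
  by split=> // x xc _; apply: cusp_sum1_le => //; exact: far.
by split=> // x xc _; rewrite normrN; apply: cusp_sum2_le => //; exact: far.
Qed.

(** At a singularity the cusp of the same index compensates [h], and the other
    cusps are far away; elsewhere all terms are bounded separately. *)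
Lemma bounded_at_decomp (h : R -> R) (Z : nat -> R -> R) x0 :
  (D x0 -> bounded_at x0 h) ->
  (forall k, (0 < k < d)%N -> x0 != a k -> bounded_at x0 (Z k)) ->
  (forall j s, (0 < j < d)%N -> s ^+ 2 = 1 -> exists M del, 0 < del /\
     forall x, 0 < s * (x - a j) < del -> `|h x + Z j x| <= M) ->
  0 <= x0 <= 1 -> bounded_at x0 (fun x => h x + \sum_(1 <= k < d) Z k x).
Proof.
move=> hD hZ hs x01.
have kin k : k \in index_iota 1 d -> (0 < k < d)%N by rewrite mem_index_iota.
case: (pselect (exists j, (0 < j < d)%N /\ x0 = a j)) => [[j [jd x0j]]|none]; last first.
  have Dx0 : D x0.
    split=> // k kd; apply/negP => /eqP xk; apply: none; by exists k.
  apply: bounded_atD; first exact: hD.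
  by apply: bounded_at_sum => k /kin kd _; apply: hZ => //; have [_] := Dx0; exact.
have sumE x : h x + \sum_(1 <= k < d) Z k x
    = (h x + Z j x) + \sum_(1 <= k < d | k != j) Z k x.
  rewrite (bigD1_seq j) ?addrA ?iota_uniq //=.
  by rewrite mem_index_iota.
have B1 : bounded_at x0 (fun x => h x + Z j x).
  have [M [e [e0 hM]]] := hs j 1 jd s1p; have [M' [e' [e'0 hM']]] := hs j (-1) jd s1m.
  exists (Num.max M M'), (Num.min e e'); split; first by rewrite lt_min e0.
  move=> x; rewrite lt_min x0j => /andP[xe xe'] [_ /(_ j jd) xj].
  rewrite le_max; case: (ltgtP x (a j)) => [lt|gt|E]; last by rewrite E eqxx in xj.
    rewrite hM' ?orbT // mulN1r opprB subr_gt0 lt /=.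
    by apply: le_lt_trans xe'; exact: ler_norm.
  rewrite hM // mul1r subr_gt0 gt /=.
  by apply: le_lt_trans xe; rewrite distrC ler_norm.
have B2 : bounded_at x0 (fun x => \sum_(1 <= k < d | k != j) Z k x).
  apply: bounded_at_sum => k /kin kd kj; apply: hZ => //; rewrite x0j.
  have [g g0 hg] := endpt_gap T.
  have /andP[_ jd'] := jd; have /andP[_ kd'] := kd.
  case: (ltngtP k j) kj => // [lt|gt] _.
    have := hg _ _ lt (ltnW jd') => hh; rewrite -subr_eq0 gt_eqF //; lra.
  have := hg _ _ gt (ltnW kd') => hh; rewrite -subr_eq0 lt_eqF //; lra.
have [M [e [e0 hM]]] := bounded_atD B1 B2.
by exists M, e; split=> // x xe Dx; rewrite sumE; exact: hM.
Qed.

Lemma roof_smooth m x : D x ->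
  cvg (diff_quotient (iter m (deriv_on D) f) x y @[y --> within D x^']).
Proof. exact: (als_smooth hf). Qed.

Lemma roof_dom_01 x : D x -> 0 <= x <= 1.
Proof. by case. Qed.

Lemma roof_deriv1_le : exists M, 0 <= M /\ forall x, D x ->
  `|f1 x + \sum_(1 <= k < d) cusp_sum1 k x| <= M.
Proof.
have [|M [M0 hM]] := @segment_bounded R D (fun x => f1 x + \sum_(1 <= k < d) cusp_sum1 k x).
  move=> x0; apply: bounded_at_decomp.
  - by move=> Dx; have := diff_quotient_locally_bounded (roof_smooth (m := 1%N) Dx).
  - by move=> k kd xk; have [] := bounded_at_cusp_sum kd xk.
  - move=> j s jd s1; have [M [del [_ del0 h]]] := roof_near_sing jd s1.
    by exists M, del; split=> // x /h[].
by exists M; split=> // x Dx; apply: hM => //; exact: roof_dom_01.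
Qed.

Lemma roof_deriv2_le : exists M, 0 <= M /\ forall x, D x ->
  `|f2 x - \sum_(1 <= k < d) cusp_sum2 k x| <= M.
Proof.
have [|M [M0 hM]] := @segment_bounded R D (fun x => f2 x + \sum_(1 <= k < d) - cusp_sum2 k x).
  move=> x0; apply: bounded_at_decomp.
  - by move=> Dx; have := diff_quotient_locally_bounded (roof_smooth (m := 2%N) Dx).
  - by move=> k kd xk; have [] := bounded_at_cusp_sum kd xk.
  - move=> j s jd s1; have [M [del [_ del0 h]]] := roof_near_sing jd s1.
    by exists M, del; split=> // x /h[].
exists M; split=> // x Dx; rewrite -sumrN; apply: hM => //; exact: roof_dom_01.
Qed.

(** At distance less than [expR (-1)] the logarithm is at least 1 in absolute
    value, so that it absorbs the bounded part of the roof function. *)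
Lemma roof_le_log : exists C del, [/\ 0 < C, 0 < del & forall k x, (0 < k < d)%N ->
  0 < `|x - a k| < del -> f x <= C * `|ln `|x - a k| |].
Proof.
suff H : forall N, exists C del, [/\ 0 < C, 0 < del & forall k x, (k < N)%N ->
    (0 < k < d)%N -> 0 < `|x - a k| < del -> f x <= C * `|ln `|x - a k| |].
  have [C [del [C0 del0 h]]] := H d; exists C, del; split=> // k x kd.
  by apply: h => //; case/andP: kd.
elim=> [|N [C [del [C0 del0 IH]]]]; first by exists 1, 1; split.
case: (boolP (0 < N < d)%N) => Nd; last first.
  exists C, del; split=> // k x; rewrite ltnS leq_eqVlt => /orP[/eqP->|kN].
    by rewrite (negbTE Nd).
  exact: IH.
have [M [e [M0 e0 hM]]] := roof_near_sing Nd s1p.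
have [M' [e' [M'0 e'0 hM']]] := roof_near_sing Nd s1m.
pose C1 := Cp N + Cm N + M + M'.
have [p0 m0] := als_const_gt0 hf Nd.
have C10 : 0 < C1 by rewrite /C1; lra.
exists (C + C1), (Num.min del (Num.min (expR (-1)) (Num.min e e'))); split.
- exact: addr_gt0.
- by rewrite !lt_min del0 expR_gt0 e0.
move=> k x; rewrite ltnS leq_eqVlt => kN kd; rewrite !lt_min => /andP[x0].
move=> /andP[xdel /andP[xE /andP[xe xe']]].
case/orP: kN => [/eqP kN|kN]; last first.
  have := IH k x kN kd; rewrite x0 xdel => /(_ isT)/le_trans; apply.
  by rewrite ler_wpM2r // lerDl ltW.
subst k; have t0 : 0 < `|x - a N| by [].
have lnt : 1 <= - ln `|x - a N|.
  by rewrite lerNr -(expRK (-1)) ler_ln ?posrE ?expR_gt0 // ltW.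
rewrite ler0_norm; last by lra.
apply: (@le_trans _ _ (C1 * - ln `|x - a N|)); last first.
  by rewrite ler_wpM2r; lra.
have fin (c m : R) : 0 <= c <= Cp N + Cm N -> 0 <= m <= M + M' ->
    c * - ln `|x - a N| + m <= C1 * - ln `|x - a N|.
  move: (- ln _) lnt => t t1 /andP[c0 cc] /andP[m00 mm]; rewrite /C1.
  have : c * t <= (Cp N + Cm N) * t by rewrite ler_wpM2r //; lra.
  have : m <= (M + M') * t by rewrite -[leLHS]mulr1; apply: ler_pM; lra.
  have -> : (Cp N + Cm N + M + M') * t = (Cp N + Cm N) * t + (M + M') * t by ring.
  lra.
case: (ltgtP x (a N)) => [lt|gt|E]; last by rewrite E subrr normr0 ltxx in x0.
  have dE : `|x - a N| = -1 * (x - a N) by rewrite ltr0_norm ?mulN1r // subr_lt0.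
  have [|h _ _] := hM' x; first by rewrite -dE t0.
  apply: le_trans h _; rewrite -dE; apply: fin; rewrite /side_const ?ltr0N1; apply/andP; split; lra.
have dE : `|x - a N| = 1 * (x - a N) by rewrite gtr0_norm ?mul1r // subr_gt0.
have [|h _ _] := hM x; first by rewrite -dE t0.
apply: le_trans h _; rewrite -dE; apply: fin; rewrite /side_const ?ltr01; apply/andP; split; lra.
Qed.

Lemma roof_dom_nbhs x : D x -> 0 < x < 1 -> nbhs x D.
Proof.
move=> [_ xk] /andP[x0 x1]; apply/nearR.
pose m := \big[Num.min/Num.min x (1 - x)]_(k < d | (0 < k)%N) `|x - a k|.
exists m.
  apply: lt_bigmin; first by rewrite lt_min x0 subr_gt0.
  by move=> k k0; rewrite normr_gt0 subr_eq0 xk // k0 ltn_ord.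
move=> y xy; have m1 : m <= Num.min x (1 - x) by exact: bigmin_le_id.
have xyl : `|x - y| < Num.min x (1 - x) by exact: lt_le_trans xy m1.
rewrite lt_min !ltr_norml in xyl; have /andP[/andP[h1 h2] /andP[h3 h4]] := xyl.
split; first by apply/andP; split; lra.
move=> k /andP[k0 kd]; apply: contraTneq xy => ->; rewrite -leNgt.
exact: (bigmin_le_cond _ (j := Ordinal kd)).
Qed.

Lemma roof_within_continuous (A : set R) : A `<=` D -> {within A, continuous f}.
Proof.
move=> AD; apply/subspace_continuousP => w Aw.
have [M [e [e0 he]]] := diff_quotient_bounded (roof_smooth (m := 0%N) (AD w Aw)).
apply/cvgrPdist_lt => eps eps0; rewrite near_withinE; apply/nearR.
exists (Num.min e (eps / (`|M| + 1))).
  by rewrite lt_min e0 divr_gt0 // ltr_wpDl.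
move=> v; rewrite lt_min => /andP[ve veps] Av.
rewrite distrC; apply: le_lt_trans (he v ve (AD v Av)) _.
rewrite ltr_pdivlMr ?ltr_wpDl // in veps; rewrite distrC in veps.
apply: le_lt_trans veps; rewrite mulrC ler_wpM2l // (le_trans (ler_norm M)) //.
by rewrite lerDl.
Qed.

(** Away from the singularities the roof function oscillates little on short
    intervals, because its derivative is bounded by the inverse distance. *)
Lemma roof_oscillation : exists M, 0 <= M /\ forall c y z, 0 < c <= 1 ->
  0 <= y <= z -> z <= 1 ->
  (forall w k, y <= w <= z -> (0 < k < d)%N -> c <= `|w - a k|) ->
  `|f z - f y| <= M / c * (z - y).
Proof.
have [M1 [M10 h1]] := roof_deriv1_le.
pose S := \sum_(1 <= k < d) (Cp k + Cm k).
have S0 : 0 <= S.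
  rewrite /S big_seq; apply: sumr_ge0 => k; rewrite mem_index_iota => /(als_const_gt0 hf)[p0 m0].
  by rewrite addr_ge0 // ltW.
exists (M1 + S); split; first exact: addr_ge0.
move=> c y z /andP[c0 c1] /andP[y0 yz] z1 far.
have Dw w : y <= w <= z -> D w.
  move=> /andP[yw wz]; split; first by apply/andP; split; lra.
  move=> k kd; apply/negP => /eqP wk; have := far w k; rewrite yw wz => /(_ isT kd).
  by rewrite wk subrr normr0 leNgt c0.
have [w wyz E] : exists2 w, w \in `[y, z] & f z - f y = f1 w * (z - y).
  apply: MVT_segment => //.
    move=> w; rewrite in_itv /= => /andP[yw wz].
    have Dw' : D w by apply: Dw; rewrite !ltW.
    apply: is_derive_deriv_on; last exact: (roof_smooth (m := 0%N) Dw').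
    by apply: roof_dom_nbhs => //; apply/andP; split; lra.
  by apply: roof_within_continuous => w /=; rewrite in_itv /= => /Dw.
rewrite E normrM [`|z - y|]ger0_norm ?subr_ge0 //.
rewrite ler_wpM2r ?subr_ge0 //.
rewrite in_itv /= in wyz.
have := h1 w (Dw w wyz) => hw.
have sumle : `|\sum_(1 <= k < d) cusp_sum1 k w| <= S / c.
  apply: le_trans (ler_norm_sum _ _ _) _; rewrite /S mulr_suml.
  rewrite big_seq [leRHS]big_seq; apply: ler_sum => k; rewrite mem_index_iota => kd.
  by apply: cusp_sum1_le => //; exact: far.
have := ler_normB (f1 w + \sum_(1 <= k < d) cusp_sum1 k w) (\sum_(1 <= k < d) cusp_sum1 k w).
rewrite addrK => /le_trans; apply; rewrite mulrDl lerD //.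
apply: le_trans hw _; rewrite ler_peMr // invf_ge1 //.
Qed.

End Roof.

(** * Integral of the roof function *)

Section RoofIntegral.
Context {R : realType} {d : nat} {T : iet R d} {f : R -> R} {Cp Cm : nat -> R}.
Hypothesis T1 : total_len T = 1.
Hypothesis hf : asym_log_sing T f Cp Cm.
Local Notation D := (roof_dom T).
Local Notation mu := (@lebesgue_measure R).

Lemma roof_gt0 x : D x -> 0 < f x.
Proof. by move=> Dx; have [x0 [_ p0 /(_ x Dx)]] := als_min hf; exact: lt_le_trans. Qed.

Let E (N : nat) : set R :=
  [set x | 0 <= x <= 1 /\ forall k, (0 < k < N)%N -> x != endpt T k].

Let E0 : E 1 = [set` `[0, 1]].
Proof.
apply/seteqP; split=> x /=; rewrite in_itv /=; first by case.
by split=> // -[|[]].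
Qed.

Let ES N : (0 < N)%N -> E N.+1 = E N `\ endpt T N.
Proof.
move=> N0; apply/seteqP; split=> x /=.
  move=> [x01 xk]; split; last by apply/eqP/xk; rewrite N0 ltnSn.
  by split=> // k /andP[k0 kN]; apply: xk; rewrite k0 ltnW.
move=> [[x01 xk] /eqP xN]; split=> // k /andP[k0].
by rewrite ltnS leq_eqVlt => /orP[/eqP->//|kN]; apply: xk; rewrite k0.
Qed.

Let mE N : (0 < N)%N -> measurable (E N).
Proof.
case: N => // N _; elim: N => [|N IH]; first by rewrite E0.
by rewrite ES //; exact: measurableD.
Qed.

(** Downward induction from the domain of [f], adding back one singularity at a
    time, since [f] may take any values there. *)
Let mf m : (m < d)%N -> measurable_fun (E (d - m)) (EFin \o f).
Proof.
elim: m => [|m IH] md.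
  apply/measurable_EFinP; rewrite subn0.
  by apply: subspace_continuous_measurable_fun; [exact: mE|exact: (roof_within_continuous hf)].
have dm : (d - m = (d - m.+1).+1)%N by rewrite subnSK // ltnW.
have N0 : (0 < d - m.+1)%N by rewrite subn_gt0.
have {IH} := IH (ltnW md); rewrite dm ES // => mfd.
have : measurable_fun ((E (d - m.+1) `\ endpt T (d - m.+1)) `|` [set endpt T (d - m.+1)])
    (EFin \o f).
  apply/measurable_funU => //; first by apply: measurableD => //; exact: mE.
  by split=> //; exact: measurable_fun_set1.
apply: measurable_funS; last by move=> x Ex /=; case: (pselect (x = endpt T (d - m.+1))); [right|left].
by apply: measurableU => //; apply: measurableD => //; exact: mE.
Qed.

Lemma integral_roof_dom : (0 < d)%N ->
  (\int[mu]_(x in `[0%R, 1%R]) (f x)%:E = \int[mu]_(x in D) (f x)%:E)%E.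
Proof.
move=> d0; rewrite -E0; have -> : D = E (d.-1).+1 by rewrite prednK.
have : (d.-1 < d)%N by rewrite prednK.
elim: d.-1 => // N IH Nd; rewrite (IH (ltnW Nd)) [in RHS]ES //.
rewrite integral_setD1 //; first by apply: measurableD => //; exact: mE.
rewrite -ES //; have -> : N.+2 = (d - (d - N.+2))%N by rewrite subKn.
by apply: mf; rewrite ltn_subrL (leq_trans _ Nd).
Qed.

Lemma roof_measurable : (0 < d)%N -> measurable_fun D (EFin \o f).
Proof. by move=> d0; have := mf d0; rewrite subn0. Qed.

Lemma roof_dom_measurable : (0 < d)%N -> measurable D.
Proof. exact: mE. Qed.

Context {T' : iet R d} {H : 'I_d -> nat} {it : 'I_d -> nat -> 'I_d}.
Hypothesis tw : tower T T' H it.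
Local Notation flo := (floor_lo (T := T) (T' := T') (H := H)).
Local Notation flen := (floor_len (T' := T') (H := H)).
Local Notation infl := (in_floor (T := T) (T' := T') (H := H)).

(** A floor with [0 < b J] lies in the domain of [f], where [f] is positive and
    at least [b J]; the floors are disjoint, and the finitely many singularities
    are negligible. *)
Lemma sum_floors_le_integral (b : tfloor H -> R) : (0 < d)%N ->
  (forall J, 0 <= b J) ->
  (forall J w, 0 < b J -> infl J w -> D w /\ b J <= f w) ->
  ((\sum_J b J * flen J)%:E <= \int[mu]_(x in `[0%R, 1%R]) (f x)%:E)%E.
Proof.
move=> d0 b0 bf; rewrite integral_roof_dom //.
pose s := enum [pred J : tfloor H | 0 < b J].
pose F (J : tfloor H) : set R := if 0 < b J then [set` `[flo J, flo J + flen J[] else set0.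
have FE J x : F J x <-> 0 < b J /\ infl J x.
  by rewrite /F; case: ifP => h /=; rewrite ?in_itv /=; split=> // -[].
have mF J : measurable (F J) by rewrite /F; case: ifP.
have FD J : F J `<=` D by move=> x /FE[bJ Jx]; have [] := bf J x bJ Jx.
have UD : \big[setU/set0]_(J <- s) F J `<=` D.
  by move=> x; rewrite -bigcup_seq => -[J _ FJ]; exact: (FD J).
have mU : measurable (\big[setU/set0]_(J <- s) F J) by exact: bigsetU_measurable.
have f0 x : D x -> (0 <= (f x)%:E)%E by move=> /roof_gt0/ltW; rewrite lee_fin.
apply: (@le_trans _ _ (\int[mu]_(x in \big[setU/set0]_(J <- s) F J) (f x)%:E)%E); last first.
  by apply: ge0_subset_integral => //; [exact: roof_dom_measurable|exact: roof_measurable].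
rewrite ge0_integral_bigsetU //; last first.
- by move=> x /UD/f0.
- by apply: measurable_funS (roof_measurable d0) => //; exact: roof_dom_measurable.
- apply/trivIsetP => J J' _ _ JJ'; apply/seteqP; split=> // x [/FE[_ h] /FE[_ h']].
  by rewrite (in_floor_inj tw h h') eqxx in JJ'.
- exact: enum_uniq.
have -> : \sum_J b J * flen J = \sum_(J <- s) b J * flen J.
  rewrite (bigID (fun J => 0 < b J)) /= [X in _ + X]big1 ?addr0; last first.
    by move=> J; rewrite -leNgt => bJ; rewrite (@le_anti _ _ (b J) 0) ?mul0r // bJ b0.
  by rewrite /s big_enum.
rewrite -sumEFin big_seq [leRHS]big_seq; apply: lee_sum => J.
rewrite mem_enum inE => bJ.
have mu_F : mu (F J) = (flen J)%:E.
  rewrite /F bJ lebesgue_measure_itv /= lte_fin ltrDl iet_len_gt0.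
  by rewrite -EFinB addrAC subrr add0r.
rewrite EFinM -mu_F -(integral_cst mu (mF J) (b J)%:E).
apply: ge0_le_integral => //; first exact: (mF J).
- by move=> x _ /=; rewrite lee_fin ltW.
- by apply: measurable_funS (roof_measurable d0) => //; exact: roof_dom_measurable.
- by move=> x /FE[_ Jx] /=; rewrite lee_fin; have [] := bf J x bJ Jx.
Qed.

End RoofIntegral.

(** * Birkhoff sums of the roof function *)

Section RoofSum.
Context {R : realType} {d : nat} {RV : nat -> iet R d} {n : nat -> nat}
  {kappa nu D D' : R} {lbar : nat}.
Hypothesis bl : balanced RV n kappa nu D D' lbar.
Context {tau tau' : R}.
Hypotheses (htau : 1 < tau < 2) (htau' : tau / 2 < tau' < 1).
Hypothesis hnorm : (l%:R `^ (- tau) * mxnorm1 (rv_matrix RV (n l) (n l.+1)))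
  @[l --> \oo] --> (0 : R).
Context {f : R -> R} {Cp Cm : nat -> R}.
Hypothesis hf : asym_log_sing (RV 0%N) f Cp Cm.

Local Notation RVstep := (bl_step bl).
Local Notation F := (iet_map (RV 0%N)).
Local Notation dom := (roof_dom (RV 0%N)).
Local Notation mh l := (max_height RV (n l)).
Local Notation lam l := (total_len (RV (n l))).
Local Notation X l := (ln (mh l)%:R : R).
Local Notation K := ((Num.floor kappa)%:~R + 2 : R).
Local Notation avoids := (avoids (RV := RV) (n := n) (tau' := tau')).
Local Notation a := (endpt (RV 0%N)).

Let mh0 l : 0 < (mh l)%:R :> R.
Proof. by rewrite ltr0n (max_height_gt0 bl). Qed.

Let kappa0 : 0 < kappa.
Proof. by rewrite (lt_trans _ (bl_kappa bl)). Qed.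

(** This makes the logarithm an instance of the estimate for points close to a
    singularity, with a constant [psi] that tends to 0. *)
Lemma abs_ln_le_sqrt (t : R) : 0 < t <= 1 -> `|ln t| <= 2 / Num.sqrt t.
Proof.
move=> /andP[t0 t1]; have s0 : 0 < Num.sqrt t by rewrite sqrtr_gt0.
rewrite ler0_norm ?ln_le0 //.
have E : ln t = 2 * ln (Num.sqrt t).
  by rewrite -[in LHS](sqr_sqrtr (ltW t0)) lnXn // mulr_natl.
have := @ln_le_sub1 R (Num.sqrt t)^-1; rewrite invr_gt0 => /(_ s0).
rewrite lnV ?posrE // E; lra.
Qed.

Lemma sqrt_len_log_small M L e : 0 < M -> 0 < e -> exists l0, forall l, (l0 <= l)%N ->
  forall r, (0 < r < mh l.+1)%N -> Num.sqrt (M * lam (l - L)) * ln r%:R <= e.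
Proof.
move=> M0 e0; pose P := M * kappa; have P0 : 0 < P by rewrite mulr_gt0.
have sP0 : 0 < Num.sqrt P by rewrite sqrtr_gt0.
pose C := 64 * (Num.sqrt P / e) + 2.
have Pe0 : 0 < Num.sqrt P / e by rewrite divr_gt0.
have C0 : 0 <= C by rewrite /C; lra.
have [l0 sc] := scales bl htau htau' hnorm L C0 (divr_gt0 (@ltr01 R) (@ltr0Sn R 1)).
exists l0 => l /sc[Q [[Q0 Ll CX] [XQ _ CQ _]]] r /andP[r0 rH].
have XX : X l <= X l.+1 by exact: (ln_max_height_mono bl (leqnSn l)).
have QX : Q <= X l / 2.
  apply: le_trans (_ : 1 / 2 * X l <= _); last by lra.
  by apply: le_trans CQ; rewrite /C; nra.
set Y := X (l - L) in XQ *.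
have QY : Q <= Y by lra.
have CY : C <= 2 * Y by lra.
have Y0 : 0 < Y by rewrite /C in CY; lra.
have lr : ln r%:R <= 2 * Y.
  apply: (@le_trans _ _ (X l.+1)); last by lra.
  by apply: ler_ln_imp; rewrite ?ltr0n // ler_nat ltnW.
have lr0 : 0 <= ln r%:R :> R by rewrite ln_ge0 // ler1n.
have eY : expR Y = (mh (l - L))%:R by rewrite lnK ?posrE.
have sq : Num.sqrt (M * lam (l - L)) <= Num.sqrt P / expR (Y / 2).
  have E : (expR (Y / 2)) ^+ 2 = expR Y by rewrite expr2 -expRD; congr expR; field.
  have -> : Num.sqrt P / expR (Y / 2) = Num.sqrt (P / expR Y).
    rewrite [in RHS]sqrtrM ?(ltW P0) //; congr (_ * _).
    by rewrite -E -exprVn sqrtr_sqr ger0_norm // invr_ge0 expR_ge0.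
  apply: ler_wsqrtr; rewrite eY ler_pdivlMr // /P -mulrA ler_wpM2l ?(ltW M0) //.
  by rewrite mulrC (max_height_len_le_kappa bl).
have ex := expR_half_ge (ltW Y0).
apply: (@le_trans _ _ (Num.sqrt P / expR (Y / 2) * (2 * Y))).
  by apply: ler_pM; rewrite ?sqrtr_ge0.
rewrite mulrAC ler_pdivrMr ?expR_gt0 //.
apply: (@le_trans _ _ (e * (Y ^+ 2 / 16))); last by rewrite ler_wpM2l ?(ltW e0).
have : 64 * (Num.sqrt P / e) <= 2 * Y by rewrite /C in CY; lra.
rewrite mulrA ler_pdivrMr // => h.
have -> : e * (Y ^+ 2 / 16) = (2 * Y * e) * (Y / 32) by field.
apply: (@le_trans _ _ (64 * Num.sqrt P * (Y / 32))).
  by rewrite le_eqVlt; apply/orP; left; apply/eqP; field.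
by rewrite ler_wpM2r // divr_ge0 // ltW.
Qed.

Lemma orbit_max_ge (g : R -> R -> R) r x k i : (0 < k < d)%N -> (i < r)%N ->
  g (a k) (iter i F x) <= orbit_max (RV 0%N) g r x.
Proof.
move=> kd ir; rewrite /orbit_max.
have : k \in index_iota 1 d by rewrite mem_index_iota.
elim: (index_iota 1 d) => // k' s IH; rewrite inE big_cons => /orP[/eqP <-|ks].
  rewrite le_max; apply/orP; left.
  exact: (le_bigmax _ (fun i : 'I_r => g (a k) (iter i F x)) (Ordinal ir)).
by rewrite le_max (IH ks) orbT.
Qed.

Lemma orbit_max_ge0 (g : R -> R -> R) r x : 0 <= orbit_max (RV 0%N) g r x.
Proof.
rewrite /orbit_max; elim: (index_iota 1 d) => [|k s IH]; first by rewrite big_nil.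
by rewrite big_cons le_max IH orbT.
Qed.

Let d_gt0 : (0 < d)%N. Proof. exact: rv_step_d_gt0 (RVstep 0%N). Qed.

Section FarPart.
Context (M theta eta : R) (L l r : nat) (y I : R).
Hypotheses (M0 : 0 < M) (theta0 : 0 < theta) (eta0 : 0 <= 1 + eta).
Hypothesis osc : forall y z, 0 <= y <= z -> z <= 1 ->
  (forall w k, y <= w <= z -> (0 < k < d)%N -> M * lam (l - L) <= `|w - a k|) ->
  z - y <= lam (l - L) -> `|f z - f y| <= theta.
Hypothesis y01 : 0 <= y < 1.
Hypothesis Iint : (\int[@lebesgue_measure R]_(x in `[0%R, 1%R]) (f x)%:E = I%:E)%E.
Hypothesis vis : forall J : tfloor (height RV (n (l - L))),
  birkhoff F (fun z => (in_floor (T := RV 0%N) (T' := RV (n (l - L))) J z)%:R : R) r y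
    <= (1 + eta) * r%:R * floor_len (T' := RV (n (l - L))) J.

Definition far_from_sing (z : R) : bool :=
  [forall k : 'I_d, (0 < k)%N ==> ((M + 1) * lam (l - L) < `|z - a k|)].

(** Far from the singularities the roof function is almost constant on each
    floor, so that the frequencies of the visits turn its sum into a Riemann
    sum, bounded by the integral. *)
Lemma birkhoff_roof_far_le :
  birkhoff F (fun z => if far_from_sing z then f z else 0) r y
    <= (1 + eta) * r%:R * (I + 2 * theta).
Proof.
have [it tw] := rv_height_tower RVstep (n (l - L)).
have one := bl_one bl; have t0 := theta0.
have lam0 : 0 < lam (l - L) by exact: rv_total_len_gt0 RVstep _.
set lm := lam (l - L) in lam0 *.
pose flo := floor_lo (T := RV 0%N) (T' := RV (n (l - L))) (H := height RV (n (l - L))).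
pose flen := floor_len (T' := RV (n (l - L))) (H := height RV (n (l - L))).
pose infl := in_floor (T := RV 0%N) (T' := RV (n (l - L))) (H := height RV (n (l - L))).
pose c J := if `[< exists2 z, infl J z & far_from_sing z >] then f (flo J) + theta else 0.
have fl0 J : 0 < flen J by exact: iet_len_gt0.
have fllm J : flen J <= lm by exact: floor_len_le_total.
have Mlm : 0 < M * lm by rewrite mulr_gt0.
have in01 J w : infl J w -> 0 <= w < 1 by move/(in_floor_range tw); rewrite one.
have farJ J z w k : infl J z -> far_from_sing z -> infl J w -> (0 < k < d)%N ->
    M * lm <= `|w - a k|.
  move=> Jz /forallP fz Jw /andP[k0 kd].
  have := fz (Ordinal kd); rewrite k0 /= => zk.
  have := ler_normD (z - w) (w - a k); rewrite addrA subrK.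
  have : `|z - w| <= lm.
    move: Jz Jw (fllm J); rewrite /infl /in_floor -/flo -/flen ler_norml.
    move=> /andP[z1 z2] /andP[w1 w2] fl; apply/andP; split; lra.
  rewrite -/lm in zk; have E : (M + 1) * lm = M * lm + lm by ring.
  rewrite E in zk; lra.
have domJ J z w : infl J z -> far_from_sing z -> infl J w -> dom w.
  move=> Jz fz Jw; have /andP[w0 w1] := in01 _ _ Jw.
  split; first by rewrite w0 ltW.
  move=> k kd; apply/negP => /eqP wk; have := farJ J z w k Jz fz Jw kd.
  by rewrite wk subrr normr0 leNgt Mlm.
have loJ J : infl J (flo J) by exact: in_floor_lo.
have oscJ J z w : infl J z -> far_from_sing z -> infl J w ->
    `|f w - f (flo J)| <= theta.
  move=> Jz fz Jw; have /andP[w1 w2] := Jw; have Jw' := Jw.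
  apply: osc => //.
  - by rewrite w1 andbT; case/andP: (in01 _ _ (loJ J)).
  - by case/andP: (in01 _ _ Jw) => _ /ltW.
  - move=> v k /andP[v1 v2]; apply: (farJ J z v k Jz fz).
    by rewrite /infl /in_floor v1 (le_lt_trans v2).
  - rewrite lerBlDl; apply: le_trans (ltW w2) _; rewrite lerD2l; exact: fllm.
have c0 J : 0 <= c J.
  rewrite /c; case: ifP => // /asboolP[z Jz fz].
  by rewrite addr_ge0 ?(ltW theta0) ?(ltW (roof_gt0 hf (domJ J z _ Jz fz (loJ J)))).
have gc J z : infl J z -> (if far_from_sing z then f z else 0) <= c J.
  move=> Jz; case: ifP => fz; last exact: c0.
  rewrite /c; case: asboolP => [_|[]]; last by exists z.
  by rewrite -lerBlDl (le_trans (ler_norm _)) // (oscJ J z z).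
have y01' : 0 <= y < total_len (RV 0%N) by rewrite one.
apply: le_trans (birkhoff_le_floors tw c0 gc y01' vis) _.
rewrite ler_wpM2l ?mulr_ge0 // -/flen.
pose b J := Num.max (c J - 2 * theta) 0.
have b0 J : 0 <= b J by rewrite le_max lexx orbT.
have bf J w : 0 < b J -> infl J w -> dom w /\ b J <= f w.
  rewrite /b lt_max ltxx orbF /c; case: asboolP => [[z Jz fz] bJ Jw|_ bJ]; last by exfalso; lra.
  have dw := domJ J z w Jz fz Jw; split=> //.
  rewrite ge_max (ltW (roof_gt0 hf dw)) andbT.
  have := oscJ J z w Jz fz Jw; rewrite distrC => /(le_trans (ler_norm _)); lra.
have sumb := sum_floors_le_integral hf tw d_gt0 b0 bf.
rewrite Iint lee_fin in sumb.
have sumlen : \sum_J flen J = 1.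
  rewrite -[RHS]subr0 -one -(sum_floors tw id).
  by apply: eq_bigr => J _; rewrite addrAC subrr add0r.
apply: (@le_trans _ _ (\sum_J (b J * flen J + 2 * theta * flen J))).
  apply: ler_sum => J _; have cb : c J <= b J + 2 * theta.
    by rewrite -lerBlDr le_max lexx.
  have -> : b J * flen J + 2 * theta * flen J = (b J + 2 * theta) * flen J by ring.
  by rewrite ler_wpM2r // ltW.
by rewrite big_split -mulr_sumr sumlen mulr1 lerD2r.
Qed.

End FarPart.

(** The gap between 2 and the integral absorbs the errors of the far part and
    all near points, except for at most [K] closest points on each side of each
    singularity; these are what the constant counts. *)
Lemma roof_sum : exists2 const : R, 0 < const &
  (\int[@lebesgue_measure R]_(x in `[0%R, 1%R]) (f x)%:E < 2%:E)%E ->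
  exists l0, forall l, (l0 <= l)%N -> forall (r : nat) (y : R),
  (mh l <= r < mh l.+1)%N -> 0 <= y < 1 -> avoids l y ->
  (forall i, (i < r)%N -> dom (iter i F y)) ->
  birkhoff F f r y
    <= 2 * r%:R + const * orbit_max (RV 0%N) (fun b z => `|ln `|z - b| |) r y.
Proof.
have one := bl_one bl.
have [C [del [C0 del0 flog]]] := roof_le_log one hf.
have [Mf [Mf0 fosc]] := roof_oscillation one hf.
have K0 : 0 <= K by exact: traverse_bound_ge0 bl.
pose const := 2 * d%:R * C * K + 1.
have const0 : 0 <= 2 * d%:R * C * K.
  by apply: mulr_ge0 => //; rewrite !mulr_ge0 // ltW.
exists const; first by rewrite /const; lra.
move=> int2.
have int0 : (0 <= \int[@lebesgue_measure R]_(x in `[0%R, 1%R]) (f x)%:E)%E.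
  rewrite (integral_roof_dom hf d_gt0); apply: integral_ge0 => x dx.
  by rewrite lee_fin ltW // (roof_gt0 hf).
have [I IE] : exists I : R, (\int[@lebesgue_measure R]_(x in `[0%R, 1%R]) (f x)%:E = I%:E)%E.
  by move: int0 int2; case: (integral _ _ _) => [I _ _|_ //|//]; exists I.
rewrite IE lte_fin in int2; rewrite IE lee_fin in int0.
pose ga := 2 - I; have ga0 : 0 < ga by rewrite /ga; lra.
have ga2 : ga <= 2 by rewrite /ga; lra.
(* With these fractions of the gap, [(1 + eta) * (I + 2 * theta)] stays below
   [2 - ga / 2]. *)
pose theta := ga / 8; have theta0 : 0 < theta by rewrite divr_gt0.
pose eta := ga / 16; have eta0 : 0 < eta by rewrite divr_gt0.
(* At distance [M] times the length of a floor, the oscillation bound [Mf / M]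
   is at most [theta]. *)
pose M := Mf / theta + 1.
have M0 : 0 < M by rewrite ltr_wpDl // divr_ge0 // ltW.
have M10 : 0 < M + 1 by rewrite addr_gt0.
have [L equi] := floor_equidist bl eta0.
have [l1 nearS] := near_sum_le bl htau htau' hnorm erefl L M0 (@ltr01 R).
have dC0 : 0 < 8 * (d%:R * C) + 1 :> R by rewrite ltr_wpDl // !mulr_ge0 // ltW.
have e0 : 0 < ga / (8 * (d%:R * C) + 1) by rewrite divr_gt0.
have [l2 sq] := sqrt_len_log_small L M10 e0.
have [l3 small1] := total_len_small bl htau htau' hnorm M L (@ltr01 R).
have del20 : 0 < Num.min (del / 2) 1 by rewrite lt_min ltr01 divr_gt0.
have [l4 small2] := total_len_small bl htau htau' hnorm (M + 1) L del20.
exists (maxn (maxn L l1) (maxn l2 (maxn l3 l4))) => l.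
rewrite !geq_max => /andP[/andP[Ll ll1] /andP[/sq {}sq /andP[/small1 Ml1 /small2]]].
rewrite le_min => /andP[rdel r1] r y Hr y01 av domi.
set rho := (M + 1) * lam (l - L) in sq rdel r1.
have lam0 : 0 < lam (l - L) by exact: rv_total_len_gt0 RVstep _.
have rho0 : 0 < rho by rewrite mulr_gt0.
have /andP[H1 H2] := Hr.
have r0n : (0 < r)%N by rewrite (leq_trans (max_height_gt0 bl l)).
have r0 : 0 < r%:R :> R by rewrite ltr0n.
set B := orbit_max _ _ _ _.
have B0 : 0 <= B by exact: orbit_max_ge0.
have Bge k i : (0 < k < d)%N -> (i < r)%N -> `|ln `|iter i F y - a k| | <= B.
  by move=> kd ir; exact: (orbit_max_ge (fun b z => `|ln `|z - b| |)).
have vis J := proj2 (andP (equi l Ll r y J H1 y01)).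
have eta1 : 0 <= 1 + eta by rewrite addr_ge0 // ltW.
have osc y1 z1 : 0 <= y1 <= z1 -> z1 <= 1 ->
    (forall w k, y1 <= w <= z1 -> (0 < k < d)%N -> M * lam (l - L) <= `|w - a k|) ->
    z1 - y1 <= lam (l - L) -> `|f z1 - f y1| <= theta.
  move=> h1 h2 h3 h4; apply: le_trans (fosc (M * lam (l - L)) y1 z1 _ h1 h2 h3) _.
    by rewrite mulr_gt0.
  apply: (@le_trans _ _ (Mf / (M * lam (l - L)) * lam (l - L))).
    by rewrite ler_wpM2l // divr_ge0 // mulr_ge0 // ltW.
  rewrite invfM mulrA divfK ?gt_eqF // ler_pdivrMr // /M.
  have -> : theta * (Mf / theta + 1) = Mf + theta.
    by field; rewrite gt_eqF.
  by rewrite lerDl ltW.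
have farle := birkhoff_roof_far_le M0 theta0 eta1 osc y01 IE vis.
pose near s k z := 0 < s * (z - a k) <= rho.
pose g s k z := if near s k z then `|ln `|z - a k| | else 0.
have dist s k z : s ^+ 2 = 1 -> 0 < s * (z - a k) -> `|z - a k| = s * (z - a k).
  move=> s1 h; rewrite -[RHS]ger0_norm ?(ltW h) // normrM.
  by case: (sign_cases s1) => ->; rewrite ?normrN normr1 mul1r.
have gle s k : s ^+ 2 = 1 -> (0 < k < d)%N ->
    birkhoff F (g s k) r y <= 2 * Num.sqrt rho * (r%:R * ln r%:R) + K * B.
  move=> s1 kd.
  have psi0 : 0 <= 2 * Num.sqrt rho by rewrite mulr_ge0 // sqrtr_ge0.
  have := nearS l ll1 r k y s (2 * Num.sqrt rho) B (fun z => `|ln `|z - a k| |)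
    Hr y01 av kd s1 psi0 B0 (fun z => normr_ge0 _).
  rewrite /= mulr1; apply.
    move=> z /andP[z0 zr]; rewrite (dist s k z s1 z0); set t := s * (z - a k) in z0 zr *.
    have t1 : 0 < t <= 1 by rewrite z0 (le_trans zr).
    apply: le_trans (abs_ln_le_sqrt t1) _.
    have st0 : 0 < Num.sqrt t by rewrite sqrtr_gt0.
    have -> : 2 / Num.sqrt t = 2 * Num.sqrt t / t.
      rewrite -[Z in _ = _ / Z](sqr_sqrtr (ltW z0)).
      by move: (Num.sqrt t) st0 => q q0; field; rewrite gt_eqF.
    by rewrite ler_wpM2r ?invr_ge0 ?(ltW z0) // ler_wpM2l // ler_wsqrtr.
  by move=> i ir _; exact: Bge.
have s1p : (1 : R) ^+ 2 = 1 by rewrite expr1n.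
have s1m : (-1 : R) ^+ 2 = 1 by rewrite sqrrN expr1n.
have g0 s k z : 0 <= g s k z by rewrite /g; case: ifP.
have pointwise i : (i < r)%N -> let z := iter i F y in
    f z <= (if far_from_sing M L l z then f z else 0)
           + \sum_(1 <= k < d) C * (g 1 k z + g (-1) k z).
  move=> ir /=; have := domi i ir; set z := iter i F y => dz.
  have sum0 : 0 <= \sum_(1 <= k < d) C * (g 1 k z + g (-1) k z).
    by apply: sumr_ge0 => k _; rewrite mulr_ge0 ?(ltW C0) // addr_ge0.
  case: ifP => [_|/negbT]; first by rewrite lerDl.
  rewrite negb_forall => /existsP[k]; rewrite negb_imply -leNgt => /andP[k0 zk].
  rewrite -/rho in zk; have kd : (0 < k < d)%N by rewrite k0 ltn_ord.
  have zk0 : 0 < `|z - a k|.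
    by rewrite normr_gt0 subr_eq0; case: dz => _ /(_ k kd).
  have := flog k z kd; rewrite zk0 /= => fz.
  rewrite add0r (bigD1_seq (k : nat)) ?mem_index_iota ?iota_uniq //=.
  apply: le_trans (fz _) _; first by lra.
  rewrite -[leLHS]addr0; apply: lerD; last first.
    by apply: sumr_ge0 => k' _; rewrite mulr_ge0 ?(ltW C0) // addr_ge0.
  rewrite ler_wpM2l ?(ltW C0) //.
  case: (ltgtP z (a k)) => [lt|gt|E]; last by rewrite E subrr normr0 ltxx in zk0.
    have dE : `|z - a k| = -1 * (z - a k) by rewrite ltr0_norm ?mulN1r // subr_lt0.
    by rewrite [in Z in _ <= _ + Z]/g /near -dE zk0 zk lerDr.
  have dE : `|z - a k| = 1 * (z - a k) by rewrite gtr0_norm ?mul1r // subr_gt0.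
  by rewrite [in Z in _ <= Z + _]/g /near -dE zk0 zk lerDl.
have step1 : birkhoff F f r y
    <= birkhoff F (fun z => if far_from_sing M L l z then f z else 0) r y
       + \sum_(1 <= k < d) C * (birkhoff F (g 1 k) r y + birkhoff F (g (-1) k) r y).
  rewrite /birkhoff.
  have -> : \sum_(1 <= k < d) C * (\sum_(i < r) g 1 k (iter i F y) + \sum_(i < r) g (-1) k (iter i F y))
      = \sum_(i < r) \sum_(1 <= k < d) C * (g 1 k (iter i F y) + g (-1) k (iter i F y)).
    rewrite exchange_big /=; apply: eq_bigr => k _.
    by rewrite -big_split mulr_sumr.
  rewrite -big_split; apply: ler_sum => i _; exact: pointwise.
apply: le_trans step1 _.
set W := 2 * Num.sqrt rho * (r%:R * ln r%:R) + K * B in gle.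
have W0 : 0 <= W.
  rewrite addr_ge0 // ?mulr_ge0 ?sqrtr_ge0 // ?(ltW r0) //.
  by rewrite ln_ge0 // ler1n.
have nearsum : \sum_(1 <= k < d) C * (birkhoff F (g 1 k) r y + birkhoff F (g (-1) k) r y)
    <= d%:R * (C * (2 * W)).
  apply: (@le_trans _ _ (\sum_(1 <= k < d) C * (2 * W))).
    rewrite big_seq [leRHS]big_seq; apply: ler_sum => k; rewrite mem_index_iota => kd.
    rewrite ler_wpM2l ?(ltW C0) //.
    by have := gle 1 k s1p kd; have := gle (-1) k s1m kd; lra.
  rewrite sumr_const_nat -[leLHS]mulr_natl ler_wpM2r ?mulr_ge0 ?(ltW C0) //.
  by rewrite ler_nat leq_subr.
apply: le_trans (lerD farle nearsum) _.
have sqr : Num.sqrt rho * ln r%:R <= ga / (8 * (d%:R * C) + 1) by apply: sq; rewrite r0n.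
have sq2 : (8 * (d%:R * C) + 1) * (Num.sqrt rho * ln r%:R) <= ga.
  by rewrite mulrC -ler_pdivlMr.
have sl0 : 0 <= Num.sqrt rho * ln r%:R.
  by rewrite mulr_ge0 ?sqrtr_ge0 // ln_ge0 // ler1n.
have -> : d%:R * (C * (2 * W))
    = 4 * (d%:R * C) * (Num.sqrt rho * ln r%:R) * r%:R + (2 * d%:R * C * K) * B.
  by rewrite /W; ring.
have h1 : 4 * (d%:R * C) * (Num.sqrt rho * ln r%:R) <= ga / 2.
  move: sq2 sl0; move: (Num.sqrt rho * _) => q; lra.
have h2 : (1 + eta) * (I + 2 * theta) <= 2 - ga / 2.
  have -> : I = 2 - ga by rewrite /ga; ring.
  rewrite /eta /theta; nra.
have h3 : (1 + eta) * r%:R * (I + 2 * theta) <= (2 - ga / 2) * r%:R.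
  by rewrite mulrAC ler_wpM2r // ltW.
have h4 : 4 * (d%:R * C) * (Num.sqrt rho * ln r%:R) * r%:R <= ga / 2 * r%:R.
  by rewrite ler_wpM2r // ltW.
have h5 : 2 * d%:R * C * K * B <= const * B by rewrite ler_wpM2r // /const lerDl.
have -> : 2 * r%:R = (2 - ga / 2) * r%:R + ga / 2 * r%:R :> R by ring.
by rewrite addrA lerD // lerD.
Qed.

End RoofSum.

(** * Birkhoff sums of the derivatives *)

Section SumsOfDerivatives.
Context {R : realType} {d : nat} {T : iet R d} {f : R -> R} {Cp Cm : nat -> R}.
Hypothesis T1 : total_len T = 1.
Hypothesis hf : asym_log_sing T f Cp Cm.

Local Notation F := (iet_map T).
Local Notation D := (roof_dom T).
Local Notation f1 := (deriv_on D f).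
Local Notation f2 := (deriv_on D f1).
Local Notation a := (endpt T).

Lemma birkhoff_sum_range (g : nat -> R -> R) r y :
  birkhoff F (fun z => \sum_(1 <= k < d) g k z) r y
  = \sum_(1 <= k < d) birkhoff F (g k) r y.
Proof. by rewrite /birkhoff exchange_big. Qed.

Lemma birkhoff_near (g h : R -> R) M r y :
  (forall i, (i < r)%N -> `|g (iter i F y) - h (iter i F y)| <= M) ->
  `|birkhoff F g r y - birkhoff F h r y| <= M * r%:R.
Proof.
move=> gh; rewrite /birkhoff -sumrB; apply: le_trans (ler_norm_sum _ _ _) _.
rewrite -[r in leRHS]card_ord mulr_natr -sumr_const; apply: ler_sum => i _.
exact: gh.
Qed.

Lemma birkhoff_deriv1 : exists M, 0 <= M /\ forall r y,
  (forall i, (i < r)%N -> D (iter i F y)) ->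
  `|birkhoff F f1 r y + \sum_(1 <= k < d) (Cp k * birkhoff F (cusp 1 (a k)) r y
       - Cm k * birkhoff F (cusp (-1) (a k)) r y)| <= M * r%:R.
Proof.
have [M [M0 hM]] := roof_deriv1_le T1 hf; exists M; split=> // r y dom.
have -> : \sum_(1 <= k < d) (Cp k * birkhoff F (cusp 1 (a k)) r y
       - Cm k * birkhoff F (cusp (-1) (a k)) r y)
   = - birkhoff F (fun z => - \sum_(1 <= k < d) cusp_sum1 (T := T) (Cp := Cp) (Cm := Cm) k z) r y.
  rewrite /birkhoff sumrN opprK -/(birkhoff F _ r y).
  rewrite -[RHS]/(birkhoff F (fun z => \sum_(1 <= k < d) cusp_sum1 (T := T) (Cp := Cp) (Cm := Cm) k z) r y).
  rewrite birkhoff_sum_range; apply: eq_bigr => k _.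
  by rewrite /birkhoff !mulr_sumr -sumrB.
by apply: birkhoff_near => i ir; rewrite opprK; exact: hM (dom i ir).
Qed.

Lemma birkhoff_deriv2 : exists M, 0 <= M /\ forall r y,
  (forall i, (i < r)%N -> D (iter i F y)) ->
  `|birkhoff F f2 r y - \sum_(1 <= k < d)
      (Cp k * birkhoff F (fun z => cusp 1 (a k) z ^+ 2) r y
       + Cm k * birkhoff F (fun z => cusp (-1) (a k) z ^+ 2) r y)| <= M * r%:R.
Proof.
have [M [M0 hM]] := roof_deriv2_le T1 hf; exists M; split=> // r y dom.
have -> : \sum_(1 <= k < d) (Cp k * birkhoff F (fun z => cusp 1 (a k) z ^+ 2) r y
       + Cm k * birkhoff F (fun z => cusp (-1) (a k) z ^+ 2) r y)
   = birkhoff F (fun z => \sum_(1 <= k < d) cusp_sum2 (T := T) (Cp := Cp) (Cm := Cm) k z) r y.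
  rewrite birkhoff_sum_range; apply: eq_bigr => k _.
  by rewrite /birkhoff !mulr_sumr -big_split.
by apply: birkhoff_near => i ir; exact: hM (dom i ir).
Qed.

Lemma birkhoff_sqr_le (g : R -> R) b r y : (forall z, 0 <= g z) ->
  (forall i, (i < r)%N -> g (iter i F y) <= b) ->
  birkhoff F (fun z => g z ^+ 2) r y <= b * birkhoff F g r y.
Proof.
move=> g0 gb; rewrite /birkhoff mulr_sumr; apply: ler_sum => i _.
by rewrite expr2 ler_wpM2r // gb.
Qed.

Lemma ler_sum_range (g h : nat -> R) :
  (forall k, (0 < k < d)%N -> g k <= h k) ->
  \sum_(1 <= k < d) g k <= \sum_(1 <= k < d) h k.
Proof.
move=> gh; rewrite big_seq [leRHS]big_seq; apply: ler_sum => k.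
by rewrite mem_index_iota => kd; exact: gh.
Qed.

Lemma sumC_ge0 : 0 <= sumC d Cp /\ 0 <= sumC d Cm.
Proof.
split; rewrite /sumC big_seq; apply: sumr_ge0 => k;
  by rewrite mem_index_iota => /(als_const_gt0 hf)[/ltW ? /ltW ?].
Qed.

(** The bounds for the sums of the two derivatives follow from those for the
    sums of the one-sided singularities by linearity. *)
Lemma deriv1_bounds M e rl KU KV r y :
  `|birkhoff F f1 r y + \sum_(1 <= k < d) (Cp k * birkhoff F (cusp 1 (a k)) r y
       - Cm k * birkhoff F (cusp (-1) (a k)) r y)| <= M ->
  (forall k, (0 < k < d)%N ->
     (1 - e) * rl <= birkhoff F (cusp 1 (a k)) r y <= (1 + e) * rl + KU) ->
  (forall k, (0 < k < d)%N ->
     (1 - e) * rl <= birkhoff F (cusp (-1) (a k)) r y <= (1 + e) * rl + KV) ->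
  birkhoff F f1 r y <= M + (- sumC d Cp + sumC d Cm) * rl
     + e * rl * (sumC d Cp + sumC d Cm) + sumC d Cm * KV /\
  (- sumC d Cp + sumC d Cm) * rl - M - e * rl * (sumC d Cp + sumC d Cm)
     - sumC d Cp * KU <= birkhoff F f1 r y.
Proof.
set A := \sum_(1 <= k < d) _; rewrite ler_norml => /andP[h1 h2] hp hm.
have Alow : sumC d Cp * ((1 - e) * rl) - sumC d Cm * ((1 + e) * rl + KV) <= A.
  rewrite /sumC !mulr_suml -sumrB; apply: ler_sum_range => k kd.
  have [p0 m0] := als_const_gt0 hf kd.
  have /andP[p1 p2] := hp k kd; have /andP[m1 m2] := hm k kd.
  by apply: lerB; rewrite ler_wpM2l // ltW.
have Aupp : A <= sumC d Cp * ((1 + e) * rl + KU) - sumC d Cm * ((1 - e) * rl).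
  rewrite /sumC !mulr_suml -sumrB; apply: ler_sum_range => k kd.
  have [p0 m0] := als_const_gt0 hf kd.
  have /andP[p1 p2] := hp k kd; have /andP[m1 m2] := hm k kd.
  by apply: lerB; rewrite ler_wpM2l // ltW.
move: (sumC d Cp) (sumC d Cm) (birkhoff _ _ _ _) Alow Aupp h1 h2 => p m b *.
split; lra.
Qed.

Lemma deriv2_bound M e rl KU KV U V r y :
  `|birkhoff F f2 r y - \sum_(1 <= k < d)
      (Cp k * birkhoff F (fun z => cusp 1 (a k) z ^+ 2) r y
       + Cm k * birkhoff F (fun z => cusp (-1) (a k) z ^+ 2) r y)| <= M ->
  0 <= U -> 0 <= V ->
  (forall k i, (0 < k < d)%N -> (i < r)%N -> cusp 1 (a k) (iter i F y) <= U) ->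
  (forall k i, (0 < k < d)%N -> (i < r)%N -> cusp (-1) (a k) (iter i F y) <= V) ->
  (forall k, (0 < k < d)%N -> birkhoff F (cusp 1 (a k)) r y <= (1 + e) * rl + KU) ->
  (forall k, (0 < k < d)%N -> birkhoff F (cusp (-1) (a k)) r y <= (1 + e) * rl + KV) ->
  0 <= KU -> 0 <= KV ->
  `|birkhoff F f2 r y| <= M + Num.max U V * (sumC d Cp + sumC d Cm)
    * ((1 + e) * rl + (KU + KV)).
Proof.
set A := \sum_(1 <= k < d) _ => hA U0 V0 cU cV sU sV KU0 KV0.
set m := Num.max U V; have m0 : 0 <= m by rewrite le_max U0.
have sq0 s k : 0 <= birkhoff F (fun z => cusp s (a k) z ^+ 2) r y.
  by apply: birkhoff_ge0 => z; rewrite exprn_ge0 // cusp_ge0.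
have Aupp : A <= m * (sumC d Cp + sumC d Cm) * ((1 + e) * rl + (KU + KV)).
  rewrite /sumC -big_split mulrAC mulr_sumr; apply: ler_sum_range => k kd /=.
  have [p0 q0] := als_const_gt0 hf kd; set t := (1 + e) * rl + (KU + KV).
  have h1 : birkhoff F (fun z => cusp 1 (a k) z ^+ 2) r y <= m * t.
    apply: (@le_trans _ _ (m * birkhoff F (cusp 1 (a k)) r y)).
      apply: birkhoff_sqr_le => [z|i ir]; first exact: cusp_ge0.
      by rewrite le_max (cU k i kd ir).
    by rewrite ler_wpM2l //; apply: le_trans (sU k kd) _; rewrite /t; lra.
  have h2 : birkhoff F (fun z => cusp (-1) (a k) z ^+ 2) r y <= m * t.
    apply: (@le_trans _ _ (m * birkhoff F (cusp (-1) (a k)) r y)).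
      apply: birkhoff_sqr_le => [z|i ir]; first exact: cusp_ge0.
      by rewrite le_max (cV k i kd ir) orbT.
    by rewrite ler_wpM2l //; apply: le_trans (sV k kd) _; rewrite /t; lra.
  have -> : m * t * (Cp k + Cm k) = Cp k * (m * t) + Cm k * (m * t) by ring.
  by apply: lerD; rewrite ler_wpM2l // ltW.
have A0 : 0 <= A.
  rewrite /A big_seq; apply: sumr_ge0 => k; rewrite mem_index_iota => kd.
  have [p0 q0] := als_const_gt0 hf kd.
  by rewrite addr_ge0 // mulr_ge0 ?sq0 // ltW.
have := ler_normD (birkhoff F f2 r y - A) A; rewrite subrK => /le_trans; apply.
by rewrite (ger0_norm A0) lerD.
Qed.

End SumsOfDerivatives.

Lemma uniform_below (d : nat) (P : nat -> nat -> Prop) :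
  (forall k, (0 < k < d)%N -> exists l0, forall l, (l0 <= l)%N -> P k l) ->
  exists l0, forall l, (l0 <= l)%N -> forall k, (0 < k < d)%N -> P k l.
Proof.
move=> H; suff [l0 h] : exists l0, forall l, (l0 <= l)%N ->
    forall k, (k < d)%N -> (0 < k < d)%N -> P k l.
  by exists l0 => l ll k kd; apply: h => //; case/andP: kd.
move: {1}d => N; elim: N => [|N [l0 IH]]; first by exists 0%N.
case: (boolP (0 < N < d)%N) => Nd; last first.
  exists l0 => l ll k; rewrite ltnS leq_eqVlt => /orP[/eqP->|kN]; last exact: IH.
  by rewrite (negbTE Nd).
have [l1 h1] := H N Nd; exists (maxn l0 l1) => l; rewrite geq_max => /andP[ll0 ll1] k.
by rewrite ltnS leq_eqVlt => /orP[/eqP->|kN] kd; [exact: h1|exact: IH].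
Qed.

Lemma cusp_le_aux_u (R : realType) (a y U : R) : 0 <= U -> aux_u a y <= U -> cusp 1 a y <= U.
Proof. by move=> U0; rewrite /aux_u /cusp mul1r subr_gt0; case: ifP. Qed.

Lemma cusp_le_aux_v (R : realType) (a y V : R) : 0 <= V -> aux_v a y <= V -> cusp (-1) a y <= V.
Proof. by move=> V0; rewrite /aux_v /cusp mulN1r [- (y - a)]opprB subr_gt0; case: ifP. Qed.

Theorem theorem5p5 (R : realType) (d : nat) (T : iet R d) (RV : nat -> iet R d)
    (tau : R) (n : nat -> nat) (kappa tau' : R) (f : R -> R)
    (Cp Cm : nat -> R)
    (hT : total_len T = 1)
    (hS : rauzy_veech T RV)
    (htau : 1 < tau < 2)
    (hdio : mixing_diophantine RV tau n kappa)
    (htau' : tau / 2 < tau' < 1)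
    (hf : asym_log_sing T f Cp Cm) :
  let Cplus := sumC d Cp in
  let Cminus := sumC d Cm in
  let C := - Cplus + Cminus in
  let f1 := deriv_on (roof_dom T) f in
  let f2 := deriv_on (roof_dom T) f1 in
  let U := orbit_max T (@aux_u R) in
  let V := orbit_max T (@aux_v R) in
  let K : R := (Num.floor kappa)%:~R + 2 in
  exists2 const : R, 0 < const &
  forall eps : R, 0 < eps ->
  exists2 rbar : nat, (0 < rbar)%N &
  forall (r l : nat) (x : R),
    (rbar <= r)%N ->
    (max_height RV (n l) <= r < max_height RV (n l.+1))%N ->
    0 <= x < 1 -> ~ Sigma RV n tau' l x -> ~ singular T r x ->
    let rlogr : R := r%:R * ln r%:R in
    [/\ (\int[lebesgue_measure]_(y in `[0%R, 1%R]) (f y)%:E < 2%:E)%E ->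
        birkhoff (iet_map T) f r x
          <= 2 * r%:R + const * orbit_max T (fun a y => `|ln `|y - a| |) r x,
        birkhoff (iet_map T) f1 r x
          <= (C + eps) * rlogr + (Cminus + 1) * K * V r x,
        birkhoff (iet_map T) f1 r x
          >= (C - eps) * rlogr - (Cplus + 1) * K * U r x
      & `|birkhoff (iet_map T) f2 r x|
          <= (2 * Num.max (U r x) (V r x) + 1) * (Cplus + Cminus + eps)
             * (rlogr + K * (U r x + V r x))].
Proof.
case: hS => RV0 hS; subst T.
case: hdio => nmono [kappa1 [nu [D [D' [lbar [nu1 D01 D'0 hl hnorm]]]]]].
have bl : balanced RV n kappa nu D D' lbar.
  split=> // [l i j|l i j|l i j|l b c b0 c0].
  - by have [h _ _ _] := hl l; exact: h.
  - by have [_ h _ _] := hl l; exact: h.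
  - by have [_ _ h _] := hl l; exact: h.
  - by have [_ _ _ h] := hl l; exact: h.
move=> Cplus Cminus C f1 f2 U V K.
have K0 : 0 <= K by exact: traverse_bound_ge0 bl.
have [const const0 roof] := roof_sum bl htau htau' hnorm hf.
exists const => // eps eps0.
have [Cp0 Cm0] := sumC_ge0 hf.
rewrite -/Cplus in Cp0; rewrite -/Cminus in Cm0.
have [M1 [M10 B1]] := birkhoff_deriv1 hT hf.
have [M2 [M20 B2]] := birkhoff_deriv2 hT hf.
(* Half of [eps] pays for the relative error [e] of the sums of the singular
   parts, the other half for the bounded parts of the derivatives. *)
pose e := Num.min 1 (eps / (2 * (Cplus + Cminus + 1))).
have S0 : 0 < 2 * (Cplus + Cminus + 1) by lra.
have e0 : 0 < e by rewrite lt_min ltr01 divr_gt0.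
have e1 : e <= 1 by rewrite ge_min lexx.
have e01 : 0 < e <= 1 by rewrite e0.
have eS : e * (Cplus + Cminus) <= eps / 2.
  have : e <= eps / (2 * (Cplus + Cminus + 1)) by rewrite ge_min lexx orbT.
  rewrite ler_pdivlMr //; nra.
have [lu hu] := uniform_below (fun k kd => cusp_sum bl htau htau' hnorm kd (expr1n R 2) e01).
have m1 : (-1 : R) ^+ 2 = 1 by rewrite sqrrN expr1n.
have [lv hv] := uniform_below (fun k kd => cusp_sum bl htau htau' hnorm kd m1 e01).
have CM0 : 0 <= 2 * (M1 + M2) / eps by rewrite divr_ge0 ?mulr_ge0 ?addr_ge0 // ltW.
have [lx hx] := scales bl htau htau' hnorm 0 CM0 (@ltr01 R).
have [lf hroof] : exists l0, forall l, (l0 <= l)%N ->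
    (\int[@lebesgue_measure R]_(y in `[0%R, 1%R]) (f y)%:E < 2%:E)%E ->
    forall (r : nat) (y : R),
    (max_height RV (n l) <= r < max_height RV (n l.+1))%N -> 0 <= y < 1 ->
    avoids (RV := RV) (n := n) (tau' := tau') l y ->
    (forall i, (i < r)%N -> roof_dom (RV 0%N) (iter i (iet_map (RV 0%N)) y)) ->
    birkhoff (iet_map (RV 0%N)) f r y
    <= 2 * r%:R + const * orbit_max (RV 0%N) (fun b z => `|ln `|z - b| |) r y.
  case: (pselect (\int[@lebesgue_measure R]_(y in `[0%R, 1%R]) (f y)%:E < 2%:E)%E) => hi.
    by have [l0 h] := roof hi; exists l0 => l ll _; exact: h.
  by exists 0%N.
pose l0 := maxn (maxn lu lv) (maxn lx lf).
(* If [r] exceeds all heights of index at most [l0], then the level [l] with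
   [r < max_height RV (n l.+1)] is at least [l0]. *)
exists (\max_(l < l0) max_height RV (n l.+1)).+1 => // r l x rr Hr x01 nS nsing.
have ll0 : (l0 <= l)%N.
  rewrite leqNgt; apply/negP => ll; case/andP: Hr => _.
  rewrite ltnNge => /negP; apply; apply: ltnW; apply: leq_trans rr; rewrite ltnS.
  exact: (leq_bigmax (Ordinal ll)).
move: ll0; rewrite !geq_max => /andP[/andP[/hu {}hu /hv {}hv] /andP[/hx [Q [[_ _ CX] _]] /hroof {}hroof]].
move=> rlogr; have /andP[H1 H2] := Hr.
have r0n : (0 < r)%N by rewrite (leq_trans (max_height_gt0 bl l)).
have r0 : 0 < r%:R :> R by rewrite ltr0n.
have Xr : ln (max_height RV (n l))%:R <= ln r%:R :> R.
  by apply: ler_ln_imp; rewrite ?ltr0n ?(max_height_gt0 bl) // ler_nat.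
have lr0 : 0 <= ln r%:R :> R by rewrite ln_ge0 // ler1n.
have rl0 : 0 <= rlogr by rewrite mulr_ge0 // ltW.
have av : avoids (RV := RV) (n := n) (tau' := tau') l x.
  move=> k i kd ir; rewrite ltNge; apply/negP => h; apply: nS.
  exists k => //; exists i; first by rewrite /= floor_ge_int.
  split=> //; have := @iter_iet_range _ _ (RV 0%N) x i.
  by rewrite hT => /(_ x01) /andP[-> /ltW->].
have domi i : (i < r)%N -> roof_dom (RV 0%N) (iter i (iet_map (RV 0%N)) x).
  move=> ir; split.
    have := @iter_iet_range _ _ (RV 0%N) x i.
    by rewrite hT => /(_ x01) /andP[-> /ltW->].
  by move=> k kd; apply/negP => /eqP E; apply: nsing; exists i, k.
have U0 : 0 <= U r x by exact: orbit_max_ge0.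
have V0 : 0 <= V r x by exact: orbit_max_ge0.
have cU k i : (0 < k < d)%N -> (i < r)%N ->
    cusp 1 (endpt (RV 0%N) k) (iter i (iet_map (RV 0%N)) x) <= U r x.
  by move=> kd ir; apply: cusp_le_aux_u => //; exact: orbit_max_ge.
have cV k i : (0 < k < d)%N -> (i < r)%N ->
    cusp (-1) (endpt (RV 0%N) k) (iter i (iet_map (RV 0%N)) x) <= V r x.
  by move=> kd ir; apply: cusp_le_aux_v => //; exact: orbit_max_ge.
have hu' k : (0 < k < d)%N -> (1 - e) * rlogr
    <= birkhoff (iet_map (RV 0%N)) (cusp 1 (endpt (RV 0%N) k)) r x
    <= (1 + e) * rlogr + K * U r x.
  by move=> kd; apply: (hu k kd r x (U r x) Hr x01 av U0) => i; exact: cU.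
have hv' k : (0 < k < d)%N -> (1 - e) * rlogr
    <= birkhoff (iet_map (RV 0%N)) (cusp (-1) (endpt (RV 0%N) k)) r x
    <= (1 + e) * rlogr + K * V r x.
  by move=> kd; apply: (hv k kd r x (V r x) Hr x01 av V0) => i; exact: cV.
have Msmall : (M1 + M2) * r%:R <= eps / 2 * rlogr.
  rewrite /rlogr mulrCA [leLHS]mulrC ler_wpM2l ?(ltW r0) //.
  have := le_trans CX Xr; rewrite ler_pdivrMr //; lra.
have M1r0 : 0 <= M1 * r%:R by rewrite mulr_ge0.
have M2r0 : 0 <= M2 * r%:R by rewrite mulr_ge0.
have M12 : (M1 + M2) * r%:R = M1 * r%:R + M2 * r%:R by ring.
rewrite M12 in Msmall.
have KU0 : 0 <= K * U r x by rewrite mulr_ge0.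
have KV0 : 0 <= K * V r x by rewrite mulr_ge0.
have [up low] := deriv1_bounds hf (B1 r x domi) hu' hv'.
have two := deriv2_bound hf (B2 r x domi) U0 V0 cU cV
  (fun k kd => proj2 (andP (hu' k kd))) (fun k kd => proj2 (andP (hv' k kd))) KU0 KV0.
have erl : e * rlogr * (Cplus + Cminus) <= eps / 2 * rlogr.
  by rewrite mulrAC ler_wpM2r.
split.
- by move=> hi; exact: hroof.
- apply: le_trans up _; rewrite -/Cplus -/Cminus -/C.
  have -> : (C + eps) * rlogr + (Cminus + 1) * K * V r x
    = C * rlogr + eps * rlogr + Cminus * (K * V r x) + K * V r x by ring.
  lra.
- apply: le_trans low; rewrite -/Cplus -/Cminus -/C.
  have -> : (C - eps) * rlogr - (Cplus + 1) * K * U r x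
    = C * rlogr - eps * rlogr - Cplus * (K * U r x) - K * U r x by ring.
  lra.
- apply: le_trans two _; rewrite -/Cplus -/Cminus.
  set m := Num.max _ _; have m0 : 0 <= m by rewrite le_max U0.
  have -> : (2 * m + 1) * (Cplus + Cminus + eps) * (rlogr + K * (U r x + V r x))
    = m * (Cplus + Cminus) * (2 * rlogr + 2 * (K * U r x + K * V r x))
      + 2 * m * eps * (rlogr + (K * U r x + K * V r x))
      + (Cplus + Cminus) * (rlogr + (K * U r x + K * V r x))
      + eps * rlogr + eps * (K * U r x + K * V r x) by ring.
  have KUV0 : 0 <= K * U r x + K * V r x by exact: addr_ge0.
  have g1 : 0 <= 2 * m * eps * (rlogr + (K * U r x + K * V r x)).
    by rewrite !mulr_ge0 ?addr_ge0 // ltW.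
  have g2 : 0 <= (Cplus + Cminus) * (rlogr + (K * U r x + K * V r x)).
    by rewrite mulr_ge0 ?addr_ge0.
  have g3 : 0 <= eps * (K * U r x + K * V r x) by rewrite mulr_ge0 // ltW.
  have g4 : m * (Cplus + Cminus) * ((1 + e) * rlogr + (K * U r x + K * V r x))
      <= m * (Cplus + Cminus) * (2 * rlogr + 2 * (K * U r x + K * V r x)).
    rewrite ler_wpM2l ?mulr_ge0 ?addr_ge0 //; nra.
  have g5 : 0 <= eps / 2 * rlogr by rewrite mulr_ge0 // divr_ge0 // ltW.
  lra.
Qed.
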